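(* Let $X=\Pi\backslash B(\mathbb C^2)$. The automorphism of $X$ induced by $j^4$, that is, $\Pi z\mapsto\Pi(j^4.z)$, has exactly $9$ fixed points. These are the three points $\Pi(b^\mu.0)$, $\mu=0,1,-1$, and six points $\Pi(h_i.z_0)$, where $h_i\in\Gamma$ for $i=1,\ldots,6$, and where $z_0\in B(\mathbb C^2)$ is the unique fixed point of $buv$.
   Context: Let $\zeta=e^{2\pi i/12}$, $r=\zeta+\zeta^{-1}=\sqrt3$, and $$F=\begin{pmatrix}-r-1&1&0\\1&1-r&0\\0&0&1\end{pmatrix}.$$ Let $\Gamma=\{g\in M_{3\times3}(\mathbb Z[\zeta]):g^*Fg=F\}/Z$, where $g^*$ is the conjugate transpose of $g$ and $Z=\{\zeta^\nu I:\nu=0,1,\ldots,11\}$. Elements $gZ$ of $\Gamma$ are denoted by matrix representatives $g$. Action on the ball: let $B(\mathbb C^2)=\{(z_1,z_2)\in\mathbb C^2:|z_1|^2+|z_2|^2<1\}$, with origin denoted $0$. Let $$\gamma_0=\begin{pmatrix}1&0&0\\1&1-r&0\\0&0&1\end{pmatrix},\qquad D=\mathrm{diag}\bigl(1,1,\sqrt{\sqrt3-1}\bigr),$$ and $\tilde g=D\gamma_0g\gamma_0^{-1}D^{-1}$, which is unitary with respect to $\mathrm{diag}(1,1,-1)$. Then $(gZ).(z,w)=(z',w')$ if $\tilde g(z,w,1)^T=\lambda(z',w',1)^T$ for some $\lambda\in\mathbb C$; one writes $g.(z,w)$ for $(gZ).(z,w)$. The following matrices define elements of $\Gamma$: $$u=\begin{pmatrix}\zeta^3+\zeta^2-\zeta&1-\zeta&0\\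 \zeta^3+\zeta^2-1&\zeta-\zeta^3&0\\0&0&1\end{pmatrix},\quad v=\begin{pmatrix}\zeta^3&0&0\\ \zeta^3+\zeta^2-\zeta-1&1&0\\0&0&1\end{pmatrix},$$ $$b=\begin{pmatrix}1&0&0\\-2\zeta^3-\zeta^2+2\zeta+2&\zeta^3+\zeta^2-\zeta-1&-\zeta^3-\zeta^2\\ \zeta^2+\zeta&-\zeta^3-1&-\zeta^3+\zeta+1\end{pmatrix}.$$ Let $j=(uv)^2$, which is the diagonal matrix with diagonal entries $\zeta,\zeta,1$. Let $\Pi$ be the subgroup of $\Gamma$ generated by $$a_1=vuv^{-1}j^4buvj^2,\qquad a_2=v^2ubuv^{-1}uv^2j,\qquad a_3=u^{-1}v^2uj^9bv^{-1}uv^{-1}j^8.$$ The element $j^4$ normalizes $\Pi$, so that it induces an automorphism of $X$. *)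

(* Defs.v *)
From HB Require Import structures.
From mathcomp Require Import all_boot all_order all_algebra.
From mathcomp Require Import boolp classical_sets functions cardinality reals.
From mathcomp Require Import trigo complex sesquilinear spectral ring lra.

Set Implicit Arguments.
Unset Strict Implicit.
Unset Printing Implicit Defensive.

Import Order.TTheory GRing.Theory Num.Theory.

Local Open Scope ring_scope.
Local Open Scope classical_set_scope.
Local Open Scope quotient_scope.
Local Open Scope sesquilinear_scope.

Section CyclotomicIntegers.
Variable R : realType.
Local Notation C := R[i].

Definition zeta : C := (cos (2 * pi / 12) +i* sin (2 * pi / 12))%C.

Definition Zzeta : pred C :=
  fun x => `[< exists p : {poly int}, x = (map_poly intr p).[zeta] >].

(* The real number r = sqrt 3; see [rhoE]. *)
Definition rho : C := zeta + zeta^-1.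

Lemma cos_pi6_gt0 : 0 < cos (2 * pi / 12) :> R.
Proof. by apply: cos_gt0_pihalf; have := pi_gt0 R; lra. Qed.

Lemma cos_pi6_sqr : cos (2 * pi / 12) ^+ 2 = 3 / 4 :> R.
Proof.
have := cos_pi6_gt0; have := cos2Dsin2 (2 * pi / 12 : R).
have : cos (2 * pi / 12 *+ 2 + 2 * pi / 12) = 0 :> R.
  by rewrite -[RHS]cos_pihalf; congr cos; field.
rewrite cosD cos_mulr2n sin_mulr2n.
set c := cos _; set s := sin _ => e c2s2 c_gt0.
have s2 : s ^+ 2 = 1 - c ^+ 2 by rewrite -c2s2; ring.
have : c * (4 * c ^+ 2 - 3) = 0 by rewrite -[RHS]e; ring: s2.
move/eqP; rewrite mulf_eq0 (gt_eqF c_gt0) /= => /eqP ?; lra.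
Qed.

Lemma sin_pi6_sqr : sin (2 * pi / 12) ^+ 2 = 1 / 4 :> R.
Proof. by have := cos2Dsin2 (2 * pi / 12 : R); rewrite cos_pi6_sqr; lra. Qed.

Lemma zeta4 : zeta ^+ 4 = zeta ^+ 2 - 1.
Proof.
rewrite /zeta; have := cos_pi6_sqr; have := sin_pi6_sqr.
set c := cos _; set s := sin _ => s2 c2.
rewrite !exprS expr0 mulr1; simpc.
apply/eqP; rewrite eq_complex /=; apply/andP; split; apply/eqP.
  transitivity ((c ^+ 2) ^+ 2 - 6 * c ^+ 2 * s ^+ 2 + (s ^+ 2) ^+ 2); first by ring.
  by rewrite -!expr2 s2 c2; field.
transitivity (4 * c * s * (c ^+ 2 - s ^+ 2)); first by ring.
by rewrite s2 c2; field.
Qed.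

Lemma zetaV : zeta^-1 = zeta - zeta ^+ 3.
Proof.
have z1 : zeta * (zeta - zeta ^+ 3) = 1 by ring: zeta4.
have z0 : zeta != 0 by apply: contra_eq_neq z1 => ->; rewrite mul0r eq_sym oner_eq0.
by apply: (mulfI z0); rewrite z1 mulfV.
Qed.

Lemma conj_zeta : zeta^* = zeta - zeta ^+ 3.
Proof.
rewrite -zetaV; have z : zeta * zeta^* = 1.
  have -> : zeta^* = (zeta^*)%C by [].
  rewrite /zeta; simpc; apply/eqP; rewrite eq_complex /=.
  apply/andP; split; apply/eqP; last by ring.
  by have := cos2Dsin2 (2 * pi / 12 : R); rewrite !expr2.
have z0 : zeta != 0 by apply: contra_eq_neq z => ->; rewrite mul0r eq_sym oner_eq0.
by apply: (mulfI z0); rewrite z mulfV.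
Qed.

Lemma rho_zeta : rho = 2 * zeta - zeta ^+ 3.
Proof. by rewrite /rho zetaV; ring. Qed.

Lemma rhoE : rho = (Num.sqrt 3)%:C%C.
Proof.
have -> : rho = (2 * cos (2 * pi / 12))%:C%C.
  rewrite /rho zetaV -conj_zeta; have -> : zeta^* = (zeta^*)%C by [].
  rewrite /zeta; simpc; apply/eqP; rewrite eq_complex /= eqxx andbT.
  by apply/eqP; ring.
congr (_ +i* _)%C; have c0 := cos_pi6_gt0.
have -> : 3 = (2 * cos (2 * pi / 12)) ^+ 2 :> R.
  by rewrite exprMn cos_pi6_sqr; field.
by rewrite sqrtr_sqr ger0_norm // mulr_ge0 // ltW.
Qed.

Fact Zzeta_subring : subring_closed Zzeta.
Proof.
split=> [|x y|x y].
- by apply/asboolP; exists 1; rewrite rmorph1 hornerE.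
- move=> /asboolP[p ->] /asboolP[q ->]; apply/asboolP.
  by exists (p - q); rewrite rmorphB !hornerE.
- move=> /asboolP[p ->] /asboolP[q ->]; apply/asboolP.
  by exists (p * q); rewrite rmorphM !hornerE.
Qed.

HB.instance Definition _ := GRing.isSubringClosed.Build C Zzeta Zzeta_subring.

Lemma Zzeta_zeta : zeta \in Zzeta.
Proof. by apply/asboolP; exists 'X; rewrite map_polyX hornerX. Qed.

Lemma Zzeta_conj x : x \in Zzeta -> x^* \in Zzeta.
Proof.
move=> /asboolP[p ->]; rewrite -horner_map -map_poly_comp /=.
rewrite (@eq_map_poly _ _ _ intr); last by move=> z /=; rewrite rmorph_int.
rewrite conj_zeta horner_coef; apply: rpred_sum => i _.
rewrite coef_map rpredM ?rpred_int// rpredX// rpredB ?rpredX//;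
  exact: Zzeta_zeta.
Qed.

End CyclotomicIntegers.

Arguments zeta {R}.
Arguments Zzeta {R}.
Arguments rho {R}.

Definition mx3 (K : nmodType) (s : seq (seq K)) : 'M[K]_3 :=
  \matrix_(i, j) (nth [::] s i)`_j.

Lemma mx3_eq (K : nmodType) (A B : 'M[K]_3) :
  (forall i j, (i < 3)%N -> (j < 3)%N -> A (inord i) (inord j) = B (inord i) (inord j)) ->
  A = B.
Proof.
move=> AB; apply/matrixP => i j.
by have := AB i j (ltn_ord i) (ltn_ord j); rewrite !inord_val.
Qed.

Lemma mul_mx3 (K : pzSemiRingType) (a b c d e f g h i a' b' c' d' e' f' g' h' i' : K) :
  mx3 [:: [:: a; b; c]; [:: d; e; f]; [:: g; h; i]] *m
  mx3 [:: [:: a'; b'; c']; [:: d'; e'; f']; [:: g'; h'; i']] =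
  mx3 [:: [:: a * a' + b * d' + c * g'; a * b' + b * e' + c * h';
             a * c' + b * f' + c * i'];
          [:: d * a' + e * d' + f * g'; d * b' + e * e' + f * h';
             d * c' + e * f' + f * i'];
          [:: g * a' + h * d' + i * g'; g * b' + h * e' + i * h';
             g * c' + h * f' + i * i']].
Proof.
apply: mx3_eq => -[|[|[|//]]] [|[|[|//]]] _ _;
  by rewrite !mxE !big_ord_recl big_ord0 !mxE /= !inordK //= addr0 addrA.
Qed.

Lemma mx3_scalar (K : nzSemiRingType) (a : K) :
  a%:M = mx3 [:: [:: a; 0; 0]; [:: 0; a; 0]; [:: 0; 0; a]].
Proof.
by apply: mx3_eq => -[|[|[|//]]] [|[|[|//]]] _ _;
  rewrite !mxE !inordK // -val_eqE /= !inordK.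
Qed.

Lemma conj_mx3 (K : numClosedFieldType) (a b c d e f g h i : K) :
  (mx3 [:: [:: a; b; c]; [:: d; e; f]; [:: g; h; i]])^t* =
  mx3 [:: [:: a^*; d^*; g^*]; [:: b^*; e^*; h^*]; [:: c^*; f^*; i^*]].
Proof.
by apply: mx3_eq => -[|[|[|//]]] [|[|[|//]]] _ _; rewrite !mxE !inordK.
Qed.

Lemma mx3_over (K : nmodType) (S : {pred K}) (s : seq (seq K)) : 0 \in S ->
  all (all [in S]) s -> mx3 s \is a mxOver S.
Proof.
move=> S0 sS; apply/mxOverP => i j; rewrite mxE.
have [lt_j|?] := ltnP j (size (nth [::] s i)); last by rewrite nth_default.
have [lt_i|?] := ltnP i (size s); last by rewrite (nth_default [::]) // nth_nil.
exact: (allP (allP sS _ (mem_nth [::] lt_i)) _ (mem_nth 0 lt_j)).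
Qed.

Section UnitaryGroup.
Variable R : realType.
Local Notation C := R[i].

Definition Fmx : 'M[C]_3 :=
  mx3 [:: [:: - rho - 1; 1; 0]; [:: 1; 1 - rho; 0]; [:: 0; 0; 1]].

Definition unitaryF (g : 'M[C]_3) : bool :=
  (g \is a mxOver Zzeta) && (g^t* *m Fmx *m g == Fmx).

Record UF := MkUF { UFmx :> 'M[C]_3; UFmxP : unitaryF UFmx }.
HB.instance Definition _ := [isSub for UFmx].
HB.instance Definition _ := [Choice of UF by <:].

Let Finv : 'M[C]_3 :=
  mx3 [:: [:: 1 - rho; - 1; 0]; [:: - 1; - rho - 1; 0]; [:: 0; 0; 1]].

Lemma Zzeta_rho : rho \in @Zzeta R.
Proof.
by rewrite rho_zeta rpredB ?rpredX ?rpredM ?rpred_nat //; exact: Zzeta_zeta.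
Qed.

Lemma Fmx_over : Fmx \is a mxOver Zzeta.
Proof.
have zr := Zzeta_rho; apply: mx3_over; first exact: rpred0.
by rewrite /= !(rpred0, rpred1, rpredB, rpredN).
Qed.

Let Finv_over : Finv \is a mxOver Zzeta.
Proof.
have zr := Zzeta_rho; apply: mx3_over; first exact: rpred0.
by rewrite /= !(rpred0, rpred1, rpredB, rpredN).
Qed.

Let mulFinv : Finv *m Fmx = 1%:M.
Proof.
rewrite mul_mx3 mx3_scalar rho_zeta.
by do ![congr (_ :: _) | congr mx3]; ring: (@zeta4 R).
Qed.

Lemma UF_mulP (g h : UF) : unitaryF (UFmx g *m UFmx h).
Proof.
case: g h => [g /andP[/= gZ /eqP gF]] [h /andP[/= hZ /eqP hF]].
apply/andP; split; first exact: mxOverM.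
rewrite trmx_mul map_mxM.
suff -> : h^t* *m g^t* *m Fmx *m (g *m h) = h^t* *m (g^t* *m Fmx *m g) *m h.
  by rewrite gF hF.
by rewrite !mulmxA.
Qed.

Let UF_left_inv (g : UF) : Finv *m (UFmx g)^t* *m Fmx *m g = 1%:M.
Proof.
by case: g => [g /andP[/= _ /eqP gF]]; rewrite -!mulmxA (mulmxA _ _ g) gF mulFinv.
Qed.

Lemma UF_unit (g : UF) : UFmx g \in unitmx.
Proof. by have [] := mulmx1_unit (UF_left_inv g). Qed.

Let UF_invE (g : UF) : invmx (UFmx g) = Finv *m (UFmx g)^t* *m Fmx.
Proof.
by rewrite -[RHS](mulmxK (UF_unit g)) UF_left_inv mul1mx.
Qed.

Lemma UF_invP (g : UF) : unitaryF (invmx (UFmx g)).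
Proof.
apply/andP; split.
  rewrite UF_invE; apply: mxOverM; last exact: Fmx_over.
  apply: mxOverM => //; apply/mxOverP => i j; rewrite !mxE.
  by apply: Zzeta_conj; case: g => g /= /andP[/mxOverP gZ _].
have gu := UF_unit g; case: g gu => [g /andP[/= _ /eqP gF]] gu.
have gi : (invmx g)^t* *m g^t* = 1%:M.
  by rewrite -map_mxM -trmx_mul mulmxV // trmx1 map_mx1.
suff -> : (invmx g)^t* *m Fmx *m invmx g =
    ((invmx g)^t* *m g^t*) *m Fmx *m (g *m invmx g).
  by rewrite gi mulmxV // mul1mx mulmx1.
by rewrite -{1}gF !mulmxA.
Qed.

Lemma UF_oneP : unitaryF 1%:M.
Proof.
rewrite /unitaryF mxOver_scalar ?rpred0 ?rpred1 //=.
by rewrite trmx1 map_mx1 mul1mx mulmx1.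
Qed.

Definition UF_one := MkUF UF_oneP.
Definition UF_mul g h := MkUF (UF_mulP g h).
Definition UF_inv g := MkUF (UF_invP g).

Fact UF_mulA : associative UF_mul.
Proof. by move=> g h k; apply: val_inj; rewrite /= mulmxA. Qed.
Fact UF_mul1 : left_id UF_one UF_mul.
Proof. by move=> g; apply: val_inj; rewrite /= mul1mx. Qed.
Fact UF_mulr1 : right_id UF_one UF_mul.
Proof. by move=> g; apply: val_inj; rewrite /= mulmx1. Qed.
Fact UF_mulV : left_inverse UF_one UF_inv UF_mul.
Proof. by move=> g; apply: val_inj; rewrite /= mulVmx // UF_unit. Qed.
Fact UF_mulrV : right_inverse UF_one UF_inv UF_mul.
Proof. by move=> g; apply: val_inj; rewrite /= mulmxV // UF_unit. Qed.

HB.instance Definition _ :=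
  isGroup.Build UF UF_mulA UF_mul1 UF_mulr1 UF_mulV UF_mulrV.

(* The group Z of the scalar matrices zeta^nu I. *)
Definition Zcenter : pred UF :=
  fun g => [exists nu : 'I_12, UFmx g == (zeta ^+ nu)%:M].

Local Open Scope group_scope.

Lemma zeta12 : (zeta ^+ 12 = 1 :> C)%R.
Proof.
have z6 : (zeta ^+ 6 = -1 :> C)%R by ring: (@zeta4 R).
by rewrite (exprM _ 6 2) z6 sqrrN expr1n.
Qed.

Lemma ZcenterP g : reflect (exists n, UFmx g = (zeta ^+ n)%:M)%R (g \in Zcenter).
Proof.
apply: (iffP existsP) => [[nu /eqP ->]|[n ->]]; first by exists nu.
by exists (Ordinal (ltn_pmod n (isT : (0 < 12)%N))); rewrite /= expr_mod ?zeta12.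
Qed.

Lemma Zcenter1 : 1 \in Zcenter.
Proof. by apply/ZcenterP; exists 0. Qed.

Lemma Zcenter_mul g h : g \in Zcenter -> h \in Zcenter -> g * h \in Zcenter.
Proof.
move=> /ZcenterP[n gn] /ZcenterP[m hm]; apply/ZcenterP; exists (n + m)%N.
by rewrite /= gn hm -scalar_mxM exprD.
Qed.

Lemma Zcenter_commute g h : g \in Zcenter -> g * h = h * g.
Proof.
by move=> /ZcenterP[n gn]; apply: val_inj; rewrite /= gn scalar_mxC.
Qed.

Lemma Zcenter_inv g : g \in Zcenter -> g^-1 \in Zcenter.
Proof.
move=> /ZcenterP[n gn]; apply/ZcenterP; exists (n * 11)%N.
apply: (can_inj (mulKmx (UF_unit g))).
rewrite /= mulmxV ?UF_unit // gn -scalar_mxM -exprD -mulnS mulnC exprM.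
by rewrite zeta12 expr1n.
Qed.

(* Equality of the left cosets g Z and h Z. *)
Definition same_coset (g h : UF) : bool := (g^-1 * h) \in Zcenter.

Fact same_coset_equiv : equiv_class_of same_coset.
Proof.
split=> [g|g h|h g k].
- by rewrite /same_coset mulVg Zcenter1.
- by apply/idP/idP => /Zcenter_inv; rewrite invgM invgK.
- by move=> gh hk; have := Zcenter_mul gh hk; rewrite mulgA mulgK.
Qed.

Canonical same_coset_equivRel := EquivRelPack same_coset_equiv.

(* The quotient group UF / Z. *)
Definition Gamma := {eq_quot same_coset}.
HB.instance Definition _ := EqQuotient.on Gamma.
HB.instance Definition _ := Choice.on Gamma.

Definition coset (g : UF) : Gamma := \pi_Gamma g.

Lemma cosetP g h : coset g = coset h <-> g^-1 * h \in Zcenter.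
Proof. exact: (rwP (eqquotP Gamma g h)). Qed.

Definition Gamma_one : Gamma := coset 1.
Definition Gamma_mul (x y : Gamma) : Gamma := coset (repr x * repr y).
Definition Gamma_inv (x : Gamma) : Gamma := coset (repr x)^-1.

Lemma coset_ind (P : Gamma -> Prop) : (forall g, P (coset g)) -> forall x, P x.
Proof. by move=> Pg x; rewrite -[x]reprK; apply: Pg. Qed.

Lemma repr_coset g : exists2 z, z \in Zcenter & repr (coset g) = g * z.
Proof.
exists (g^-1 * repr (coset g)); last by rewrite mulVKg.
by apply/cosetP; rewrite /coset reprK.
Qed.

Lemma coset_mulz g z : z \in Zcenter -> coset (g * z) = coset g.
Proof. by move=> zZ; apply/esym/cosetP; rewrite mulKg. Qed.

Lemma Gamma_mulE g h : Gamma_mul (coset g) (coset h) = coset (g * h).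
Proof.
rewrite /Gamma_mul; have [z zZ ->] := repr_coset g; have [w wZ ->] := repr_coset h.
rewrite mulgA (coset_mulz _ wZ) -(mulgA g) (Zcenter_commute h zZ) mulgA.
by rewrite (coset_mulz _ zZ).
Qed.

Lemma Gamma_invE g : Gamma_inv (coset g) = coset g^-1.
Proof.
rewrite /Gamma_inv; have [z zZ ->] := repr_coset g.
by rewrite invgM (Zcenter_commute _ (Zcenter_inv zZ)) (coset_mulz _ (Zcenter_inv zZ)).
Qed.

Fact Gamma_mulA : associative Gamma_mul.
Proof.
elim/coset_ind=> x; elim/coset_ind=> y; elim/coset_ind=> z.
by rewrite !Gamma_mulE mulgA.
Qed.
Fact Gamma_mul1 : left_id Gamma_one Gamma_mul.
Proof. by elim/coset_ind=> x; rewrite Gamma_mulE mul1g. Qed.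
Fact Gamma_mulr1 : right_id Gamma_one Gamma_mul.
Proof. by elim/coset_ind=> x; rewrite Gamma_mulE mulg1. Qed.
Fact Gamma_mulV : left_inverse Gamma_one Gamma_inv Gamma_mul.
Proof. by elim/coset_ind=> x; rewrite Gamma_invE Gamma_mulE mulVg. Qed.
Fact Gamma_mulrV : right_inverse Gamma_one Gamma_inv Gamma_mul.
Proof. by elim/coset_ind=> x; rewrite Gamma_invE Gamma_mulE mulgV. Qed.

HB.instance Definition _ :=
  isGroup.Build Gamma Gamma_mulA Gamma_mul1 Gamma_mulr1 Gamma_mulV Gamma_mulrV.

Lemma cosetM g h : coset (g * h) = coset g * coset h.
Proof. by rewrite -Gamma_mulE. Qed.

End UnitaryGroup.

Section Generators.
Variable R : realType.
Local Notation C := R[i].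
Local Notation z := (@zeta R).

Definition u_mx : 'M[C]_3 := mx3
  [:: [:: z ^+ 3 + z ^+ 2 - z; 1 - z; 0];
      [:: z ^+ 3 + z ^+ 2 - 1; z - z ^+ 3; 0];
      [:: 0; 0; 1]].

Definition v_mx : 'M[C]_3 := mx3
  [:: [:: z ^+ 3; 0; 0];
      [:: z ^+ 3 + z ^+ 2 - z - 1; 1; 0];
      [:: 0; 0; 1]].

Definition b_mx : 'M[C]_3 := mx3
  [:: [:: 1; 0; 0];
      [:: - 2 * z ^+ 3 - z ^+ 2 + 2 * z + 2; z ^+ 3 + z ^+ 2 - z - 1;
          - z ^+ 3 - z ^+ 2];
      [:: z ^+ 2 + z; - z ^+ 3 - 1; - z ^+ 3 + z + 1]].

Let z_in : z \in Zzeta. Proof. exact: Zzeta_zeta. Qed.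
Let two_in : (2 : C) \in Zzeta. Proof. exact: rpred_nat. Qed.
Let zX n : z ^+ n \in Zzeta. Proof. exact: rpredX z_in. Qed.

Ltac unitaryF_tac :=
  apply/andP; split;
  [ apply: mx3_over; [exact: rpred0 |];
    rewrite /= !(rpred0, rpred1, rpredN, rpredD, rpredM, zX, z_in, two_in) //
  | apply/eqP; rewrite /u_mx /v_mx /b_mx /Fmx conj_mx3 !mul_mx3;
    rewrite !(rmorphB, rmorphD, rmorphN, rmorphM, rmorph_nat, rmorphXn,
              rmorph0, rmorph1) /=;
    rewrite conj_zeta rho_zeta;
    by do ![congr (_ :: _) | congr mx3]; ring: (@zeta4 R) ].

Lemma u_mxP : unitaryF u_mx. Proof. unitaryF_tac. Qed.
Lemma v_mxP : unitaryF v_mx. Proof. unitaryF_tac. Qed.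
Lemma b_mxP : unitaryF b_mx. Proof. unitaryF_tac. Qed.

Local Open Scope group_scope.

Definition u : Gamma R := coset (MkUF u_mxP).
Definition v : Gamma R := coset (MkUF v_mxP).
Definition b : Gamma R := coset (MkUF b_mxP).
Definition j : Gamma R := (u * v) ^+ 2.

Definition a1 : Gamma R := v * u * v^-1 * j ^+ 4 * b * u * v * j ^+ 2.
Definition a2 : Gamma R := v ^+ 2 * u * b * u * v^-1 * u * v ^+ 2 * j.
Definition a3 : Gamma R :=
  u^-1 * v ^+ 2 * u * j ^+ 9 * b * v^-1 * u * v^-1 * j ^+ 8.

Definition PiGroup : set (Gamma R) :=
  smallest [set H : set (Gamma R) | group_closed [in H]] [set a1; a2; a3].

End Generators.

Arguments PiGroup : clear implicits.
Arguments u {R}.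
Arguments v {R}.
Arguments b {R}.
Arguments j {R}.

Section Ball.
Variable R : realType.
Local Notation C := R[i].

Definition B2 := {p : C * C | `|p.1| ^+ 2 + `|p.2| ^+ 2 < 1}.
HB.instance Definition _ := Choice.on B2.

Definition gamma0 : 'M[C]_3 :=
  mx3 [:: [:: 1; 0; 0]; [:: 1; 1 - rho; 0]; [:: 0; 0; 1]].

Definition dsqrt : C := (Num.sqrt (Num.sqrt 3 - 1))%:C%C.

Definition Dmx : 'M[C]_3 := mx3 [:: [:: 1; 0; 0]; [:: 0; 1; 0]; [:: 0; 0; dsqrt]].

Definition tilde (g : 'M[C]_3) : 'M[C]_3 :=
  Dmx *m gamma0 *m g *m invmx gamma0 *m invmx Dmx.

(* The column (z, w, 1)^T. *)
Definition hcol (p : C * C) : 'cV[C]_3 := \col_i [:: p.1; p.2; 1]`_i.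

Definition projpt (x : 'cV[C]_3) : C * C := (x 0 0 / x 2 0, x 1 0 / x 2 0).

Definition Jmx : 'M[C]_3 := mx3 [:: [:: 1; 0; 0]; [:: 0; 1; 0]; [:: 0; 0; - 1]].

Lemma dsqrt_sqr : dsqrt ^+ 2 = rho - 1.
Proof.
rewrite rhoE /dsqrt -rmorphXn /= sqr_sqrtr ?rmorphB ?rmorph1 //.
by rewrite subr_ge0 -{1}sqrtr1 ler_sqrt ?ler1n.
Qed.

Lemma rho_sqr : (rho ^+ 2 = 3 :> C)%R.
Proof. by rewrite rho_zeta; ring: (@zeta4 R). Qed.

Lemma rho_neq1 : 1 - rho != 0 :> C.
Proof.
have : (1 - rho) * (1 + rho) = - 2 :> C by ring: rho_sqr.
by apply: contra_eq_neq => ->; rewrite mul0r eq_sym oppr_eq0 pnatr_eq0.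
Qed.

Lemma dsqrt_neq0 : dsqrt != 0.
Proof.
by rewrite -sqrf_eq0 dsqrt_sqr -oppr_eq0 opprB rho_neq1.
Qed.

Lemma gamma0_unit : gamma0 \in unitmx.
Proof.
have : gamma0 *m mx3 [:: [:: 1; 0; 0];
    [:: - (1 - rho)^-1; (1 - rho)^-1; 0]; [:: 0; 0; 1]] = 1%:M.
  rewrite mul_mx3 mx3_scalar; have := rho_neq1 => rn.
  by do ![congr (_ :: _) | congr mx3]; field.
by case/mulmx1_unit.
Qed.

Lemma Dmx_unit : Dmx \in unitmx.
Proof.
have : Dmx *m mx3 [:: [:: 1; 0; 0]; [:: 0; 1; 0]; [:: 0; 0; dsqrt^-1]] = 1%:M.
  rewrite mul_mx3 mx3_scalar; have := dsqrt_neq0 => rn.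
  by do ![congr (_ :: _) | congr mx3]; field.
by case/mulmx1_unit.
Qed.

Lemma form_change : (Dmx *m gamma0)^t* *m Jmx *m (Dmx *m gamma0) = (1 - rho) *: Fmx R.
Proof.
have -> : (1 - rho) *: Fmx R =
    mx3 [:: [:: 2; 1 - rho; 0]; [:: 1 - rho; (1 - rho) ^+ 2; 0]; [:: 0; 0; 1 - rho]].
  by rewrite -mul_scalar_mx mx3_scalar mul_mx3;
  do ![congr (_ :: _) | congr mx3]; ring: rho_sqr.
have cr : zeta^* + (zeta^-1)^* = rho :> C.
  by rewrite -rmorphD -/rho rhoE; apply: conjc_real.
have cd : dsqrt^* = dsqrt by apply: conjc_real.
rewrite mul_mx3 conj_mx3 !mul_mx3.
rewrite !(rmorphB, rmorphD, rmorphN, rmorphM, rmorph0, rmorph1) /= cr cd.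
by do ![congr (_ :: _) | congr mx3]; ring: rho_sqr dsqrt_sqr.
Qed.

Lemma tilde_conj (g : UF R) : tilde g *m (Dmx *m gamma0) = Dmx *m gamma0 *m g.
Proof.
by rewrite /tilde mulmxA mulmxKV ?Dmx_unit // mulmxKV ?gamma0_unit.
Qed.

Lemma tilde_unitary (g : UF R) : (tilde g)^t* *m Jmx *m tilde g = Jmx.
Proof.
have Pu : Dmx *m gamma0 \in unitmx by rewrite unitmx_mul Dmx_unit gamma0_unit.
have Pu' : (Dmx *m gamma0)^t* \in unitmx by rewrite map_unitmx unitmx_tr.
apply: (can_inj (mulKmx Pu')); apply: (can_inj (mulmxK Pu)).
have -> : (Dmx *m gamma0)^t* *m ((tilde g)^t* *m Jmx *m tilde g) *m (Dmx *m gamma0)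
    = (tilde g *m (Dmx *m gamma0))^t* *m Jmx *m (tilde g *m (Dmx *m gamma0)).
  by rewrite [(tilde g *m _)^T]trmx_mul [map_mx _ (_ *m _)]map_mxM !mulmxA.
rewrite tilde_conj form_change trmx_mul map_mxM.
have -> : (UFmx g)^t* *m (Dmx *m gamma0)^t* *m Jmx *m (Dmx *m gamma0 *m g) =
    (UFmx g)^t* *m ((Dmx *m gamma0)^t* *m Jmx *m (Dmx *m gamma0)) *m g.
  by rewrite !mulmxA.
rewrite form_change -scalemxAr -scalemxAl.
by case: g => g /= /andP[_ /eqP ->].
Qed.

Definition qform (x : 'cV[C]_3) : C := (x^t* *m Jmx *m x) 0 0.

Lemma qformE x : qform x = `|x 0 0| ^+ 2 + `|x 1 0| ^+ 2 - `|x 2 0| ^+ 2.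
Proof.
rewrite /qform !mxE !big_ord_recl big_ord0 !mxE !big_ord_recl !big_ord0 !mxE /=.
have -> : lift ord0 ord0 = 1 :> 'I_3 by apply: val_inj.
have -> : lift ord0 (lift ord0 ord0) = 2 :> 'I_3 by apply: val_inj.
have -> : ord0 = 0 :> 'I_3 by apply: val_inj.
by rewrite !normCK; ring.
Qed.

Lemma qform_tilde (g : UF R) x : qform (tilde g *m x) = qform x.
Proof.
rewrite /qform trmx_mul map_mxM.
have -> : x^t* *m (tilde g)^t* *m Jmx *m (tilde g *m x) =
    x^t* *m ((tilde g)^t* *m Jmx *m tilde g) *m x by rewrite !mulmxA.
by rewrite tilde_unitary.
Qed.

Lemma qform_hcol p : qform (hcol p) = `|p.1| ^+ 2 + `|p.2| ^+ 2 - 1.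
Proof. by rewrite qformE !mxE /= normr1 expr1n. Qed.

Lemma tilde_last_neq0 (g : UF R) (p : B2) : (tilde g *m hcol (val p)) 2 0 != 0.
Proof.
apply/eqP => x20; have := qform_tilde g (hcol (val p)).
rewrite qform_hcol qformE x20 normr0 expr0n /= subr0 => e.
have := valP p; rewrite /= -subr_lt0 -e le_gtF //.
by rewrite addr_ge0 // exprn_ge0.
Qed.

Lemma actUF_subproof (g : UF R) (p : B2) :
  let q := projpt (tilde g *m hcol (val p)) in `|q.1| ^+ 2 + `|q.2| ^+ 2 < 1.
Proof.
rewrite /projpt /=; have := tilde_last_neq0 g p.
have := qform_tilde g (hcol (val p)); rewrite qform_hcol qformE.
have := valP p; rewrite /= -subr_lt0.
set x := tilde g *m _ => pB e x20; rewrite !normrM !normfV !exprMn -mulrDl.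
rewrite exprVn ltr_pdivrMr ?mul1r ?exprn_gt0 ?normr_gt0 //.
by rewrite -subr_lt0 e.
Qed.

Definition actUF (g : UF R) (p : B2) : B2 :=
  exist _ (projpt (tilde g *m hcol (val p))) (actUF_subproof g p).

Lemma hcol_actUF (g : UF R) (p : B2) : exists2 c : C, c != 0 &
  tilde g *m hcol (val p) = c *: hcol (val (actUF g p)).
Proof.
exists ((tilde g *m hcol (val p)) 2 0); first exact: tilde_last_neq0.
apply/matrixP => i k; rewrite ord1 [RHS]mxE [hcol _ _ _]mxE /=.
have := tilde_last_neq0 g p; set x := tilde g *m _ => x20.
case: i => [[|[|[|//]]]] lti /=.
- by rewrite mulrC divfK //; congr (x _ 0); apply: val_inj.
- by rewrite mulrC divfK //; congr (x _ 0); apply: val_inj.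
- by rewrite mulr1; congr (x _ 0); apply: val_inj.
Qed.

Lemma hcol_inj (p q : C * C) (c : C) : hcol p = c *: hcol q -> p = q.
Proof.
case: p q => p1 p2 [q1 q2] /matrixP e.
have := e 2 0; rewrite !mxE /= mulr1 => c1.
by have := e 0 0; have := e 1 0; rewrite !mxE /= -c1 !mul1r => -> ->.
Qed.

(* g.(z, w) = (z', w') iff tilde g (z, w, 1)^T is a multiple of (z', w', 1)^T. *)
Lemma actUFP (g : UF R) (p q : B2) :
  actUF g p = q <-> exists c : C, tilde g *m hcol (val p) = c *: hcol (val q).
Proof.
have [c c0 e] := hcol_actUF g p; split=> [<-|[d]]; first by exists c.
rewrite e => /(congr1 (fun M => c^-1 *: M)).
by rewrite !scalerA mulVf // scale1r => /hcol_inj /val_inj.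
Qed.

Lemma tilde1 : tilde 1%:M = 1%:M.
Proof.
by rewrite /tilde mulmx1 (mulmxK gamma0_unit) mulmxV ?Dmx_unit.
Qed.

Lemma tildeM g h : tilde (g *m h) = tilde g *m tilde h.
Proof.
by rewrite /tilde !mulmxA mulmxKV ?Dmx_unit // mulmxKV ?gamma0_unit.
Qed.

Local Open Scope group_scope.

Lemma actUFM g h p : actUF (g * h) p = actUF g (actUF h p).
Proof.
apply/actUFP; have [c _ ec] := hcol_actUF h p.
have [d _ ed] := hcol_actUF g (actUF h p); exists (c * d)%R.
set q := actUF g _ in ed *; rewrite -[UFmx _]/(UFmx g *m UFmx h).
by rewrite tildeM -mulmxA ec -scalemxAr ed scalerA.
Qed.

Lemma actUF_center g p : g \in @Zcenter R -> actUF g p = p.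
Proof.
move=> /ZcenterP[n gn]; apply/actUFP; exists (zeta ^+ n)%R.
have -> : tilde g = (zeta ^+ n)%:M.
  rewrite gn -scalemx1 /tilde -scalemxAr -!scalemxAl -[X in (_ *: X)%R]/(tilde 1%:M).
  by rewrite tilde1.
by rewrite mul_scalar_mx.
Qed.

Definition act (x : Gamma R) (p : B2) : B2 := actUF (repr x) p.

Lemma act_coset g p : act (coset g) p = actUF g p.
Proof.
by rewrite /act; have [z zZ ->] := repr_coset g; rewrite actUFM (actUF_center _ zZ).
Qed.

Lemma act1 p : act 1 p = p.
Proof. by rewrite act_coset actUF_center // Zcenter1. Qed.

Lemma actM x y p : act (x * y) p = act x (act y p).
Proof.
elim/coset_ind: x => g; elim/coset_ind: y => h.
by rewrite -cosetM !act_coset actUFM.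
Qed.

Fact origin_subproof : (let p : C * C := (0, 0) in `|p.1| ^+ 2 + `|p.2| ^+ 2 < 1)%R.
Proof. by rewrite /= normr0 expr0n addr0 ltr01. Qed.

Definition origin : B2 := exist _ (0, 0)%R origin_subproof.

(* Equality of the orbits Pi p and Pi q. *)
Definition same_orbit (p q : B2) : bool :=
  `[< exists2 g, PiGroup R g & q = act g p >].

Lemma PiGroup_closed : group_closed [in PiGroup R].
Proof.
split; first by rewrite inE => H /= [[]]; rewrite inE.
move=> x y; rewrite !inE => xP yP H HP; have [[_ HV] _] := HP.
by have := HV _ _ (mem_set (xP _ HP)) (mem_set (yP _ HP)); rewrite inE.
Qed.

Fact same_orbit_equiv : equiv_class_of same_orbit.
Proof.
have [P1 PV] := PiGroup_closed.
have PN := group_closedV PiGroup_closed; have PM := group_closedM PiGroup_closed.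
have sym p q : same_orbit p q -> same_orbit q p.
  move=> /asboolP[g gP ->]; apply/asboolP; exists g^-1.
    by have := PN _ (mem_set gP); rewrite inE.
  by rewrite -actM mulVg act1.
split=> [p|p q|q p s].
- by apply/asboolP; exists 1; [rewrite inE in P1|rewrite act1].
- by apply/idP/idP; apply: sym.
- move=> /asboolP[g gP ->] /asboolP[h hP ->]; apply/asboolP; exists (h * g).
    by have := PM _ _ (mem_set hP) (mem_set gP); rewrite inE.
  by rewrite actM.
Qed.

Canonical same_orbit_equivRel := EquivRelPack same_orbit_equiv.

(* The quotient Pi \ B(C^2). *)
Definition X := {eq_quot same_orbit}.
HB.instance Definition _ := EqQuotient.on X.
HB.instance Definition _ := Choice.on X.

Definition orbX (p : B2) : X := \pi_X p.

Lemma orbXP p q : orbX p = orbX q <-> exists2 g, PiGroup R g & q = act g p.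
Proof.
apply: iff_trans (rwP (eqquotP X p q)) _; apply: iff_sym.
exact: (rwP (asboolP _)).
Qed.

End Ball.

(* Main.v *)
(* Every element of Gamma is the class of a 3x3 matrix over Z[zeta] preserving F, and
   such matrices are multiplied exactly as matrices of integer quadruples. The
   stabilizer K of the origin is finite (288 elements). Among the translates k b^-1.0
   with k in K there are always some whose direction is close to that of a given point
   (they contain the vertices of regular octahedra in P^1(C)), so that a point z with
   |z|^2 > 1/2 can be moved substantially closer to the origin. Two consequences
   follow. First, Gamma is the union of the sets Pi b^n K with n = 0, 1, -1, by descent
   from Pi b^n K b being contained in that union; since a test by determinant and
   reduction modulo sqrt 3 separates these sets, it decides membership in Pi. Secondly,
   every point has a translate with |z|^2 <= 1/2, and an element A fixing such a point
   satisfies |A_33|^2 <= 9, which only leaves three double cosets of K.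
   If Pi p is fixed, then some element of Pi j^4 fixes p. Moving p near the origin
   leaves finitely many candidates for this element; the test shows that it is j^4,
   fixing only the origin, or a conjugate of buv, fixing only a translate of z0. The
   translates of z0 that occur fall into six orbits, which are distinct because the
   stabilizer of z0 is generated by buv. *)

(* Finiteness comes from the second real place of Q(sqrt 3), where F is positive definite. For A
   preserving F, write |A_33|^2 = a + b sqrt 3: this number is at least 1, while its conjugate a - b
   sqrt 3 lies in [0, 1]. So |A_33|^2 has finitely many values below any bound, and the integer a
   drops whenever |A_33|^2 does, which makes the descent terminate. The same number locates A.0,
   since |A_33|^2 (1 - |A.0|^2) = 1. The threshold |z|^2 = 1/2 thus means |A_33|^2 = 2, and no value
   lies strictly between 1 and 2: a translate of the origin in the smaller ball is the origin
   itself. An element of Gamma is a matrix up to powers of zeta, so every test on matrices has to be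
   insensitive to such scalars. *)
From Stdlib Require Import BinInt.
Require Import Defs.
From HB Require Import structures.
From mathcomp Require Import all_boot all_order all_algebra.
From mathcomp Require Import boolp classical_sets functions cardinality reals.
From mathcomp Require Import trigo complex sesquilinear spectral ring lra zify ssrZ.

Set Implicit Arguments.
Unset Strict Implicit.
Unset Printing Implicit Defensive.

Import Order.TTheory GRing.Theory Num.Theory.

Local Delimit Scope Z_scope with ZZ.

(** * Exact arithmetic in Z[zeta] *)

(* Short-circuit versions of [all] and [has]: vm_compute evaluates both
   arguments of a boolean connective. *)
Fixpoint allb T (p : T -> bool) (s : seq T) : bool :=
  if s is x :: s' then (if p x then allb p s' else false) else true.
Fixpoint hasb T (p : T -> bool) (s : seq T) : bool :=
  if s is x :: s' then (if p x then true else hasb p s') else false.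

Lemma allbE T (p : T -> bool) s : allb p s = all p s.
Proof. by elim: s => //= x s ->. Qed.

Lemma hasbE T (p : T -> bool) s : hasb p s = has p s.
Proof. by elim: s => //= x s ->. Qed.

Section Matrix3.
Variable T : Type.

Definition row3 := (T * T * T)%type.
Definition m3 := (row3 * row3 * row3)%type.

Variables add mul : T -> T -> T.

Definition dot3 (x y : row3) : T :=
  let '(x1, x2, x3) := x in let '(y1, y2, y3) := y in
  add (add (mul x1 y1) (mul x2 y2)) (mul x3 y3).

Definition tr3 (A : m3) : m3 :=
  let '((a11, a12, a13), (a21, a22, a23), (a31, a32, a33)) := A in
  ((a11, a21, a31), (a12, a22, a32), (a13, a23, a33)).

Definition mul3 (A B : m3) : m3 :=
  let '(a1, a2, a3) := A in let '(b1, b2, b3) := tr3 B in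
  ((dot3 a1 b1, dot3 a1 b2, dot3 a1 b3),
   (dot3 a2 b1, dot3 a2 b2, dot3 a2 b3),
   (dot3 a3 b1, dot3 a3 b2, dot3 a3 b3)).

End Matrix3.

Definition map3 T U (f : T -> U) (A : m3 T) : m3 U :=
  let '((a11, a12, a13), (a21, a22, a23), (a31, a32, a33)) := A in
  ((f a11, f a12, f a13), (f a21, f a22, f a23), (f a31, f a32, f a33)).

Definition e33 T (A : m3 T) : T := let '(_, _, (_, _, x)) := A in x.

(** Serves both the evaluation in C and the reduction to F_9. *)
Lemma map3_mul T U (f : T -> U) add mul add' mul' :
  {morph f : x y / add x y >-> add' x y} ->
  {morph f : x y / mul x y >-> mul' x y} ->
  {morph map3 f : A B / mul3 add mul A B >-> mul3 add' mul' A B}.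
Proof.
move=> fD fM [[[[a11 a12] a13] [[a21 a22] a23]] [[a31 a32] a33]].
move=> [[[[b11 b12] b13] [[b21 b22] b23]] [[b31 b32] b33]] /=.
by rewrite !(fD, fM).
Qed.

(* A quadruple (q0, q1, q2, q3) stands for q0 + q1 zeta + q2 zeta^2 + q3 zeta^3. *)
Definition quad := (Z * Z * Z * Z)%type.

Section Quad.
Local Open Scope Z_scope.

Definition q0 : quad := (0, 0, 0, 0).
Definition q1 : quad := (1, 0, 0, 0).
Definition qz : quad := (0, 1, 0, 0).
Definition qr : quad := (0, 2, 0, -1).

Definition qadd (x y : quad) : quad :=
  let '(x0, x1, x2, x3) := x in let '(y0, y1, y2, y3) := y in
  (x0 + y0, x1 + y1, x2 + y2, x3 + y3).

Definition qopp (x : quad) : quad :=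
  let '(x0, x1, x2, x3) := x in (- x0, - x1, - x2, - x3).

Definition qsub x y := qadd x (qopp y).

(** The coefficients c4, c5, c6 are folded back by zeta^4 = zeta^2 - 1, zeta^5 = zeta^3 - zeta and
    zeta^6 = -1. *)
Definition qmul (x y : quad) : quad :=
  let '(x0, x1, x2, x3) := x in let '(y0, y1, y2, y3) := y in
  let c4 := x1 * y3 + x2 * y2 + x3 * y1 in
  let c5 := x2 * y3 + x3 * y2 in
  let c6 := x3 * y3 in
  (x0 * y0 - c4 - c6, x0 * y1 + x1 * y0 - c5, x0 * y2 + x1 * y1 + x2 * y0 + c4,
   x0 * y3 + x1 * y2 + x2 * y1 + x3 * y0 + c5).

(** The conjugates of zeta, zeta^2, zeta^3 are zeta - zeta^3, 1 - zeta^2 and -zeta^3. *)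
Definition qconj (x : quad) : quad :=
  let '(x0, x1, x2, x3) := x in (x0 + x2, x1, - x2, - x1 - x3).

(* |x|^2 = a + b sqrt 3 for (a, b) = qnorm x. *)
Definition qnorm (x : quad) : Z * Z :=
  let '(x0, x1, x2, x3) := x in
  (x0 * x0 + x1 * x1 + x2 * x2 + x3 * x3 + x0 * x2 + x1 * x3,
   x0 * x1 + x1 * x2 + x2 * x3).

Definition qzX (n : nat) : quad := iter n (qmul qz) q1.

Definition qhalf (x : quad) : option quad :=
  let '(x0, x1, x2, x3) := x in
  if Z.even x0 && Z.even x1 && Z.even x2 && Z.even x3
  then Some (Z.div2 x0, Z.div2 x1, Z.div2 x2, Z.div2 x3) else None.

End Quad.

Definition qm3 := m3 quad.
Definition mulq : qm3 -> qm3 -> qm3 := mul3 qadd qmul.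
Definition ctq (A : qm3) : qm3 := map3 qconj (tr3 A).
Definition scq (c : quad) : qm3 -> qm3 := map3 (qmul c).
Definition Iq : qm3 := ((q1, q0, q0), (q0, q1, q0), (q0, q0, q1)).
Definition Fq : qm3 :=
  ((qsub (qopp qr) q1, q1, q0), (q1, qsub q1 qr, q0), (q0, q0, q1)).
Definition Finvq : qm3 :=
  ((qsub q1 qr, qopp q1, q0), (qopp q1, qsub (qopp qr) q1, q0), (q0, q0, q1)).
(** The inverse when A preserves F; it needs no division, because F has its inverse over Z[zeta]. *)
Definition invq (A : qm3) : qm3 := mulq (mulq Finvq (ctq A)) Fq.
Definition uq (A : qm3) : bool := mulq (mulq (ctq A) Fq) A == Fq.
Definition powq (A : qm3) (n : nat) : qm3 := iter n (mulq A) Iq.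
Definition prodq (s : seq qm3) : qm3 := foldr mulq Iq s.
Definition detq (A : qm3) : quad :=
  let '((a11, a12, a13), (a21, a22, a23), (a31, a32, a33)) := A in
  qadd (qsub (qmul a11 (qsub (qmul a22 a33) (qmul a23 a32)))
             (qmul a12 (qsub (qmul a21 a33) (qmul a23 a31))))
       (qmul a13 (qsub (qmul a21 a32) (qmul a22 a31))).

(** Equality of the classes of A and B modulo Z. *)
Definition eqscq (A B : qm3) : bool := hasb (fun n => A == scq (qzX n) B) (iota 0 12).

Section GeneratorMatrices.
Local Open Scope Z_scope.

Definition uM : qm3 :=
  (((0, -1, 1, 1), (1, -1, 0, 0), q0), ((-1, 0, 1, 1), (0, 1, 0, -1), q0), (q0, q0, q1)).
Definition vM : qm3 :=
  (((0, 0, 0, 1), q0, q0), ((-1, -1, 1, 1), q1, q0), (q0, q0, q1)).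
Definition bM : qm3 :=
  ((q1, q0, q0), ((2, 2, -1, -2), (-1, -1, 1, 1), (0, 0, -1, -1)),
   ((0, 1, 1, 0), (-1, 0, 0, -1), (1, 1, 0, -1))).

End GeneratorMatrices.

Definition jM : qm3 := powq (mulq uM vM) 2.
Definition uV := invq uM.
Definition vV := invq vM.
Definition bV := invq bM.
Definition j4M := powq jM 4.
(** The inverse of [j4M], as j^12 = 1. *)
Definition j4V := powq jM 8.
Definition a1M := prodq [:: vM; uM; vV; powq jM 4; bM; uM; vM; powq jM 2].
Definition a2M := prodq [:: powq vM 2; uM; bM; uM; vV; uM; powq vM 2; jM].
Definition a3M := prodq [:: uV; powq vM 2; uM; powq jM 9; bM; vV; uM; vV; powq jM 8].
Definition gM := prodq [:: bM; uM; vM].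

(* Reduction modulo the prime (sqrt 3) of Z[zeta]: zeta maps to a square root of
   -1 in F_9; the elements 0, 1, -1 of F_3 are None, Some false, Some true. *)
Definition f3 := option bool.
Definition add3 (x y : f3) : f3 :=
  match x, y with
  | None, _ => y
  | _, None => x
  | Some a, Some b => if a == b then Some (~~ a) else None
  end.
Definition opp3 (x : f3) : f3 := if x is Some a then Some (~~ a) else None.
Definition mult3 (x y : f3) : f3 :=
  match x, y with Some a, Some b => Some (a (+) b) | _, _ => None end.
Definition red3 (x : Z) : f3 :=
  match Z.modulo x 3 with Z0 => None | Zpos xH => Some false | _ => Some true end.

Definition f9 := (f3 * f3)%type.
Definition add9 (x y : f9) : f9 := (add3 x.1 y.1, add3 x.2 y.2).
Definition mul9 (x y : f9) : f9 :=
  (add3 (mult3 x.1 y.1) (opp3 (mult3 x.2 y.2)), add3 (mult3 x.1 y.2) (mult3 x.2 y.1)).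
Definition red9 (x : quad) : f9 :=
  let '(x0, x1, x2, x3) := x in (red3 (x0 - x2), red3 (x1 - x3)).
Definition mulm9 : m3 f9 -> m3 f9 -> m3 f9 := mul3 add9 mul9.
Definition redm (A : qm3) : m3 f9 := map3 red9 A.

(** Breadth-first closure: [fr] is the newest layer and [n] bounds the depth. *)
Fixpoint closure9 (n : nat) (gs fr acc : seq (m3 f9)) : seq (m3 f9) :=
  if n is n'.+1 then
    let nf := foldr (fun x s => if (x \in acc) || (x \in s) then s else x :: s) [::]
      [seq mulm9 x g | x <- fr, g <- gs] in
    closure9 n' gs nf (acc ++ nf)
  else acc.

(** Nested conditionals replace the generic equality, so that [vm_compute] stops at the first
    difference. *)
Definition eq3 (x y : f3) : bool :=
  match x, y with
  | None, None | Some true, Some true | Some false, Some false => true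
  | _, _ => false
  end.
Definition eqr9 (x y : row3 f9) : bool :=
  let '((a, b), (c, d), (e, f)) := x in let '((a', b'), (c', d'), (e', f')) := y in
  if eq3 a a' then if eq3 b b' then if eq3 c c' then if eq3 d d' then
  if eq3 e e' then eq3 f f' else false else false else false else false else false.
Definition eqm9 (x y : m3 f9) : bool :=
  let '(a, b, c) := x in let '(a', b', c') := y in
  if eqr9 a a' then if eqr9 b b' then eqr9 c c' else false else false.

(** The scalar zeta is adjoined to make membership independent of the representative of a class.
    That depth 20 is enough is confirmed by [P9_gen]. *)
Definition P9 : seq (m3 f9) := Eval vm_compute in
  closure9 20 [:: redm a1M; redm a2M; redm a3M; redm (scq qz Iq)] [:: redm Iq] [:: redm Iq].

Definition in9 (x : m3 f9) : bool := hasb (eqm9 x) P9.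
(** The determinants of the scalar matrices zeta^n I. *)
Definition cubes : seq quad := Eval vm_compute in [seq qzX n | n <- [:: 0; 3; 6; 9]].
(* By [PiGroup_test] and [test_PiGroup], this congruence test characterizes Pi. *)
Definition testPi (A : qm3) : bool := if detq A \in cubes then in9 (redm A) else false.

Lemma P9_gen :
  all (fun g => all (fun p => in9 (mulm9 (redm g) p)) P9)
    [:: a1M; a2M; a3M; invq a1M; invq a2M; invq a3M; scq qz Iq].
Proof. by vm_cast_no_check (erefl true). Qed.

(** Complete by [smallqP]: all x with |x|^2 = a + b sqrt 3 and a <= 2. *)
Definition smallq : seq quad :=
  [seq x <- [seq (x, d) | x <- [seq (x, c) | x <- [seq (a, b) | a <- [:: -1; 0; 1]%ZZ,
      b <- [:: -1; 0; 1]%ZZ], c <- [:: -1; 0; 1]%ZZ], d <- [:: -1; 0; 1]%ZZ]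
   | Z.leb (qnorm x).1 2].

Definition addp (x y : Z * Z) : Z * Z := (Z.add x.1 y.1, Z.add x.2 y.2).

Definition shell1 (q : quad) : bool := qnorm q == (1, 0)%ZZ.
Definition shell3 (q : quad) : bool := qnorm q == (4, 2)%ZZ.
(* The values of |A33|^2 up to 9 for A in the unitary group: 1, 2 + sqrt 3 and
   4 + 2 sqrt 3. *)
Definition shells (q : quad) : bool :=
  let n := qnorm q in [|| n == (1, 0)%ZZ, n == (2, 1)%ZZ | n == (4, 2)%ZZ].

(* First columns of the stabilizer of the origin: |x1|^2 + |x1 + (1-r)x2|^2 = 2. *)
Definition kcols : seq (quad * quad) :=
  pmap (fun p : quad * quad =>
    if addp (qnorm p.1) (qnorm p.2) == (2, 0)%ZZ then
      omap (pair p.1) (qhalf (qmul (qopp (qadd q1 qr)) (qsub p.2 p.1)))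
    else None)
  [seq (x, y) | x <- smallq, y <- smallq].

(* The remaining columns are determined by the first one and the determinant d. *)
Definition kmat (x : quad * quad) (d : quad) : option qm3 :=
  let: (x1, x2) := x in
  let y1 := qconj x1 in let y2 := qconj x2 in
  let al := qadd (qmul (qopp (qadd qr q1)) y1) y2 in
  let be := qadd y1 (qmul (qsub q1 qr) y2) in
  obind (fun p => omap (fun s => ((x1, p, q0), (x2, s, q0), (q0, q0, q1)))
     (qhalf (qmul (qsub q1 qr) (qadd (qmul al d) x2))))
   (qhalf (qmul (qsub qr q1) (qsub (qmul d be) x1))).

Definition Kdef : seq qm3 :=
  flatten [seq pmap (fun n => kmat x (qzX n)) (iota 0 12) | x <- kcols].
Definition Klist : seq qm3 := Eval vm_compute in Kdef.

(** * Finite verifications *)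

(* A straight-line program: the i-th pair multiplies two earlier entries of
   [Pilist]. The resulting elements of Pi suffice for [bKb_check]. *)
Definition slp : seq (nat * nat) :=
 [:: (4, 6); (6, 6); (7, 8); (2, 2); (2, 6); (10, 11); (9, 12); (2, 10); (9, 14);
(3, 5); (5, 5); (16, 17); (3, 3); (3, 1); (19, 20); (18, 21); (1, 22); (4, 5);
(5, 3); (17, 25); (1, 2); (19, 27); (26, 28); (29, 1); (24, 25); (1, 1); (19,
32); (31, 33); (13, 34); (13, 4); (9, 9); (2, 37); (1, 3); (19, 39); (40, 33);
(41, 5); (20, 5); (5, 4); (44, 8); (6, 2); (46, 10); (45, 47); (4, 48); (24,
27); (2, 4); (5, 1); (51, 52); (50, 53); (6, 4); (2, 1); (55, 56); (54, 57);
(55, 25); (59, 33); (1, 60); (44, 7); (8, 5); (62, 63); (24, 39); (4, 2); (1,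
5); (66, 67); (44, 56); (68, 69); (65, 70); (17, 5); (72, 21); (4, 4); (74,
8); (46, 56); (75, 76); (77, 22); (10, 24); (21, 5); (55, 17); (81, 21); (15,
82); (10, 39); (84, 73); (20, 67); (19, 86); (13, 64); (55, 5); (54, 89); (4,
9); (27, 51); (5, 6); (93, 8); (92, 94); (9, 84); (96, 73); (52, 55); (92,
98); (99, 5); (2, 39); (101, 9); (73, 102); (39, 20); (104, 81); (105, 9);
(56, 20); (73, 107); (108, 5); (4, 17); (1, 64); (19, 67); (26, 112); (21,
21); (114, 5); (6, 5); (8, 116); (74, 117); (51, 7); (119, 63); (21, 89);
(121, 15); (2, 19); (20, 27); (123, 124); (125, 4); (7, 55); (84, 127); (10,
56); (129, 22); (125, 22); (51, 8); (132, 47); (101, 70); (21, 1); (10, 1);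
(3, 4); (137, 8); (136, 138); (84, 7); (128, 30); (39, 66); (67, 44); (142,
143); (2, 144); (15, 81); (49, 105); (24, 1); (148, 79); (149, 105); (56, 17);
(17, 19); (152, 86); (8, 7); (154, 8); (20, 44); (156, 9); (157, 5); (56,
153); (21, 81); (148, 160); (1, 19); (162, 86); (1, 81); (22, 155); (2, 7);
(10, 4); (167, 37); (119, 8); (46, 39); (75, 170); (171, 4); (8, 4); (119,
173); (174, 95); (14, 37); (20, 19); (19, 177); (178, 13); (8, 10); (119,
180); (181, 24); (15, 64); (27, 7); (21, 184); (2, 185); (4, 56); (151, 187);
(128, 188); (84, 4); (84, 9); (191, 4); (191, 187); (24, 17); (13, 194); (2,
9); (1, 6); (19, 197); (198, 110); (152, 177); (200, 56); (201, 23); (55, 8);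
(75, 203); (2, 204); (3, 2); (19, 206); (207, 143); (154, 180); (24, 209);
(36, 210); (1, 17); (21, 212); (189, 23); (139, 73); (20, 81); (114, 212);
(208, 163); (169, 37); (167, 9); (21, 128); (114, 87); (2, 120); (19, 124);
(224, 37); (191, 24); (1, 160); (7, 24); (228, 15); (2, 229); (134, 23); (123,
86); (36, 90); (21, 199); (56, 39); (235, 73); (174, 236); (122, 110); (122,
43); (139, 9); (2, 3); (241, 19); (242, 32); (133, 106); (191, 9); (140, 164);
(221, 113); (68, 45); (51, 248); (28, 53); (250, 67); (232, 5); (135, 160);
(56, 160); (125, 73); (21, 160); (36, 150); (114, 72); (62, 8); (114, 259);
(166, 103); (15, 199); (55, 24); (15, 263); (264, 163); (191, 110); (114, 64);
(51, 55); (268, 17); (169, 81); (221, 150); (190, 216); (125, 37); (189, 106);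
(84, 87); (136, 160); (39, 67); (10, 277); (191, 91); (136, 103)].

Definition Pilist : seq qm3 :=
  foldl (fun s (p : nat * nat) => rcons s (mulq (nth Iq s p.1) (nth Iq s p.2)))
    [:: Iq; a1M; a2M; a3M; invq a1M; invq a2M; invq a3M] slp.
Definition qdot : row3 quad -> row3 quad -> quad := dot3 qadd qmul.
Definition lrow (A : qm3) : row3 quad := A.2.
Definition lcol (A : qm3) : row3 quad := (tr3 A).2.

(** The exponents 0, 1, -1 are coded by 0, 1, 2. *)
Definition bpow (n : nat) : qm3 := if n is 0 then Iq else if n is 1 then bM else bV.
Definition bpV (n : nat) : qm3 := if n is 0 then Iq else if n is 1 then bV else bM.

(* If the (3,3) entry of b^-n p^-1 x is a unit, then x lies in p b^n K, where K is
   the stabilizer of the origin; only last rows and last columns are needed. *)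
Definition bKb_rows : seq (row3 quad) :=
  [seq (lrow (mulq (bpV n) (invq p))) | n <- iota 0 3, p <- Pilist].
(** The position of a suitable row for each (n, k), found in advance so that the check does not
    search. *)
Definition bKb_hints : seq (seq nat) := Eval vm_compute in
  let rows := bKb_rows in
  [seq [seq (let c := lcol (mulq (bpow n) (mulq k bM)) in
        find (fun r => shell1 (qdot r c)) rows) | k <- Klist] | n <- iota 0 3].
Definition bKb_check : bool :=
  let rows := bKb_rows in
  allb (fun n => allb (fun x : qm3 * nat => let: (k, i) := x in
    shell1 (qdot (nth (lrow Iq) rows i) (lcol (mulq (bpow n) (mulq k bM)))))
      (zip Klist (nth [::] bKb_hints n))) (iota 0 3).
Lemma bKb_checkP : bKb_check.
Proof. by vm_cast_no_check (erefl true). Qed.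

(* Elements with |g33|^2 = 4 + 2 sqrt 3 form a single double coset of K. *)
Definition shell3_mx : qm3 := Eval vm_compute in
  nth Iq [seq x <- [seq mulq bV (mulq k bV) | k <- Klist] | shell3 (e33 x)] 0.
Definition dotmv (A : qm3) (y : row3 quad) : row3 quad :=
  let: (r1, r2, r3) := A in (qdot r1 y, qdot r2 y, qdot r3 y).
(** With s = [shell3_mx], an element x lies in K s K as soon as s^-1 c x fixes the origin for some c
    in K. *)
Definition shell3_check : bool :=
  allb (fun k => let x := mulq bV (mulq k bV) in
    if shell3 (e33 x) then
      let r := lrow (invq shell3_mx) in let y := lcol x in
      hasb (fun c => shell1 (qdot r (dotmv c y))) Klist
    else true) Klist.
Lemma shell3_checkP : shell3_check.
Proof. by vm_cast_no_check (erefl true). Qed.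

(** Treats the fixed points in the orbits of the b^n.0: an element of b^n K b^-n in Pi j^4 must be
    b^n j^4 b^-n. *)
Definition twist_stab_check : bool :=
  let J := j4M in
  allb (fun n => allb (fun k =>
    if testPi (mulq (mulq (bpow n) (mulq k (bpV n))) j4V) then k == J else true)
    Klist) (iota 0 3).
Lemma twist_stab_checkP : twist_stab_check.
Proof. by vm_cast_no_check (erefl true). Qed.

(** If m fixes a point with |z|^2 <= 1/2, so do its powers, and the (3,3) entry of each of them is
    restricted to [shells]. *)
Fixpoint pow_test (m p : qm3) (n : nat) : bool :=
  if shells (e33 p) then (if n is n'.+1 then pow_test m (mulq p m) n' else true) else false.
(* The determinants of the elements of Pi j^4. *)
Definition twist_dets : seq quad := Eval vm_compute in [seq qmul x (qzX 8) | x <- cubes].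
Definition bK : seq qm3 := [seq mulq (bpow n) k | n <- iota 0 3, k <- Klist].
Definition bK9 : seq (m3 f9 * m3 f9) := [seq (redm t, redm (invq t)) | t <- bK].
Definition hconj : seq qm3 := [seq mulq k (bpow n) | n <- iota 0 2, k <- Klist].
(* The determinant and the powers of m discard most candidates; [redm m] decides
   whether t m t^-1 can lie in Pi j^4 for some t = b^n k. *)
Definition twist_elliptic_check : bool :=
  let J := redm j4V in let T9 := bK9 in let H := hconj in
  allb (fun gs => allb (fun k => let m := mulq gs k in
     if detq m \in twist_dets then if pow_test m m 3 then
       let m9 := redm m in
       if allb (fun t => if in9 (mulm9 (mulm9 t.1 m9) (mulm9 t.2 J)) then false else true) T9
       then true else
       hasb (fun h => eqscq (mulq h gM) (mulq m h)) H
     else true else true) Klist) [:: bV; shell3_mx].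
Lemma twist_elliptic_checkP : twist_elliptic_check.
Proof. by vm_cast_no_check (erefl true). Qed.

(* a^3 + zeta b^3 + zeta^2 c^3 - 3 zeta a b c; with tau^3 = zeta it has the factor
   a + tau b + tau^2 c, whose vanishing it therefore detects within Z[zeta]. *)
Definition cubnorm (a b c : quad) : quad :=
  let cub x := qmul x (qmul x x) in
  let x := qmul qz (qmul a (qmul b c)) in
  qsub (qadd (cub a) (qadd (qmul qz (cub b)) (qmul (qzX 2) (cub c))))
    (qadd x (qadd x x)).
Definition subq (A B : qm3) : qm3 :=
  let: ((a11, a12, a13), (a21, a22, a23), (a31, a32, a33)) := A in
  let: ((b11, b12, b13), (b21, b22, b23), (b31, b32, b33)) := B in
  ((qsub a11 b11, qsub a12 b12, qsub a13 b13), (qsub a21 b21, qsub a22 b22, qsub a23 b23),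
   (qsub a31 b31, qsub a32 b32, qsub a33 b33)).
(* [moves_z0 s] holds only if s does not fix z0: the vector
   e3 + tau g e3 + tau^2 g^2 e3 over z0 is then not killed by g s - s g. *)
Definition moves_z0 (s : qm3) : bool :=
  let c := subq (mulq gM s) (mulq s gM) in
  let '(x1, x2, x3) := lcol c in
  let '(y1, y2, y3) := lcol (mulq c gM) in
  let '(z1, z2, z3) := lcol (mulq c (mulq gM gM)) in
  if cubnorm x1 y1 z1 == q0 then if cubnorm x2 y2 z2 == q0 then if cubnorm x3 y3 z3 == q0 then false
  else true else true else true.
Definition gpow : seq qm3 := [:: Iq; gM; mulq gM gM].
Definition stab_ok (s : qm3) : bool :=
  if moves_z0 s then true else hasb (eqscq s) gpow.
Lemma stab_ok_Klist : allb stab_ok Klist.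
Proof. by vm_cast_no_check (erefl true). Qed.

(* If s = k1 gs k2 fixes z0, then m^-1 g m (with m = k1 gs), s g and g s g all fix
   points near the origin, which restricts their (3,3) entries. *)
Definition z0_stab_check : bool :=
  allb (fun gs => allb (fun k1 => let m := mulq k1 gs in
    if shells (e33 (mulq (invq m) (mulq gM m))) then
      let r := lrow m in let r1 := lrow (mulq gM m) in
      allb (fun k2 =>
        let c := lcol (mulq k2 gM) in
        if shells (qdot r c) then
        if shells (qdot r1 c) then stab_ok (mulq m k2) else true else true) Klist
    else true) Klist) [:: bV; shell3_mx].
Lemma z0_stab_checkP : z0_stab_check.
Proof. by vm_cast_no_check (erefl true). Qed.

(* The vertices of a regular octahedron in P^1(C): directions of the translates
   k b^-1.0 closest to the origin. *)
Definition axes : seq (quad * quad) := Eval vm_compute in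
  let w := qsub (qsub (qzX 2) qz) q1 in
  [:: (w, q0); (q0, w); (q1, q1); (q1, qzX 3); (q1, qzX 6); (q1, qzX 9)].
(** Each axis occurs with all twelve phases zeta^n while the (3,3) entry stays 1 + zeta; [covering]
    chooses among these phases. *)
Definition axis_check : bool :=
  let cols := [seq lcol (mulq k bV) | k <- Klist] in
  allb (fun ax : quad * quad => allb (fun n =>
    let c := qzX n in let y1 := qmul c ax.1 in let y2 := qmul c ax.2 in
    hasb (fun x => let '(x1, x2, x3) := x in
      if x1 == y1 then if qadd x1 (qmul (qsub q1 qr) x2) == y2 then x3 == qadd q1 qz
      else false else false) cols) (iota 0 12)) axes.
Lemma axis_checkP : axis_check.
Proof. by vm_cast_no_check (erefl true). Qed.

Lemma Klist_ok : allb (fun k => if uq k then e33 k == q1 else false) Klist.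
Proof. by vm_cast_no_check (erefl true). Qed.

Lemma root_check :
  allb (fun x => if qnorm x == (1, 0)%ZZ then hasb (fun n => x == qzX n) (iota 0 12) else true)
  smallq.
Proof. by vm_cast_no_check (erefl true). Qed.

(** Among the b^n k b^-m only the identity passes the test. This makes the sets Pi b^n k pairwise
    distinct and, once they cover Gamma, makes the test sufficient. *)
Definition disjoint_check : bool :=
  allb (fun m => allb (fun n => allb (fun k =>
    if testPi (mulq (bpow n) (mulq k (bpV m))) then if n == m then k == Iq else false
    else true) Klist) (iota 0 3)) (iota 0 3).
Lemma disjoint_checkP : disjoint_check.
Proof. by vm_cast_no_check (erefl true). Qed.

(** The t for which t (buv) t^-1, which fixes t.z0, lies in Pi j^4. *)
Definition z0_hits : seq qm3 :=
  [seq t <- bK | testPi (mulq (mulq t (mulq gM (invq t))) j4V)].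
(* t.z0 and h.z0 have the same Pi-orbit, g, g^2 and 1 being the stabilizer of z0. *)
Definition linked (t h : qm3) : bool :=
  hasb (fun g => testPi (mulq t (mulq g (invq h)))) gpow.
Definition z0_reps : seq qm3 := Eval vm_compute in
  foldl (fun s t => if hasb (linked t) s then s else rcons s t) [::] z0_hits.
Definition z0_orbits_check : bool :=
  [&& size z0_reps == 6, allb uq z0_reps, allb (fun t => hasb (linked t) z0_reps) z0_hits,
    allb (fun h => testPi (mulq (mulq h (mulq gM (invq h))) j4V)) z0_reps &
    allb (fun n => allb (fun m =>
      if linked (nth Iq z0_reps n) (nth Iq z0_reps m) then n == m else true)
      (iota 0 6)) (iota 0 6)].
Lemma z0_orbits_checkP : z0_orbits_check.
Proof. by vm_cast_no_check (erefl true). Qed.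

Definition twist_b_check : bool :=
  allb (fun n => testPi (mulq (mulq (bpow n) (mulq j4M (bpV n))) j4V)) (iota 0 3).
Lemma twist_b_checkP : twist_b_check.
Proof. by vm_cast_no_check (erefl true). Qed.

Section Proof.
Variable R : realType.
Local Notation C := R[i].
Local Notation origin := (origin R).
Local Notation j4 := ((@j R) ^+ 4)%g.

(** * Evaluation in the complex numbers *)

Section Evaluation.
Local Open Scope ring_scope.
Local Open Scope sesquilinear_scope.

Definition zr (a : Z) : R := (int_of_Z a)%:~R.
Definition zc (a : Z) : C := (int_of_Z a)%:~R.

Definition evq (x : quad) : C :=
  let '(x0, x1, x2, x3) := x in
  zc x0 + zc x1 * zeta + zc x2 * zeta ^+ 2 + zc x3 * zeta ^+ 3.

Lemma zcD a b : zc (Z.add a b) = zc a + zc b.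
Proof. by rewrite /zc -rmorphD /= -rmorphD. Qed.

Lemma zcM a b : zc (Z.mul a b) = zc a * zc b.
Proof. by rewrite /zc -rmorphM /= -rmorphM. Qed.

Lemma zcN a : zc (Z.opp a) = - zc a.
Proof. by rewrite /zc -rmorphN /= -rmorphN. Qed.

Lemma zcB a b : zc (Z.sub a b) = zc a - zc b.
Proof. by rewrite -zcN -zcD. Qed.

Lemma zrD a b : zr (Z.add a b) = zr a + zr b.
Proof. by rewrite /zr -rmorphD /= -rmorphD. Qed.

Lemma zrM a b : zr (Z.mul a b) = zr a * zr b.
Proof. by rewrite /zr -rmorphM /= -rmorphM. Qed.

Lemma zrN a : zr (Z.opp a) = - zr a.
Proof. by rewrite /zr -rmorphN /= -rmorphN. Qed.

Lemma zrB a b : zr (Z.sub a b) = zr a - zr b.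
Proof. by rewrite -zrN -zrD. Qed.

Lemma zc_conj a : (zc a)^* = zc a.
Proof. by rewrite /zc rmorph_int. Qed.

Lemma zcE a : zc a = (zr a)%:C%C.
Proof. by rewrite /zc /zr rmorph_int. Qed.

Definition zc_morph := (zcD, zcB, zcM, zcN).

Lemma evqD : {morph evq : x y / qadd x y >-> x + y}.
Proof.
move=> [[[x0 x1] x2] x3] [[[y0 y1] y2] y3]; rewrite /= !zcD; ring.
Qed.

Lemma evqN x : evq (qopp x) = - evq x.
Proof. by case: x => [[[x0 x1] x2] x3]; rewrite /= !zcN; ring. Qed.

Lemma evqB x y : evq (qsub x y) = evq x - evq y.
Proof. by rewrite /qsub evqD evqN. Qed.

Lemma evqM : {morph evq : x y / qmul x y >-> x * y}.
Proof.
move=> [[[x0 x1] x2] x3] [[[y0 y1] y2] y3]; rewrite /= !zc_morph.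
ring: (@zeta4 R).
Qed.

Lemma evq_conj x : evq (qconj x) = (evq x)^*.
Proof.
case: x => [[[x0 x1] x2] x3] /=.
rewrite !(rmorphD, rmorphXn, rmorphM) /= ?rmorphM ?rmorphXn /= !zc_conj ?conj_zeta !zc_morph.
ring: (@zeta4 R).
Qed.

Lemma evq0 : evq q0 = 0. Proof. by rewrite /= /zc; ring. Qed.

Lemma evq1 : evq q1 = 1. Proof. by rewrite /= /zc; ring. Qed.

Lemma evqz : evq qz = zeta. Proof. by rewrite /= /zc; ring. Qed.

Lemma evqr : evq qr = rho. Proof. by rewrite rho_zeta /= /zc; ring. Qed.

Lemma evqzX n : evq (qzX n) = zeta ^+ n.
Proof.
elim: n => [|n IH]; first by rewrite evq1.
by rewrite -[qzX n.+1]/(qmul qz (qzX n)) evqM evqz exprS -IH.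
Qed.

Definition s3 : R := Num.sqrt 3.

Lemma s3_sqr : s3 ^+ 2 = 3.
Proof. by rewrite sqr_sqrtr. Qed.

Lemma s3_bound : 1732 / 1000 < s3 < 1733 / 1000.
Proof.
have s0 : 0 <= s3 := sqrtr_ge0 3.
have := s3_sqr; move: s0; set s := s3 => s0 e.
by apply/andP; split; nra.
Qed.

Lemma zetaE : zeta = (s3 / 2 +i* (1 / 2))%C :> C.
Proof.
have c0 := cos_pi6_gt0 R; have c2 := cos_pi6_sqr R; have s2 := sin_pi6_sqr R.
have s0 : 0 <= sin (2 * pi / 12) :> R.
  by apply: sin_ge0_pi; have := pi_ge0 R; move=> p; lra.
have := s3_bound; have := s3_sqr; rewrite /zeta; move: c0 c2 s0 s2.
set c := cos _; set t := sin _; set s := s3 => c0 c2 s0 s2 e /andP[b1 b2].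
congr (_ +i* _)%C; nra.
Qed.

(** The squared modulus with values in [R], where [lra] and [nra] apply. *)
Definition nsq (x : C) : R := complex.Re x ^+ 2 + complex.Im x ^+ 2.

Lemma nsqM x y : nsq (x * y) = nsq x * nsq y.
Proof. by case: x y => [a b] [c d]; rewrite /nsq /=; ring. Qed.

Lemma nsqN x : nsq (- x) = nsq x.
Proof. by case: x => a b; rewrite /nsq /= !sqrrN. Qed.

Lemma nsq_ge0 x : 0 <= nsq x.
Proof. by rewrite addr_ge0 ?sqr_ge0. Qed.

Lemma nsq_eq0 x : nsq x = 0 -> x = 0.
Proof.
case: x => a b /eqP; rewrite /nsq /= paddr_eq0 ?sqr_ge0 // !sqrf_eq0.
by move=> /andP[/eqP -> /eqP ->].
Qed.

Lemma nsq_CauchySchwarz x y z w :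
  nsq (x * z + y * w) <= (nsq x + nsq y) * (nsq z + nsq w).
Proof.
rewrite -subr_ge0; have -> : (nsq x + nsq y) * (nsq z + nsq w) - nsq (x * z + y * w) =
    nsq (x * w^* - y * z^*).
  case: x y z w => [x x'] [y y'] [z z'] [w w'].
  by rewrite /nsq /=; ring.
exact: nsq_ge0.
Qed.

Lemma nsq_triangle x y :
  (Num.sqrt (nsq x) - Num.sqrt (nsq y)) ^+ 2 <= nsq (x - y).
Proof.
have a0 := sqrtr_ge0 (nsq x); have a2 := sqr_sqrtr (nsq_ge0 x).
have b0 := sqrtr_ge0 (nsq y); have b2 := sqr_sqrtr (nsq_ge0 y).
move: a0 a2 b0 b2; set a := Num.sqrt _; set b := Num.sqrt _ => a0 a2 b0 b2.
suff : complex.Re x * complex.Re y + complex.Im x * complex.Im y <= a * b.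
  move: a2 b2; case: x @a a0 => [x x'] a a0; case: y @b b0 => [y y'] b b0.
  by rewrite /nsq /=; lra.
apply: le_trans (ler_norm _) _.
rewrite -(@ler_pXn2r _ 2) ?nnegrE ?mulr_ge0 // real_normK ?num_real //.
rewrite exprMn a2 b2 /nsq; set p := complex.Re x; set q := complex.Re y.
by set p' := complex.Im x; set q' := complex.Im y; have := sqr_ge0 (p * q' - p' * q); lra.
Qed.

Lemma nsq_conj x : nsq x^* = nsq x.
Proof. by case: x => a b; rewrite /nsq /= sqrrN. Qed.

Lemma nsqC x : (nsq x)%:C%C = x^* * x.
Proof.
case: x => a b; rewrite /nsq; have -> : (a +i* b)%C^* = (a -i* b)%C by [].
by simpc; apply/eqP; rewrite eq_complex /=; apply/andP; split; apply/eqP; ring.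
Qed.

Lemma evq_re_im x : let '(x0, x1, x2, x3) := x in
  evq x = ((zr x0 + zr x2 / 2 + zr x1 * s3 / 2) +i*
           (zr x1 / 2 + zr x2 * s3 / 2 + zr x3))%C.
Proof.
case: x => [[[x0 x1] x2] x3] /=; rewrite !zcE zetaE; have := s3_sqr.
set s := s3 => e; rewrite !exprS expr0 mulr1; simpc.
apply/eqP; rewrite eq_complex /=; apply/andP; split; apply/eqP; by field: e.
Qed.

Lemma nsq_evq x : nsq (evq x) = zr (qnorm x).1 + zr (qnorm x).2 * s3.
Proof.
have := evq_re_im x; case: x => [[[x0 x1] x2] x3] -> /=.
rewrite /nsq /= !(zrD, zrM); have := s3_sqr; set s := s3 => e.
by field: e.
Qed.

(* The second real place of Q(sqrt 3). *)
Lemma qnorm_conj_ge0 x : 0 <= zr (qnorm x).1 - zr (qnorm x).2 * s3.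
Proof.
case: x => [[[x0 x1] x2] x3] /=; rewrite !(zrD, zrM).
have := s3_sqr; set s := s3 => e.
suff -> : forall a b c d : R,
    a * a + b * b + c * c + d * d + a * c + b * d - (a * b + b * c + c * d) * s =
    (a + c / 2 - b * s / 2) ^+ 2 + (b / 2 - c * s / 2 + d) ^+ 2.
  by rewrite addr_ge0 ?sqr_ge0.
by move=> a b c d; field: e.
Qed.

Lemma zr0 : zr Z0 = 0. Proof. by []. Qed.

Lemma zr_inj : injective zr.
Proof. by move=> a b /eqP; rewrite eqr_int => /eqP /(can_inj int_of_ZK). Qed.

Lemma zr_lt a b : (zr a < zr b) = Z.ltb a b.
Proof. rewrite ltr_int; apply/idP/idP; lia. Qed.

Lemma zr_le a b : (zr a <= zr b) = Z.leb a b.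
Proof. rewrite ler_int; apply/idP/idP; lia. Qed.

(** For nonzero b the two sides would have 3-adic valuations of different parity. *)
Lemma sqr3_irrational (a b : Z) : Z.mul a a = Z.mul 3 (Z.mul b b) -> b = Z0.
Proof.
move=> e; case: (eqVneq b Z0) => // b0; exfalso.
have {e} : `|int_of_Z (Z.mul a a)|%N = `|int_of_Z (Z.mul 3 (Z.mul b b))|%N by rewrite e.
rewrite !rmorphM /= !abszM -[`|int_of_Z 3|%N]/3%N.
have {}b0 : (0 < `|int_of_Z b|)%N.
  by rewrite absz_gt0; apply: contra_neq b0 => /(congr1 Z_of_int); rewrite int_of_ZK.
move: b0; set m := `|int_of_Z b|%N; set n := `|int_of_Z a|%N => b0 e.
have a0 : (0 < n)%N by rewrite lt0n; apply: contra_eq_neq e => ->; rewrite mul0n; nia.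
have := congr1 (logn 3) e; rewrite !lognM ?muln_gt0 ?a0 ?b0 //.
rewrite -[logn 3 3]/1%N; lia.
Qed.

Lemma zr_s3_inj a b c d : zr a + zr b * s3 = zr c + zr d * s3 -> a = c /\ b = d.
Proof.
move=> e; have {e} e : zr (Z.sub a c) = zr (Z.sub d b) * s3.
  by rewrite !zrB; move: e; set s := s3 => e; lra.
have d0 : Z.sub d b = Z0.
  apply: (@sqr3_irrational (Z.sub a c)); apply: zr_inj; rewrite !zrM.
  have -> : zr 3 = 3 by rewrite /zr.
  by rewrite e -s3_sqr; ring.
have c0 : Z.sub a c = Z0 by apply: zr_inj; rewrite e d0 zr0 mul0r.
lia.
Qed.

(** This component is a positive definite form: its double is a^2 + c^2 + (a + c)^2 + b^2 + d^2 + (b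
    + d)^2. *)
Lemma qnorm_eq0 x : (qnorm x).1 = Z0 -> x = q0.
Proof.
case: x => [[[a b] c] d] /= e.
have := Z.square_nonneg (Z.add a c); have := Z.square_nonneg (Z.add b d).
have := Z.square_nonneg a; have := Z.square_nonneg b.
have := Z.square_nonneg c; have := Z.square_nonneg d => h1 h2 h3 h4 h5 h6.
have sq0 y : Z.mul y y = Z0 -> y = Z0 by move=> /Z.mul_eq_0 [].
by congr (_, _, _, _); apply: sq0; lia.
Qed.

(** Linear independence of 1, zeta, zeta^2, zeta^3 over Z, read off from the norm and the
    irrationality of sqrt 3. *)
Lemma evq_eq0 x : evq x = 0 -> x = q0.
Proof.
move=> e; have := nsq_evq x; have -> : nsq (evq x) = 0 by rewrite e /nsq /=; ring.
move=> n0.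
have : zr 0 + zr 0 * s3 = zr (qnorm x).1 + zr (qnorm x).2 * s3.
  by rewrite -n0 zr0; ring.
by case/zr_s3_inj => /esym/qnorm_eq0.
Qed.

Lemma evq_inj : injective evq.
Proof.
move=> x y e; have : evq (qsub x y) = 0 by rewrite evqB e subrr.
move/evq_eq0; case: x y {e} => [[[a b] c] d] [[[a' b'] c'] d'] /= [????].
by congr (_, _, _, _); lia.
Qed.

Lemma Zzeta_evq x : x \in Zzeta -> exists q, x = evq q.
Proof.
move=> /asboolP[p ->]; elim/poly_ind: p => [|p a [q IH]].
  by exists q0; rewrite evq0 rmorph0 horner0.
exists (qadd (qmul q qz) (Z_of_int a, Z0, Z0, Z0)).
rewrite rmorphD rmorphM /= map_polyX map_polyC /= hornerMXaddC IH.
rewrite evqD evqM evqz; congr (_ + _).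
by rewrite /= /zc Z_of_intK; ring.
Qed.

Lemma evq_Zzeta q : evq q \in Zzeta.
Proof.
case: q => [[[a b] c] d]; have z := Zzeta_zeta R; have zX n := rpredX n z.
by rewrite /= !(rpredD, rpredM) // /zc rpred_int.
Qed.

Definition mxr3 (A : m3 C) : 'M[C]_3 :=
  let '((a11, a12, a13), (a21, a22, a23), (a31, a32, a33)) := A in
  mx3 [:: [:: a11; a12; a13]; [:: a21; a22; a23]; [:: a31; a32; a33]].

Lemma mxr3M A B : mxr3 (mul3 +%R *%R A B) = mxr3 A *m mxr3 B.
Proof.
case: A => [[[[a11 a12] a13] [[a21 a22] a23]] [[a31 a32] a33]].
by case: B => [[[[b11 b12] b13] [[b21 b22] b23]] [[b31 b32] b33]]; rewrite /= mul_mx3.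
Qed.

Definition evm (A : qm3) : 'M[C]_3 := mxr3 (map3 evq A).

Lemma evmM A B : evm (mulq A B) = evm A *m evm B.
Proof. by rewrite /evm -mxr3M (map3_mul evqD evqM). Qed.

Lemma evm_ct A : evm (ctq A) = (evm A)^t*.
Proof.
case: A => [[[[a11 a12] a13] [[a21 a22] a23]] [[a31 a32] a33]].
by rewrite /evm [mxr3 _]/= !evq_conj [in RHS]/= conj_mx3.
Qed.

Lemma evm_sc c A : evm (scq c A) = evq c *: evm A.
Proof.
case: A => [[[[a11 a12] a13] [[a21 a22] a23]] [[a31 a32] a33]].
rewrite /evm [mxr3 _]/= !evqM [in RHS]/= -mul_scalar_mx mx3_scalar mul_mx3.
by do ![congr (_ :: _) | congr mx3]; ring.
Qed.

Lemma evm1 : evm Iq = 1%:M.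
Proof. by rewrite /evm mx3_scalar /Iq [mxr3 _]/= /zc; do ![congr (_ :: _) | congr mx3]; ring. Qed.

Lemma evmF : evm Fq = Fmx R.
Proof.
rewrite /evm /Fq /Fmx -evqr [map3 _ _]/map3 /mxr3 !(evqB, evqN, evq1, evq0).
by do ![congr (_ :: _) | congr mx3]; ring.
Qed.

Lemma mx3_inj (a b c d e f g h i a' b' c' d' e' f' g' h' i' : C) :
  mx3 [:: [:: a; b; c]; [:: d; e; f]; [:: g; h; i]] =
  mx3 [:: [:: a'; b'; c']; [:: d'; e'; f']; [:: g'; h'; i']] ->
  ((a, b, c), (d, e, f), (g, h, i)) = ((a', b', c'), (d', e', f'), (g', h', i')).
Proof.
move=> E; have P i0 j0 := congr1 (fun M : 'M[C]_3 => M (inord i0) (inord j0)) E.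
move: (P 0 0) (P 0 1) (P 0 2) (P 1 0) (P 1 1) (P 1 2) (P 2 0) (P 2 1) (P 2 2)%N.
by rewrite !mxE !inordK //= => -> -> -> -> -> -> -> -> ->.
Qed.

Lemma evm_inj : injective evm.
Proof.
move=> [[[[a11 a12] a13] [[a21 a22] a23]] [[a31 a32] a33]].
move=> [[[[b11 b12] b13] [[b21 b22] b23]] [[b31 b32] b33]].
rewrite /evm ![map3 _ _]/= ![mxr3 _]/= => /mx3_inj.
by case=> /evq_inj -> /evq_inj -> /evq_inj -> /evq_inj -> /evq_inj -> /evq_inj ->
  /evq_inj -> /evq_inj -> /evq_inj ->.
Qed.

Lemma evm_surj (M : 'M[C]_3) : M \is a mxOver Zzeta -> exists A, M = evm A.
Proof.
move=> /mxOverP Mz.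
have P i k : exists q, M (inord i) (inord k) = evq q by apply/Zzeta_evq/Mz.
have [a11 e11] := P 0 0; have [a12 e12] := P 0 1; have [a13 e13] := P 0 2%N.
have [a21 e21] := P 1 0; have [a22 e22] := P 1 1; have [a23 e23] := P 1 2%N.
have [a31 e31] := P 2 0; have [a32 e32] := P 2 1; have [a33 e33] := P 2 2%N.
exists ((a11, a12, a13), (a21, a22, a23), (a31, a32, a33)).
by apply: mx3_eq => -[|[|[|//]]] [|[|[|//]]] _ _; rewrite ?e11 ?e12 ?e13 ?e21
  ?e22 ?e23 ?e31 ?e32 ?e33 !mxE !inordK.
Qed.

Lemma evm_over A : evm A \is a mxOver Zzeta.
Proof.
case: A => [[[[a11 a12] a13] [[a21 a22] a23]] [[a31 a32] a33]].
apply: mx3_over; first exact: rpred0.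
by rewrite /= !evq_Zzeta.
Qed.

Lemma uqP A : uq A = unitaryF (evm A).
Proof.
rewrite /unitaryF evm_over -evmF -evm_ct -!evmM /uq.
by apply/eqP/eqP => [-> //|/evm_inj].
Qed.

End Evaluation.

(** * The Hermitian form on the ball *)

Section Geometry.
Local Open Scope ring_scope.
Local Open Scope sesquilinear_scope.

Definition n2 (p : B2 R) : R := nsq (val p).1 + nsq (val p).2.

Lemma nsq_norm (x : C) : `|x| ^+ 2 = (nsq x)%:C%C.
Proof. by rewrite normCK nsqC mulrC. Qed.

Lemma n2_lt1 p : n2 p < 1.
Proof. by have := valP p; rewrite /= !nsq_norm -rmorphD /= -(ltcR _ 1). Qed.

Lemma n2_ge0 p : 0 <= n2 p.
Proof. by rewrite addr_ge0 ?nsq_ge0. Qed.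

Definition jf (x y : 'cV[C]_3) : C := (x^t* *m Jmx R *m y) 0 0.

Lemma jfE x y : jf x y =
  (x 0 0)^* * y 0 0 + (x 1 0)^* * y 1 0 - (x 2 0)^* * y 2 0.
Proof.
rewrite /jf !mxE !big_ord_recl big_ord0 !mxE !big_ord_recl !big_ord0 !mxE /=.
have -> : lift ord0 ord0 = 1 :> 'I_3 by apply: val_inj.
have -> : lift ord0 (lift ord0 ord0) = 2 :> 'I_3 by apply: val_inj.
have -> : ord0 = 0 :> 'I_3 by apply: val_inj.
ring.
Qed.

Lemma jf_tilde (g : UF R) x y : jf (tilde g *m x) (tilde g *m y) = jf x y.
Proof.
rewrite /jf trmx_mul map_mxM; move: (tilde g) (tilde_unitary g) => T e.
by rewrite -[in RHS]e !mulmxA.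
Qed.

Lemma jfZr (c : C) x y : jf x (c *: y) = c * jf x y.
Proof. by rewrite /jf -scalemxAr mxE. Qed.

Definition hz (p : B2 R) : 'cV[C]_3 := hcol (val p).

Lemma jfZl (c : C) x y : jf (c *: x) y = c^* * jf x y.
Proof. by rewrite !jfE !mxE !rmorphM; ring. Qed.

Lemma jf_hz2 p q : jf (hz p) (hz q) =
  (val p).1^* * (val q).1 + (val p).2^* * (val q).2 - 1.
Proof.
have hz0 r : (hz r) 0 0 = (val r).1 by rewrite mxE.
have hz1 r : (hz r) 1 0 = (val r).2 by rewrite mxE.
have hz2 r : (hz r) 2 0 = 1 by rewrite mxE.
by rewrite jfE !hz0 !hz1 !hz2 rmorph1 mulr1.
Qed.

Lemma jf_origin p : jf (hz origin) (hz p) = - 1.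
Proof. by rewrite jf_hz2 rmorph0 !mul0r !add0r. Qed.

Lemma hz_actUF (g : UF R) p :
  exists2 c : C, c != 0 & tilde g *m hz p = c *: hz (actUF g p).
Proof. exact: hcol_actUF. Qed.

Lemma jf_hz p : jf (hz p) (hz p) = (n2 p - 1)%:C%C.
Proof.
by rewrite jf_hz2 -nsqC -nsqC /n2 rmorphB [in RHS]rmorphD rmorph1.
Qed.

(** By invariance of the form, this is minus the last coordinate of the image of (z, w, 1)^T under
    g^-1, that is, minus the automorphy factor of g^-1 at p. *)
Definition hval (g : UF R) (p : B2 R) : C := jf (tilde g *m hz origin) (hz p).

Local Open Scope group_scope.

(** The form takes the value |z|^2 - 1 on the lift of a point, and g multiplies the lift by the
    automorphy factor. *)
Lemma n2_act g p : (nsq (hval (g^-1)%g p) * (1 - n2 (actUF g p)) = 1 - n2 p)%R.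
Proof.
have [l l0 e] := hz_actUF g p.
have -> : hval g^-1 p = (- l)%R.
  rewrite /hval -(jf_tilde g) mulmxA -tildeM -[UFmx g *m _]/(UFmx (g * g^-1)).
  by rewrite mulgV e jfZr tilde1 mul1mx jf_origin mulrN mulr1.
have := jf_tilde g (hz p) (hz p); rewrite e jfZr jfZl mulrA (mulrC l) -nsqC !jf_hz -rmorphM.
move=> /(congr1 (@complex.Re R)) /=.
by rewrite nsqN; set a := n2 _; set b := n2 _; lra.
Qed.

Lemma actUF_fix g p : actUF g p = p -> nsq (hval g p) = 1%R.
Proof.
move=> gp; have gVp : actUF g^-1 p = p.
  by rewrite -{1}gp -actUFM mulVg -[RHS](actUF_center p (Zcenter1 R)).
have := n2_act g^-1 p; rewrite invgK gVp; have := n2_lt1 p.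
by set a := n2 p; set b := nsq _; nra.
Qed.

Lemma cos_num_gt0 : (0 < s3 - 1)%R.
Proof. by have /andP[] := s3_bound; set s := s3; lra. Qed.

Definition dr : R := Num.sqrt (s3 - 1)%R.

Lemma dr_sqr : (dr ^+ 2 = s3 - 1)%R.
Proof. by rewrite sqr_sqrtr // ltW // cos_num_gt0. Qed.

Lemma dsqrtE : dsqrt R = (dr)%:C%C. Proof. by []. Qed.

Lemma nsq_dsqrtV (x : C) : nsq (x / dsqrt R)%R = (nsq x / (s3 - 1))%R.
Proof.
apply: (canRL (mulfK _)); first by rewrite gt_eqF // cos_num_gt0.
have -> : (s3 - 1)%R = nsq (dsqrt R) by rewrite -dr_sqr dsqrtE /nsq /= expr0n addr0.
by rewrite -nsqM mulfVK // dsqrt_neq0.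
Qed.

Lemma Dgamma0 : (Dmx R *m gamma0 R =
  mx3 [:: [:: 1; 0; 0]; [:: 1; 1 - rho; 0]; [:: 0; 0; dsqrt R]])%R.
Proof. by rewrite mul_mx3; do ![congr (_ :: _) | congr mx3]; ring. Qed.

Lemma mx3_col (a b c d e f g h i : C) (x : 'cV[C]_3) :
  (mx3 [:: [:: a; b; c]; [:: d; e; f]; [:: g; h; i]] *m x =
   \col_k [:: a * x 0 0 + b * x 1 0 + c * x 2 0; d * x 0 0 + e * x 1 0 + f * x 2 0;
              g * x 0 0 + h * x 1 0 + i * x 2 0]`_k)%R.
Proof.
apply/matrixP => k l; rewrite ord1 !mxE !big_ord_recl big_ord0 !mxE /=.
have -> : lift ord0 ord0 = 1%R :> 'I_3 by apply: val_inj.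
have -> : lift ord0 (lift ord0 ord0) = 2%R :> 'I_3 by apply: val_inj.
have -> : ord0 = 0%R :> 'I_3 by apply: val_inj.
by case: k => [[|[|[|//]]]] ? /=; rewrite addr0 addrA.
Qed.

Lemma tilde_hz0 (g : UF R) :
  (tilde g *m hz origin =
  \col_i [:: UFmx g 0 2 / dsqrt R; (UFmx g 0 2 + (1 - rho) * UFmx g 1 2) / dsqrt R;
             UFmx g 2 2]`_i)%R.
Proof.
have e : (hz origin = (dsqrt R)^-1 *: (Dmx R *m gamma0 R *m delta_mx 2 0))%R.
  rewrite Dgamma0 mx3_col; apply/matrixP => i k; rewrite ord1 !mxE /=.
  have d0 := dsqrt_neq0 R.
  by case: i => [[|[|[|//]]]] ? /=; field.
have d0 := dsqrt_neq0 R.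
rewrite e -scalemxAr mulmxA tilde_conj -(mulmxA (Dmx R *m gamma0 R)) -colE Dgamma0 mx3_col.
apply/matrixP => i k; rewrite ord1 !mxE /=.
by case: i => [[|[|[|//]]]] ? /=; field.
Qed.

Lemma hvalE (g : UF R) p : (hval g p =
  (UFmx g 0 2 / dsqrt R)^* * (val p).1 +
  ((UFmx g 0 2 + (1 - rho) * UFmx g 1 2) / dsqrt R)^* * (val p).2 - (UFmx g 2 2)^*)%R.
Proof. by rewrite /hval tilde_hz0 jfE !mxE /=; ring. Qed.

(** The image of the lift of the origin still has form -1. *)
Lemma col3_norm (g : UF R) :
  (nsq (UFmx g 0 2) + nsq (UFmx g 0 2 + (1 - rho) * UFmx g 1 2)
  = (s3 - 1) * (nsq (UFmx g 2 2) - 1))%R.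
Proof.
have := jf_tilde g (hz origin) (hz origin).
rewrite tilde_hz0 jf_hz jfE !mxE /= -!nsqC -rmorphD -rmorphB.
move=> /(congr1 (@complex.Re R)) /=; rewrite !nsq_dsqrtV /n2 /= => e.
have : nsq 0%R = 0%R by rewrite /nsq /=; ring.
have := cos_num_gt0; move: e; set a := nsq _; set b := nsq _; set c := nsq _.
set s := s3 => e s0 z; move: e; rewrite z => e.
have e1 : (a / (s - 1) + b / (s - 1) = c - 1)%R by move: e; lra.
by rewrite -e1; field; lra.
Qed.

(** Here [hval g p] has modulus 1 and equals w - conj g33, where |w|^2 <= (|g33|^2 - 1) / 2 by
    Cauchy-Schwarz. With t = |g33| this gives (t - 1)^2 <= (t^2 - 1) / 2 for t > 1, hence t <= 3. *)
Lemma fix_bound g p : (n2 p <= 1 / 2)%R -> actUF g p = p -> (nsq (UFmx g 2 2) <= 9)%R.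
Proof.
move=> p_small /actUF_fix; rewrite hvalE.
set w := (X in nsq (X - _)%R) => h.
have cs : (nsq w <= (nsq (UFmx g 2 2) - 1) * n2 p)%R.
  apply: le_trans (nsq_CauchySchwarz _ _ _ _) _; rewrite !nsq_conj !nsq_dsqrtV -mulrDl col3_norm.
  by rewrite (mulrC (s3 - 1)%R) mulfK ?gt_eqF ?cos_num_gt0.
have := nsq_triangle w (UFmx g 2 2)^*; rewrite h nsq_conj.
have a0 := sqrtr_ge0 (nsq w); have a2 := sqr_sqrtr (nsq_ge0 w).
have b0 := sqrtr_ge0 (nsq (UFmx g 2 2)); have b2 := sqr_sqrtr (nsq_ge0 (UFmx g 2 2)).
move: a0 a2 b0 b2 cs; set a := Num.sqrt (nsq w); set b := Num.sqrt (nsq (UFmx g 2 2)).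
rewrite -[(9 : R)%R]/(9%:R)%R => a0 <- b0 <- cs tri.
have n0 := n2_ge0 p; move: p_small n0 cs; set n := n2 p => p_small n0 cs.
rewrite leNgt; apply/negP => b9.
have b3 : (3 < b)%R by move: b0 b9; clear; nra.
have ab : (b - 1 <= a)%R by move: tri a0 b3; clear; nra.
have : (a ^+ 2 <= (b ^+ 2 - 1) / 2)%R by move: cs p_small b9; clear; nra.
by move: ab b3; clear; nra.
Qed.

End Geometry.

(** * Possible values of |A_33|^2 *)

Section Shells.
Local Open Scope ring_scope.

Definition e13 T (A : m3 T) : T := let '((_, _, x), _, _) := A in x.
Definition e23 T (A : m3 T) : T := let '(_, (_, _, x), _) := A in x.

Lemma lcolE A : lcol A = (e13 A, e23 A, e33 A).
Proof. by case: A => [[[[a11 a12] a13] [[a21 a22] a23]] [[a31 a32] a33]]. Qed.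

Lemma evm02 A : evm A 0 2 = evq (e13 A).
Proof.
by case: A => [[[[a11 a12] a13] [[a21 a22] a23]] [[a31 a32] a33]]; rewrite !mxE.
Qed.

Lemma evm12 A : evm A 1 2 = evq (e23 A).
Proof.
by case: A => [[[[a11 a12] a13] [[a21 a22] a23]] [[a31 a32] a33]]; rewrite !mxE.
Qed.

Lemma evm22 A : evm A 2 2 = evq (e33 A).
Proof.
by case: A => [[[[a11 a12] a13] [[a21 a22] a23]] [[a31 a32] a33]]; rewrite !mxE.
Qed.

(** [Y1] and [Y2], divided by [dsqrt], are the first two coordinates of the image of (0, 0, 1)^T in
    the ball model. *)
Definition Y1 (A : qm3) : quad := e13 A.
Definition Y2 (A : qm3) : quad := qadd (e13 A) (qmul (qsub q1 qr) (e23 A)).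

Lemma uq_UF A : uq A -> {g : UF R | UFmx g = evm A}.
Proof. by rewrite uqP => uA; exists (MkUF uA). Qed.

Lemma col3_nsq A : uq A ->
  nsq (evq (Y1 A)) + nsq (evq (Y2 A)) = (s3 - 1) * (nsq (evq (e33 A)) - 1).
Proof.
move=> /uq_UF[g gA]; have := col3_norm g.
by rewrite gA evm02 evm12 evm22 /Y2 evqD evqM evqB evq1 evqr.
Qed.

(** Compare coefficients of sqrt 3 in [col3_nsq] and conjugate: the factor sqrt 3 - 1 becomes
    negative while the norms stay nonnegative, so the conjugate of |A33|^2 is at most 1. *)
Lemma col3_qnorm A : uq A ->
  let: (a, b) := qnorm (e33 A) in
  [/\ 1 <= zr a + zr b * s3, 0 <= zr a - zr b * s3 <= 1 &
      addp (qnorm (Y1 A)) (qnorm (Y2 A)) =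
        (Z.add (Z.sub (Z.mul 3 b) a) 1, Z.sub (Z.sub a b) 1)].
Proof.
move=> /col3_nsq; have := nsq_ge0 (evq (Y1 A)); have := nsq_ge0 (evq (Y2 A)).
have := qnorm_conj_ge0 (Y1 A); have := qnorm_conj_ge0 (Y2 A).
have := qnorm_conj_ge0 (e33 A); rewrite !nsq_evq /addp.
case: (qnorm (e33 A)) (qnorm (Y1 A)) (qnorm (Y2 A)) => [a b] [a1 b1] [a2 b2] /=.
have /andP[sl su] := s3_bound; have s2 := s3_sqr.
move=> c0 d2 d1 n2 n1 e.
have [ea eb] : Z.add a1 a2 = Z.add (Z.sub (Z.mul 3 b) a) 1 /\
    Z.add b1 b2 = Z.sub (Z.sub a b) 1.
  apply: zr_s3_inj; rewrite !(zrD, zrB, zrM) -[zr 3]/(3%:R) -[zr 1]/(1%:R).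
  transitivity ((zr a1 + zr b1 * s3) + (zr a2 + zr b2 * s3)); first by ring.
  by rewrite e; ring: s2.
have ea' := congr1 zr ea; have eb' := congr1 zr eb.
move: ea' eb'; rewrite !(zrD, zrB, zrM) -[zr 3]/(3%:R) -[zr 1]/(1%:R) => ea' eb'.
split; last by congr (_, _).
  by move: n1 n2 e sl; clear; nra.
apply/andP; split; first exact: c0.
have : (zr a1 - zr b1 * s3) + (zr a2 - zr b2 * s3) = - ((s3 + 1) * (zr a - zr b * s3 - 1)).
  transitivity ((zr a1 + zr a2) - (zr b1 + zr b2) * s3); first by ring.
  by rewrite ea' eb'; ring: s2.
by move: d1 d2 sl; clear; nra.
Qed.

(** The bounds on both conjugates leave b = 0, 1, 2, 3, and a lies in an interval of length 1
    starting at b sqrt 3, hence is determined by b; b = 3 would exceed 9. *)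
Lemma shells_bound A : uq A -> nsq (evq (e33 A)) <= 9 -> shells (e33 A).
Proof.
move=> /col3_qnorm; rewrite nsq_evq /shells; case: (qnorm _) => a b /= [h1 /andP[h2 h3] _] h4.
have /andP[sl su] := s3_bound.
have zeq x (n : nat) : n%:R - 1 < zr x -> zr x < n%:R + 1 -> x = Z.of_nat n.
  have <- : zr (Z.of_nat n) = n%:R.
    by rewrite -[n%:R]/(n%:Z%:~R) /zr; congr (_%:~R); clear; lia.
  by rewrite -[1]/(zr 1) -zrB -zrD !zr_lt; clear; lia.
move: h1 h2 h3 h4 sl su; set s := s3 => h1 h2 h3 h4 sl su.
have b_up : zr b < 4%:R.
  have : zr b * s <= 9 / 2 by move: h2 h4; clear; lra.
  by rewrite ltNge => bs; apply/negP; move: bs sl; clear; nra.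
have b_lo : -1 < zr b.
  have : 0 <= zr b * s by move: h1 h3; clear; lra.
  by rewrite ltNge => bs; apply/negP; move: bs sl; clear; nra.
have : b = 0%ZZ \/ b = 1%ZZ \/ b = 2%ZZ \/ b = 3%ZZ.
  by move: b_up b_lo; rewrite -[4%:R]/(zr 4) -[-1]/(zr (-1)) !zr_lt; clear; lia.
case=> [|[|[|]]] eb; move: h1 h2 h3 h4 sl su; rewrite eb.
- rewrite zr0 mul0r => h1 _ h3 _ _ _.
  by have -> : a = 1%ZZ by apply: (zeq _ 1%N); move: h1 h3; clear; lra.
- rewrite -[zr 1]/(1%:R) => _ h2 h3 _ sl su.
  by have -> : a = 2%ZZ by apply: (zeq _ 2%N); move: h2 h3 sl su; clear; lra.
- rewrite -[zr 2]/(2%:R) => _ h2 h3 _ sl su.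
  by have -> : a = 4%ZZ by apply: (zeq _ 4%N); move: h2 h3 sl su; clear; lra.
by rewrite -[zr 3]/(3%:R) => _ h2 _ h4 sl _; exfalso; move: h2 h4 sl; clear; lra.
Qed.

(** Provides the integer measure of the descent. If a >= c, then b + 1 <= d, so a - b sqrt 3 would
    be at least sqrt 3 + (c - d sqrt 3) > 1. *)
Lemma qnorm_lt A B : uq A -> uq B -> nsq (evq (e33 A)) < nsq (evq (e33 B)) ->
  Z.lt (qnorm (e33 A)).1 (qnorm (e33 B)).1.
Proof.
move=> /col3_qnorm hA /col3_qnorm hB; rewrite !nsq_evq; move: hA hB.
case: (qnorm (e33 A)) (qnorm (e33 B)) => [a b] [c d] /=.
move=> [h1 /andP[h2 h3] _] [k1 /andP[k2 k3] _] h.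
have /andP[sl su] := s3_bound.
suff : zr a < zr c by rewrite ltr_int; clear; lia.
rewrite ltNge; apply/negP => ca.
have bd : zr b < zr d by nra.
have : zr b + 1 <= zr d.
  by rewrite -[1]/(zr 1) -zrD zr_le; move: bd; rewrite zr_lt; clear; lia.
nra.
Qed.

End Shells.

(** * The stabilizer of the origin *)

Section Stabilizer.
Local Open Scope ring_scope.
Local Open Scope sesquilinear_scope.

Lemma smallqP x : Z.le (qnorm x).1 2 -> x \in smallq.
Proof.
case: x => [[[a b] c] d] e; rewrite mem_filter; apply/andP; split; first by apply/Z.leb_le.
rewrite /= in e.
have := Z.square_nonneg (Z.add a c); have := Z.square_nonneg (Z.add b d).
have := Z.square_nonneg a; have := Z.square_nonneg b.
have := Z.square_nonneg c; have := Z.square_nonneg d => h1 h2 h3 h4 h5 h6.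
have sq1 y : Z.lt (Z.mul y y) 4 -> y \in [:: -1; 0; 1]%ZZ.
  move=> y4; have : y = (-1)%ZZ \/ y = 0%ZZ \/ y = 1%ZZ by nia.
  by case=> [->|[->|->]].
(* These squares give 3 a^2 <= 4 (a^2 + a c + c^2) <= 8, and likewise for b, c, d. *)
have h7 := Z.square_nonneg (Z.add (Z.add a a) c).
have h8 := Z.square_nonneg (Z.add (Z.add c c) a).
have h9 := Z.square_nonneg (Z.add (Z.add b b) d).
have h10 := Z.square_nonneg (Z.add (Z.add d d) b).
apply/allpairsP; exists ((a, b, c), d); split=> //; last by apply: sq1 => /=; lia.
apply/allpairsP; exists ((a, b), c); split=> //; last by apply: sq1 => /=; lia.
by apply/allpairsP; exists (a, b); split=> //; apply: sq1 => /=; lia.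
Qed.

Lemma root12 x : qnorm x = (1, 0)%ZZ -> exists2 n, (n < 12)%N & x = qzX n.
Proof.
move=> nx; have xs : x \in smallq by apply: smallqP; rewrite nx.
have := root_check; rewrite allbE => /allP/(_ _ xs); rewrite nx eqxx hasbE.
by case/hasP => n; rewrite mem_iota => /andP[_ n12] /eqP ->; exists n.
Qed.

Lemma qhalfP x y : evq y = 2 * evq x -> qhalf y = Some x.
Proof.
rewrite mulr_natl mulr2n -evqD => /evq_inj ->.
have d2 a : Z.div2 (Z.add a a) = a by rewrite Z.add_diag; case: a.
have ev a : Z.even (Z.add a a) by rewrite Z.add_diag; case: a.
by case: x => [[[a b] c] d]; rewrite /qadd /qhalf !ev /= !d2.
Qed.

Lemma rho_conj : rho^* = rho :> C.
Proof. by rewrite rhoE; exact: conjc_real. Qed.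

Lemma qnorm_ge0 x : Z.le 0 (qnorm x).1.
Proof.
case: x => [[[a b] c] d] /=.
have := Z.square_nonneg (Z.add a c); have := Z.square_nonneg (Z.add b d).
have := Z.square_nonneg a; have := Z.square_nonneg b.
have := Z.square_nonneg c; have := Z.square_nonneg d; lia.
Qed.

(** With |A33| = 1 the norms of [Y1 A] and [Y2 A] add up to 0. *)
Lemma col3_zero A : uq A -> qnorm (e33 A) = (1, 0)%ZZ -> e13 A = q0 /\ e23 A = q0.
Proof.
move=> /col3_qnorm + c1; rewrite c1 => -[_ _]; rewrite /addp => -[/= e _].
have h1 := @qnorm_ge0 (Y1 A); have h2 := @qnorm_ge0 (Y2 A).
have y1 : Y1 A = q0 by apply: qnorm_eq0; lia.
have : Y2 A = q0 by apply: qnorm_eq0; lia.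
have {}y1 : e13 A = q0 by [].
rewrite /Y2 y1 => /(congr1 evq); rewrite evqD evqM evqB evq0 evq1 evqr add0r => /eqP.
rewrite mulf_eq0 (negPf (rho_neq1 R)) /= => /eqP.
by rewrite -evq0 => /evq_inj.
Qed.

Lemma nsq_zeta n : nsq (zeta ^+ n) = 1.
Proof.
elim: n => [|n IH]; first by rewrite /nsq /=; ring.
rewrite exprS nsqM IH mulr1 zetaE /nsq /=.
by have := s3_sqr; set s := s3 => e; field: e.
Qed.

Lemma conjtr_scale (c : C) (M : 'M[C]_3) : (c *: M)^t* = c^* *: M^t*.
Proof. by apply/matrixP => i k; rewrite !mxE rmorphM. Qed.

Lemma uq_sc n A : uq (scq (qzX n) A) = uq A.
Proof.
rewrite !uqP /unitaryF !evm_over /= evm_sc conjtr_scale.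
rewrite -!scalemxAl -scalemxAr scalerA -nsqC evqzX nsq_zeta.
by rewrite scale1r.
Qed.

Lemma uq_eqs a11 a12 a21 a22 a31 a32 :
  uq ((a11, a12, q0), (a21, a22, q0), (a31, a32, q1)) ->
  let x := evq a11 in let y := evq a21 in let p := evq a12 in let s := evq a22 in
  [/\ a31 = q0 /\ a32 = q0,
      x^* * (- (rho + 1) * x + y) + y^* * (x + (1 - rho) * y) = - (rho + 1),
      x^* * (- (rho + 1) * p + s) + y^* * (p + (1 - rho) * s) = 1,
      p^* * (- (rho + 1) * x + y) + s^* * (x + (1 - rho) * y) = 1 &
      p^* * (- (rho + 1) * p + s) + s^* * (p + (1 - rho) * s) = 1 - rho].
Proof.
rewrite uqP => /andP[_ /eqP].
rewrite /Fmx /evm /map3 /mxr3 conj_mx3 !mul_mx3 !evq0 !evq1 => /mx3_inj.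
rewrite !(rmorph0, rmorph1) !(mul0r, mulr0, addr0, add0r, mulr1) => -[].
move=> e11 e12 e13 e21 e22 e23 _ _.
have z31 : a31 = q0.
  by apply: evq_eq0; apply/eqP; rewrite -conjC_eq0 e13.
have z32 : a32 = q0.
  by apply: evq_eq0; apply/eqP; rewrite -conjC_eq0 e23.
move: e11 e12 e21 e22; rewrite z31 z32 evq0 rmorph0 !(mul0r, addr0).
move=> e11 e12 e21 e22; split=> //.
- by apply: etrans (etrans _ e11) _; ring.
- by apply: etrans (etrans _ e12) _; ring.
- by apply: etrans (etrans _ e21) _; ring.
- by apply: etrans (etrans _ e22) _; ring.
Qed.

(** The upper left block preserves the corresponding block of F, which has determinant 1. So its
    determinant d is a power of zeta, and the first column together with d gives the second column
    linearly. *)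
Lemma stab_block a11 a12 a21 a22 a31 a32 :
  let A := ((a11, a12, q0), (a21, a22, q0), (a31, a32, q1)) in
  uq A -> A \in Klist.
Proof.
move=> A /uq_eqs /=; set x := evq a11; set y := evq a21; set p := evq a12; set s := evq a22.
rewrite /A; case=> -[-> ->] e11 e12 e21 e22.
set y2 := qadd a11 (qmul (qsub q1 qr) a21).
have rs := rho_sqr R.
have n2E : nsq (evq a11) + nsq (evq y2) = 2.
  apply: complexI; rewrite rmorphD /= !nsqC evqD evqM evqB evq1 evqr -/x -/y.
  rewrite rmorphD /= rmorphM /= rmorphB /= rmorph1 rho_conj.
  transitivity ((1 - rho) * - (rho + 1) : C); last by rewrite rmorph_nat; ring: rs.
  by rewrite -e11; ring: rs.
have n2q : addp (qnorm a11) (qnorm y2) = (2, 0)%ZZ.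
  move: n2E; rewrite !nsq_evq /addp => e; have [] : Z.add (qnorm a11).1 (qnorm y2).1 = 2%ZZ /\
    Z.add (qnorm a11).2 (qnorm y2).2 = 0%ZZ.
    apply: zr_s3_inj; rewrite !zrD zr0 mul0r addr0 -[zr 2]/(2%:R) -e; ring.
  by move=> -> ->.
have nn1 := @qnorm_ge0 a11; have nn2 := @qnorm_ge0 y2.
have sm1 : a11 \in smallq by apply: smallqP; case: n2q; lia.
have sm2 : y2 \in smallq by apply: smallqP; case: n2q; lia.
(* Solves y2 = a11 + (1 - r) a21 by means of (1 - r)(1 + r) = -2. *)
have h2 : qhalf (qmul (qopp (qadd q1 qr)) (qsub y2 a11)) = Some a21.
  apply: qhalfP; rewrite evqM evqN evqB !evqD evqM evqB evq1 evqr -/x -/y.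
  by ring: rs.
have colsP : (a11, a21) \in kcols.
  rewrite /kcols mem_pmap; apply/mapP; exists (a11, y2); first exact: allpairs_f.
  by rewrite /= n2q eqxx h2.
set d := qsub (qmul a11 a22) (qmul a12 a21).
have dE : evq d = x * s - p * y by rewrite evqB !evqM.
(* Determinants on both sides of the block equation. *)
have : nsq (evq d) = 1.
  apply: complexI; rewrite nsqC dE rmorphB /= !rmorphM /=.
  set D := (X in X = _).
  have : (- (rho + 1)) * (1 - rho) - 1 * 1 = D * ((- (rho + 1)) * (1 - rho) - 1).
    rewrite -{1}e11 -{2}e22 -[X in _ - X * _]e12.
    by rewrite -[X in _ - _ * X]e21 /D; ring.
  have -> : - (rho + 1) * (1 - rho) - 1 = 1 :> C by ring: rs.
  by rewrite !mulr1 => <-; ring: rs.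
rewrite nsq_evq => nd; have {nd} [d1 d2] : (qnorm d).1 = 1%ZZ /\ (qnorm d).2 = 0%ZZ.
  by apply: zr_s3_inj; rewrite nd zr0 mul0r addr0.
have /root12[n n12 dn] : qnorm d = (1, 0)%ZZ.
  by move: d1 d2; case: (qnorm d) => ? ? /= -> ->.
set al := qadd (qmul (qopp (qadd qr q1)) (qconj a11)) (qconj a21).
set be := qadd (qconj a11) (qmul (qsub q1 qr) (qconj a21)).
have alE : evq al = - (rho + 1) * x^* + y^* by rewrite evqD evqM evqN evqD evq1 evqr !evq_conj.
have beE : evq be = x^* + (1 - rho) * y^* by rewrite evqD evqM evqB evq1 evqr !evq_conj.
(* Eliminating s between [e12] and d = x s - p y leaves (r + 1) p, and (r - 1)(r + 1) = 2. *)
have hp : qhalf (qmul (qsub qr q1) (qsub (qmul d be) a11)) = Some a12.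
  apply: qhalfP; rewrite evqM !evqB evqM evqr evq1 dE beE -/x -/p.
  transitivity ((rho - 1) * (x * (x^* * (- (rho + 1) * p + s) + y^* * (p + (1 - rho) * s) - 1)
     - p * (x^* * (- (rho + 1) * x + y) + y^* * (x + (1 - rho) * y)))); first by ring.
  by rewrite e11 e12; ring: rs.
have hs : qhalf (qmul (qsub q1 qr) (qadd (qmul al d) a21)) = Some a22.
  apply: qhalfP; rewrite evqM evqB evqD evqM evqr evq1 dE alE -/y -/s.
  transitivity ((1 - rho) * (s * (x^* * (- (rho + 1) * x + y) + y^* * (x + (1 - rho) * y))
     - y * (x^* * (- (rho + 1) * p + s) + y^* * (p + (1 - rho) * s) - 1))); first by ring.
  by rewrite e11 e12; ring: rs.
have -> : Klist = Kdef by rewrite /Klist; vm_compute.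
apply/flatten_mapP; exists (a11, a21) => //.
rewrite mem_pmap; apply/mapP; exists n; first by rewrite mem_iota.
by rewrite -dn /kmat -/al -/be hp hs.
Qed.

End Stabilizer.

(** * Moving points towards the origin *)

Section Covering.
Local Open Scope ring_scope.
Local Open Scope sesquilinear_scope.

Lemma nsq_conj_mul (x y : C) :
  nsq (x^* * y) = nsq x * nsq y.
Proof. by rewrite nsqM nsq_conj. Qed.

(* (X, Y, A - B) lies on the sphere of radius A + B, and one of its coordinates has
   absolute value at least (A + B) / sqrt 3. *)
Lemma octahedron_bound (a a' b b' e : R) :
  a ^+ 2 + a' ^+ 2 + b ^+ 2 + b' ^+ 2 > 1 / 2 -> e <= 785 / 1000 ->
  2 * (a ^+ 2 + a' ^+ 2) <= e -> 2 * (b ^+ 2 + b' ^+ 2) <= e ->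
  (a + b) ^+ 2 + (a' + b') ^+ 2 <= e -> (a - b) ^+ 2 + (a' - b') ^+ 2 <= e ->
  (a + b') ^+ 2 + (a' - b) ^+ 2 <= e -> (a - b') ^+ 2 + (a' + b) ^+ 2 <= e -> False.
Proof.
move=> t_big e_small hA hB hX hX' hY hY'.
pose A := a ^+ 2 + a' ^+ 2; pose B := b ^+ 2 + b' ^+ 2.
pose X := 2 * (a * b + a' * b'); pose Y := 2 * (a * b' - a' * b).
pose u := 785 / 1000 - (A + B).
have XY : (A - B) ^+ 2 + X ^+ 2 + Y ^+ 2 = (A + B) ^+ 2 by rewrite /A /B /X /Y; ring.
have [x1 x2] : - u <= X /\ X <= u.
  by move: e_small hX hX'; rewrite /u /A /B /X; clear; split; lra.
have [y1 y2] : - u <= Y /\ Y <= u.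
  by move: e_small hY hY'; rewrite /u /A /B /Y; clear; split; lra.
have [d1 d2] : - u <= A - B /\ A - B <= u.
  by move: e_small hA hB; rewrite /u /A /B; clear; split; lra.
have {}t_big : 1 / 2 < A + B by move: t_big; rewrite /A /B; clear; lra.
have u_small : u <= 285 / 1000 by move: t_big; rewrite /u; clear; lra.
move: XY x1 x2 y1 y2 d1 d2 t_big u_small.
move: u X Y (A - B) (A + B) => {hA hB hX hX' hY hY' e_small A B} u X Y D S.
move=> XY x1 x2 y1 y2 d1 d2 t_big u_small.
have sq x : - u <= x -> x <= u -> x ^+ 2 <= u ^+ 2 by clear; nra.
have := sq _ x1 x2; have := sq _ y1 y2; have := sq _ d1 d2.
have u0 : 0 <= u by move: x1 x2; clear; lra.
by move: XY u0 u_small t_big; clear; nra.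
Qed.

(** With e = (107/100)(sqrt 3 - 1) the octahedron argument needs 3 (e - 1/2)^2 < 1/4, for which
    785/1000 is a convenient upper bound of e. *)
Lemma axes_cover (z1 z2 : C) : 1 / 2 < nsq z1 + nsq z2 ->
  exists2 a, a \in axes &
    107 / 100 * (s3 - 1) < nsq ((evq a.1)^* * z1 + (evq a.2)^* * z2).
Proof.
move=> z_big; apply: contrapT => H0.
have H a : a \in axes ->
    nsq ((evq a.1)^* * z1 + (evq a.2)^* * z2) <= 107 / 100 * (s3 - 1).
  by move=> ha; rewrite leNgt; apply/negP => h; apply: H0; exists a.
have zN1 : zr (-1)%ZZ = -1 by [].
have z1' : zr 1%ZZ = 1 by [].
have n1 : nsq (evq ((-1)%ZZ, (-1)%ZZ, 1%ZZ, 0%ZZ)) = 2.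
  by rewrite nsq_evq /= zr0 mul0r addr0; rewrite -[zr _]/(2%:R).
have i1 : evq q1 = (1 +i* 0)%C by rewrite evq1.
have i0 : evq q0 = (0 +i* 0)%C by rewrite evq0.
have i3 : evq (0%ZZ, 0%ZZ, 0%ZZ, 1%ZZ) = (0 +i* 1)%C.
  by rewrite (evq_re_im (0%ZZ, 0%ZZ, 0%ZZ, 1%ZZ)) !zr0 z1'; congr (_ +i* _)%C; ring.
have i6 : evq ((-1)%ZZ, 0%ZZ, 0%ZZ, 0%ZZ) = ((-1) +i* 0)%C.
  by rewrite (evq_re_im ((-1)%ZZ, 0%ZZ, 0%ZZ, 0%ZZ)) !zr0 zN1; congr (_ +i* _)%C; ring.
have i9 : evq (0%ZZ, 0%ZZ, 0%ZZ, (-1)%ZZ) = (0 +i* (-1))%C.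
  by rewrite (evq_re_im (0%ZZ, 0%ZZ, 0%ZZ, (-1)%ZZ)) !zr0 zN1; congr (_ +i* _)%C; ring.
have := H (nth (q0, q0) axes 0) isT; have := H (nth (q0, q0) axes 1) isT.
have := H (nth (q0, q0) axes 2) isT; have := H (nth (q0, q0) axes 3) isT.
have := H (nth (q0, q0) axes 4) isT; have := H (nth (q0, q0) axes 5) isT.
rewrite /axes /nth /fst /snd -/q0 -/q1 i3 i6 i9 i1 i0.
rewrite -[(0 +i* 0)%C]/(0 : C) rmorph0 !mul0r addr0 add0r !nsq_conj_mul n1.
case: z1 z2 z_big {H H0} => [a a'] [b b']; rewrite /nsq /=.
have /andP[sl su] := s3_bound; have s2 := s3_sqr.
move: sl su s2; set s := s3 => sl su s2 t_big h1 h2 h3 h4 h5 h6.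
apply: (@octahedron_bound a a' b b' (107 / 100 * (s - 1))) => //.
all: try (by move: su; clear; lra).
- by move: t_big; clear; lra.
- by apply: le_trans h4; rewrite le_eqVlt; apply/orP; left; apply/eqP; ring.
- by apply: le_trans h2; rewrite le_eqVlt; apply/orP; left; apply/eqP; ring.
- by apply: le_trans h3; rewrite le_eqVlt; apply/orP; left; apply/eqP; ring.
- by apply: le_trans h1; rewrite le_eqVlt; apply/orP; left; apply/eqP; ring.
Qed.

(* The maximum of Re (conj (zeta^n) t) over n is attained where the rotated t lies
   in the sector of half-angle pi/12 around the positive real axis. *)
Lemma rotate_sector (t : C) : exists2 n, (n < 12)%N &
  0 <= complex.Re ((zeta ^+ n)^* * t) /\
  nsq t <= (8 - 4 * s3) * complex.Re ((zeta ^+ n)^* * t) ^+ 2.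
Proof.
pose f (n : nat) := complex.Re ((zeta ^+ n)^* * t).
have fper n : f (n %% 12)%N = f n by rewrite /f expr_mod ?zeta12.
pose m := [arg max_(i > (ord0 : 'I_12)) f i]%O.
have fm n : f n <= f m.
  rewrite /m; case: Order.TotalTheory.arg_maxP => //= i _ fi.
  by have := fi (Ordinal (ltn_pmod n (isT : (0 < 12)%N))) isT; rewrite /= fper.
exists m => //; have := fm m.+1; have := fm (m + 11)%N.
have z11 : zeta ^+ 11 = zeta^* :> C.
  have z0 : zeta != 0 :> C.
    by apply: contra_eq_neq (zeta12 R) => ->; rewrite expr0n /= eq_sym oner_eq0.
  apply: (mulfI z0); rewrite -exprS zeta12 mulrC -nsqC -[X in nsq X]expr1 nsq_zeta.
  by rewrite rmorph1.
have -> : f (m + 11)%N = complex.Re (zeta * ((zeta ^+ m)^* * t)).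
  by rewrite /f exprD z11 rmorphM /= conjCK -mulrA mulrCA.
have -> : f m.+1 = complex.Re (zeta^* * ((zeta ^+ m)^* * t)).
  by rewrite /f exprS rmorphM /= -mulrA.
have <- : nsq ((zeta ^+ m)^* * t) = nsq t by rewrite nsq_conj_mul nsq_zeta mul1r.
rewrite /f zetaE; case: (_ * t) => X Y; rewrite /nsq /=.
have /andP[sl su] := s3_bound; have s2 := s3_sqr.
move: sl su s2; set s := s3 => sl su s2 h1 h2.
(* Comparison with the two neighbouring rotations; 2 - sqrt 3 is the tangent of pi/12. *)
have g1 : Y <= (2 - s) * X by nra.
have g2 : - ((2 - s) * X) <= Y by nra.
have X0 : 0 <= X by nra.
split=> //.
have : Y ^+ 2 <= ((2 - s) * X) ^+ 2 by nra.
suff -> : (8 - 4 * s) * X ^+ 2 = X ^+ 2 + ((2 - s) * X) ^+ 2 by lra.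
by ring: s2.
Qed.

(** Here N = |w|^2 and 2 + s = |1 + zeta|^2. As (2 + s)(8 - 4 s) = 4, one gets X >= (2 + s) a / 2
    with a = sqrt N. The resulting bound a^2 + (2 + s)(1 - a) is convex in a, so the ends of the
    range of a decide. *)
Lemma cap_bound (s N X : R) :
  1732 / 1000 < s < 1733 / 1000 -> s ^+ 2 = 3 -> 107 / 100 < N -> N < s + 1 ->
  0 <= X -> (2 + s) * N <= (8 - 4 * s) * X ^+ 2 ->
  N + (2 + s) - 2 * X <= 97 / 100.
Proof.
move=> /andP[sl su] s2 N1 N2 X0 XN.
have a0 := sqrtr_ge0 N; have a2 : Num.sqrt N ^+ 2 = N.
  by rewrite sqr_sqrtr //; move: N1; clear; lra.
move: a0 a2; set a := Num.sqrt N => a0 a2.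
have aX : ((2 + s) * a / 2) ^+ 2 <= X ^+ 2.
  have -> : ((2 + s) * a / 2) ^+ 2 = (2 + s) / 4 * ((2 + s) * N).
    by rewrite -a2; field.
  have : (2 + s) / 4 * ((2 + s) * N) <= (2 + s) / 4 * ((8 - 4 * s) * X ^+ 2).
    by rewrite ler_wpM2l //; move: sl; clear; lra.
  suff -> : (2 + s) / 4 * ((8 - 4 * s) * X ^+ 2) = X ^+ 2 by [].
  by field: s2.
have {aX XN} aX : (2 + s) * a / 2 <= X.
  by rewrite -(@ler_pXn2r _ 2) // ?nnegrE //; move: sl a0; clear; nra.
have a_lo : 1034 / 1000 < a by move: a0 a2 N1; clear; nra.
have a_hi : a < 1654 / 1000 by move: a0 a2 N2 su; clear; nra.
have : N + (2 + s) - 2 * X <= a ^+ 2 + (2 + s) - (2 + s) * a.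
  by rewrite a2; move: aX; clear; lra.
move/le_trans; apply; move: a_lo a_hi sl su; clear; nra.
Qed.

Lemma nsq_sub_conj (x c : C) :
  nsq (x - c^*) = nsq x + nsq c - 2 * complex.Re (x * c).
Proof. by case: x c => [a b] [c d]; rewrite /nsq /=; ring. Qed.

(** [hval g p] is conj (zeta^n) w - conj (1 + zeta), where w is the component of p along the axis.
    The axis makes |w| large, then the phase zeta^n turns w towards conj (1 + zeta). *)
Lemma covering p : 1 / 2 < n2 p -> exists2 k, k \in Klist &
  forall g : UF R, UFmx g = evm (mulq k bV) -> nsq (hval g p) <= 97 / 100.
Proof.
move=> p_big; have [a aP a_big] := axes_cover p_big.
set w := ((evq a.1)^* * (val p).1 + (evq a.2)^* * (val p).2) / dsqrt R.
have sb := s3_bound; have s2 := s3_sqr; have s0 := cos_num_gt0.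
have w_lo : 107 / 100 < nsq w by rewrite nsq_dsqrtV ltr_pdivlMr.
have a2 : nsq (evq a.1) + nsq (evq a.2) = 2.
  have : allb (fun a : quad * quad => addp (qnorm a.1) (qnorm a.2) == (2, 0)%ZZ) axes by [].
  rewrite allbE => /allP/(_ _ aP)/eqP[e1 e2]; rewrite !nsq_evq.
  transitivity (zr (Z.add (qnorm a.1).1 (qnorm a.2).1) +
                zr (Z.add (qnorm a.1).2 (qnorm a.2).2) * s3); first by rewrite !zrD; ring.
  by rewrite e1 e2 zr0 mul0r addr0.
(* Cauchy-Schwarz with |a|^2 = 2 and |z|^2 < 1, as 2 / (sqrt 3 - 1) = sqrt 3 + 1. *)
have w_hi : nsq w < s3 + 1.
  rewrite nsq_dsqrtV ltr_pdivrMr //; apply: le_lt_trans (nsq_CauchySchwarz _ _ _ _) _.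
  rewrite !nsq_conj a2 -/(n2 p); have := n2_lt1 p; move: s2 sb.
  by move: (n2 p) (s3); clear => n s s2 sb n1; nra.
have [n n12 [X0 Xn]] := rotate_sector (w * (1 + zeta)).
have [k kP kcol] : exists2 k, k \in Klist & lcol (mulq k bV) =
    (qmul (qzX n) a.1, e23 (mulq k bV), qadd q1 qz) /\
    Y2 (mulq k bV) = qmul (qzX n) a.2.
  have := axis_checkP; rewrite /axis_check allbE => /allP/(_ _ aP).
  rewrite allbE => /allP/(_ n); rewrite mem_iota => /(_ n12).
  rewrite hasbE => /hasP[x /mapP[k kP ->]].
  case e: (mulq k bV) => [[[[a11 a12] a13] [[a21 a22] a23]] [[a31 a32] a33]] /=.
  case: eqP => // <-; case: eqP => // <- /eqP e3.
  by exists k; rewrite // /Y2 /lcol e /= e3.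
exists k => // g gk; rewrite hvalE gk evm02 evm12 evm22.
case: kcol; rewrite lcolE => -[k1 k3] Y2E.
have -> : evq (e13 (mulq k bV)) + (1 - rho) * evq (e23 (mulq k bV)) = evq (qmul (qzX n) a.2).
  by rewrite -Y2E /Y2 evqD !evqM evqB evq1 evqr.
have cE : evq (e33 (mulq k bV)) = 1 + zeta by rewrite k3 -[X in evq X]/(qadd q1 qz) evqD evq1 evqz.
rewrite cE k1 !evqM evqzX.
have -> : (zeta ^+ n * evq a.1 / dsqrt R)^* * (val p).1 +
    (zeta ^+ n * evq a.2 / dsqrt R)^* * (val p).2 = (zeta ^+ n)^* * w.
  have dc : ((dsqrt R)^-1)^* = (dsqrt R)^-1 by rewrite fmorphV /=; congr (_^-1); exact: conjc_real.
  rewrite /w !rmorphM /= dc.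
  move: (evq a.1)^* (evq a.2)^* (val p).1 (val p).2 (dsqrt R)^-1 ((zeta ^+ n)^* : C).
  by clear => x y z t d u; ring.
rewrite nsq_sub_conj nsq_conj_mul nsq_zeta mul1r -mulrA.
have nc : nsq (1 + zeta) = 2 + s3.
  have := nsq_evq (1, 1, 0, 0)%ZZ; rewrite -[(1, 1, 0, 0)%ZZ]/(qadd q1 qz) evqD evq1 evqz => ->.
  by rewrite /= -[zr 2]/(2%:R) -[zr 1]/(1%:R) mul1r.
rewrite nc; apply: cap_bound => //.
by move: Xn; rewrite nsqM nc [nsq w * _]mulrC.
Qed.

End Covering.

(** * Classes of integral matrices *)

Section Classes.
Local Open Scope ring_scope.
Local Open Scope sesquilinear_scope.
Local Open Scope group_scope.

Definition cl (A : qm3) : Gamma R := if insub (evm A) is Some g then coset g else 1.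

Lemma clE A (g : UF R) : UFmx g = evm A -> cl A = coset g.
Proof. by rewrite /cl => <-; rewrite (valK g : insub (UFmx g) = Some g). Qed.

Lemma cl_surj (x : Gamma R) : exists2 A, uq A & x = cl A.
Proof.
elim/coset_ind: x => g; have /andP[/evm_surj[A gA] _] := UFmxP g.
exists A; first by rewrite uqP -gA UFmxP.
by rewrite (clE gA).
Qed.

Lemma uqM A B : uq A -> uq B -> uq (mulq A B).
Proof.
move=> /uq_UF[g gA] /(uq_UF)[h hB]; rewrite uqP evmM -gA -hB.
exact: UF_mulP.
Qed.

Lemma clM A B : uq A -> uq B -> cl (mulq A B) = cl A * cl B.
Proof.
move=> /uq_UF[g gA] /(uq_UF)[h hB]; rewrite (clE gA) (clE hB) -cosetM.
by apply: clE; rewrite evmM -gA -hB.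
Qed.

Lemma cl1 : cl Iq = 1.
Proof. by apply: clE; rewrite evm1. Qed.

Lemma Finv_mul : mulq Finvq Fq = Iq. Proof. by []. Qed.

Lemma evm_inv A : uq A -> evm (invq A) = invmx (evm A).
Proof.
move=> uA; have [g gA] := uq_UF uA; have Au : evm A \in unitmx by rewrite -gA UF_unit.
rewrite -[LHS](mulmxK Au) -evmM /invq.
suff -> : mulq (mulq (mulq Finvq (ctq A)) Fq) A = Iq by rewrite evm1 mul1mx.
have e : evm (ctq A) *m evm Fq *m evm A = evm Fq by rewrite -!evmM (eqP uA).
apply: evm_inj; rewrite !evmM -!mulmxA (mulmxA (evm (ctq A))) e.
by rewrite -evmM Finv_mul.
Qed.

Lemma uqV A : uq A -> uq (invq A).
Proof.
by move=> uA; rewrite uqP evm_inv //; have [g <-] := uq_UF uA; exact: UF_invP.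
Qed.

Lemma clV A : uq A -> cl (invq A) = (cl A)^-1.
Proof.
move=> uA; have [g gA] := uq_UF uA; rewrite (clE gA).
have -> : (coset g)^-1 = coset g^-1 by exact: Gamma_invE.
by apply: clE; rewrite evm_inv // -gA.
Qed.

Lemma cl_sc n A : uq A -> cl (scq (qzX n) A) = cl A.
Proof.
move=> uA; have [g gA] := uq_UF uA.
have [h hA] : {h : UF R | UFmx h = evm (scq (qzX n) A)} by apply: uq_UF; rewrite uq_sc.
rewrite (clE gA) (clE hA); apply/esym/cosetP/ZcenterP; exists n.
rewrite /= hA evm_sc -gA -scalemxAr mulVmx ?UF_unit // evqzX.
by rewrite scalemx1.
Qed.

Lemma cl_inj A B : uq A -> uq B -> cl A = cl B -> exists n, A = scq (qzX n) B.
Proof.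
move=> /uq_UF[g gA] /(uq_UF)[h hB]; rewrite (clE gA) (clE hB) => /esym/cosetP/ZcenterP[n e].
exists n; apply: evm_inj; rewrite evm_sc -gA -hB evqzX -mul_mx_scalar -e.
by rewrite /= mulKVmx // UF_unit.
Qed.

Lemma eqscq_cl A B : uq B -> eqscq A B -> cl A = cl B.
Proof. by rewrite /eqscq hasbE => uB /hasP[n _ /eqP ->]; rewrite cl_sc. Qed.

Lemma uqX A n : uq A -> uq (powq A n).
Proof. by move=> uA; elim: n => //= n IH; apply: uqM. Qed.

Lemma clX A n : uq A -> cl (powq A n) = cl A ^+ n.
Proof.
move=> uA; elim: n => [|n IH]; first by rewrite cl1 expg0.
by rewrite -[powq A n.+1]/(mulq A (powq A n)) clM ?uqX // IH expgS.
Qed.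

Lemma uq_prod s : all uq s -> uq (prodq s).
Proof. by elim: s => [|A s IH /andP[uA us]]; [|exact: uqM uA (IH us)]. Qed.

Lemma cl_prod s : all uq s -> cl (prodq s) = foldr (fun A x => cl A * x) 1 s.
Proof.
elim: s => [_|A s IH /andP[uA us]]; first exact: cl1.
by rewrite -[LHS]/(cl (mulq A (prodq s))) (clM uA (uq_prod us)) (IH us).
Qed.

Ltac cl_generator := apply: clE; rewrite /u_mx /v_mx /b_mx /evm /map3 /mxr3 /evq /= /zc;
  by do ![congr (_ :: _) | congr mx3]; rewrite -?[int_of_Z _]/(_ : int); ring.

Lemma cl_u : cl uM = u. Proof. cl_generator. Qed.

Lemma cl_v : cl vM = v. Proof. cl_generator. Qed.

Lemma cl_b : cl bM = b. Proof. cl_generator. Qed.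

Lemma uq_u : uq uM. Proof. by []. Qed.

Lemma uq_v : uq vM. Proof. by []. Qed.

Lemma uq_b : uq bM. Proof. by []. Qed.

Lemma cl_j : cl jM = j.
Proof. by rewrite (clX _ (uqM uq_u uq_v)) (clM uq_u uq_v) cl_u cl_v. Qed.

Lemma uq_j : uq jM. Proof. by vm_compute. Qed.

Lemma cl_j4 : cl j4M = j ^+ 4.
Proof. by rewrite (clX _ uq_j) cl_j. Qed.

Let ua1 : all uq [:: vM; uM; vV; powq jM 4; bM; uM; vM; powq jM 2].
Proof. by vm_compute. Qed.

Let ua2 : all uq [:: powq vM 2; uM; bM; uM; vV; uM; powq vM 2; jM].
Proof. by vm_compute. Qed.

Let ua3 : all uq [:: uV; powq vM 2; uM; powq jM 9; bM; vV; uM; vV; powq jM 8].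
Proof. by vm_compute. Qed.

Let ug : all uq [:: bM; uM; vM]. Proof. by vm_compute. Qed.

Lemma cl_uV : cl uV = u^-1. Proof. by rewrite (clV uq_u) cl_u. Qed.

Lemma cl_vV : cl vV = v^-1. Proof. by rewrite (clV uq_v) cl_v. Qed.

Lemma cl_bV : cl bV = b^-1. Proof. by rewrite (clV uq_b) cl_b. Qed.

Lemma cl_jX n : cl (powq jM n) = j ^+ n. Proof. by rewrite (clX _ uq_j) cl_j. Qed.

Lemma cl_v2 : cl (powq vM 2) = v ^+ 2. Proof. by rewrite (clX _ uq_v) cl_v. Qed.

Lemma cl_prodE s t : all uq s -> [seq cl A | A <- s] = t ->
  cl (prodq s) = foldr (fun x y => x * y) 1 t.
Proof. by move=> us <-; rewrite (cl_prod us) foldr_map. Qed.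

Lemma cl_a1 : cl a1M = a1 R.
Proof.
rewrite (cl_prodE ua1 (t := [:: v; u; v^-1; j ^+ 4; b; u; v; j ^+ 2])).
  by rewrite /foldr mulg1 /a1 !mulgA.
by rewrite /map; congr [:: _; _; _; _; _; _; _; _];
  [exact: cl_v | exact: cl_u | exact: cl_vV | exact: cl_jX | exact: cl_b
  | exact: cl_u | exact: cl_v | exact: cl_jX].
Qed.

Lemma cl_a2 : cl a2M = a2 R.
Proof.
rewrite (cl_prodE ua2 (t := [:: v ^+ 2; u; b; u; v^-1; u; v ^+ 2; j])).
  by rewrite /foldr mulg1 /a2 !mulgA.
by rewrite /map; congr [:: _; _; _; _; _; _; _; _];
  [exact: cl_v2 | exact: cl_u | exact: cl_b | exact: cl_u | exact: cl_vV
  | exact: cl_u | exact: cl_v2 | exact: cl_j].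
Qed.

Lemma cl_a3 : cl a3M = a3 R.
Proof.
rewrite (cl_prodE ua3 (t := [:: u^-1; v ^+ 2; u; j ^+ 9; b; v^-1; u; v^-1; j ^+ 8])).
  by rewrite /foldr mulg1 /a3 !mulgA.
by rewrite /map; congr [:: _; _; _; _; _; _; _; _; _];
  [exact: cl_uV | exact: cl_v2 | exact: cl_u | exact: cl_jX | exact: cl_b
  | exact: cl_vV | exact: cl_u | exact: cl_vV | exact: cl_jX].
Qed.

Lemma cl_g : cl gM = b * u * v.
Proof. rewrite (cl_prodE ug (t := [:: b; u; v])); first by rewrite /= mulg1 mulgA.
by rewrite /map; congr [:: _; _; _]; [exact: cl_b | exact: cl_u | exact: cl_v]. Qed.
End Classes.

(** * Translates of the origin and the approach to it *)

Section Action.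
Local Open Scope ring_scope.
Local Open Scope sesquilinear_scope.
Local Open Scope group_scope.

Lemma act_cl A (g : UF R) p : UFmx g = evm A -> act (cl A) p = actUF g p.
Proof. by move=> /clE ->; rewrite act_coset. Qed.

Lemma n2_0 : n2 origin = 0%R.
Proof. by rewrite /n2 /nsq /=; ring. Qed.

Lemma n2_origin (g : UF R) : (nsq (UFmx g 2 2) * (1 - n2 (actUF g origin)) = 1)%R.
Proof.
have [l _ e] := hz_actUF g origin.
have lE : UFmx g 2 2 = l.
  by have := congr1 (fun M : 'cV[C]_3 => M 2%R 0%R) e; rewrite tilde_hz0 !mxE /= mulr1.
have := jf_tilde g (hz origin) (hz origin).
rewrite e jfZr jfZl mulrA (mulrC l) -nsqC !jf_hz -rmorphM n2_0 => /(congr1 (@complex.Re R)) /=.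
by rewrite lE; move: (nsq l) (n2 _); clear => a c; lra.
Qed.

Lemma n2_eq0 p : n2 p = 0%R -> p = origin.
Proof.
rewrite /n2; have := nsq_ge0 (val p).1; have := nsq_ge0 (val p).2 => e2 e1 p0.
have z (x y : R) : (0 <= x -> 0 <= y -> x + y = 0 -> x = 0 /\ y = 0)%R.
  by clear=> *; split; lra.
have [z1 z2] := z _ _ e1 e2 p0.
apply: val_inj; rewrite [LHS]surjective_pairing (nsq_eq0 z1) (nsq_eq0 z2).
by [].
Qed.

(** The gap above 1 means that A.0 is either the origin or at |z|^2 > 1/2, where [approach]
    applies. *)
Lemma shells_nsq q : shells q ->
  (nsq (evq q) <= 9)%R /\ (shell1 q \/ (2 < nsq (evq q))%R).
Proof.
have /andP[sl su] := s3_bound; rewrite nsq_evq /shell1.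
case/or3P => /eqP -> /=; rewrite -?[zr 1]/(1%:R)%R ?zr0 -?[zr 2]/(2%:R)%R
  -?[zr 4]/(4%:R)%R.
- by split; [clear; lra | left].
- by split; [|right]; move: sl su; clear; lra.
- by split; [|right]; move: sl su; clear; lra.
Qed.

Lemma nsq_shell1 A : nsq (evq (e33 A)) = 1%R -> shell1 (e33 A).
Proof.
rewrite nsq_evq /shell1 => e.
have [] : (qnorm (e33 A)).1 = 1%ZZ /\ (qnorm (e33 A)).2 = 0%ZZ.
  by apply: zr_s3_inj; rewrite e zr0 mul0r addr0.
by case: (qnorm _) => ? ? /= -> ->.
Qed.

Lemma shell1_nsq A : shell1 (e33 A) -> nsq (evq (e33 A)) = 1%R.
Proof. by move=> /eqP e; rewrite nsq_evq e /= zr0 mul0r addr0. Qed.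

Lemma stab_shell A : uq A -> (act (cl A) origin = origin <-> shell1 (e33 A)).
Proof.
move=> /uq_UF[g gA]; rewrite (act_cl _ gA).
have := n2_origin g; rewrite gA evm22 => e; split=> [g0|/shell1_nsq c1].
  by apply: nsq_shell1; move: e; rewrite g0 n2_0 subr0 mulr1.
by apply: n2_eq0; move: e; rewrite c1; set x := n2 _; clear; lra.
Qed.

Lemma shell1_Klist A : uq A -> shell1 (e33 A) -> exists2 k, k \in Klist & cl A = cl k.
Proof.
move=> uA /eqP s1; have [n n12 cn] := root12 s1.
have [e13A e23A] := col3_zero uA s1.
(* Makes the (3,3) entry equal to 1 without changing the class. *)
set B := scq (qzX (12 - n)) A; have uB : uq B by rewrite uq_sc.
have one : qmul (qzX (12 - n)) (qzX n) = q1.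
  apply: evq_inj; rewrite evqM !evqzX -exprD subnK ?evq1 ?zeta12 //.
  exact: ltnW.
exists B; last by rewrite cl_sc.
move: uB; rewrite /B => {B}.
case: A uA s1 e13A e23A cn => [[[[a11 a12] a13] [[a21 a22] a23]] [[a31 a32] a33]] _ _.
rewrite /e13 /e23 /e33 => -> -> ->; rewrite /scq /map3.
have -> : qmul (qzX (12 - n)) q0 = q0.
  by apply: evq_inj; rewrite evqM evq0 mulr0.
by rewrite one; apply: stab_block.
Qed.

Lemma stabP x : act x origin = origin -> exists2 k, k \in Klist & x = cl k.
Proof.
have [A uA ->] := cl_surj x => /(stab_shell uA) s1.
exact: shell1_Klist.
Qed.

Lemma Klist_uq k : k \in Klist -> uq k.
Proof.
move=> kK; have := Klist_ok; rewrite allbE => /allP/(_ _ kK).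
by case: (uq k).
Qed.

Lemma Klist_e33 k : k \in Klist -> e33 k = q1.
Proof.
move=> kK; have := Klist_ok; rewrite allbE => /allP/(_ _ kK).
by case: (uq k) => // /eqP.
Qed.

Lemma Klist_stab k : k \in Klist -> act (cl k) origin = origin.
Proof. by move=> kK; apply/stab_shell; rewrite ?Klist_uq // Klist_e33. Qed.

Lemma stabM x y : act x origin = origin -> act y origin = origin ->
  act (x * y) origin = origin.
Proof. by move=> hx hy; rewrite actM hy. Qed.

Lemma stabV x : act x origin = origin -> act x^-1 origin = origin.
Proof. by move=> hx; rewrite -{1}hx -actM mulVg act1. Qed.

Lemma bernoulli (e : R) n : (0 <= e -> 1 + e *+ n <= (1 + e) ^+ n)%R.
Proof.
move=> e0; elim: n => [|n IH]; first by rewrite mulr0n addr0 expr0.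
rewrite exprS mulrS; apply: le_trans (_ : ((1 + e) * (1 + e *+ n) <= _)%R); last first.
  by rewrite ler_wpM2l // addr_ge0.
have : (0 <= e * (e *+ n))%R by rewrite mulr_ge0 // mulrn_wge0.
by set t := (e *+ n)%R; lra.
Qed.

Lemma approach p : (1 / 2 < n2 p)%R -> exists2 A, A \in Klist &
  (1 - n2 p <= 97 / 100 * (1 - n2 (act (cl (invq (mulq A bV))) p)))%R.
Proof.
move=> /covering[k kK cov]; exists k => //.
have ukb : uq (mulq k bV) by apply: (uqM (Klist_uq kK)); exact: (uqV uq_b).
have [g gk] := uq_UF ukb; have := cov _ gk.
rewrite (clV ukb) (clE gk) -[(coset g)^-1]/(Gamma_inv _) Gamma_invE act_coset.
have := n2_act g^-1 p; rewrite invgK; have := n2_lt1 (actUF g^-1 p).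
by set x := nsq _; set y := n2 _; set z := n2 _; clear; nra.
Qed.

(** Each approach multiplies 1 - |z|^2 by at least 100/97 > 1 + 1/50, so by Bernoulli's inequality
    it exceeds 1/2 after finitely many steps. *)
Lemma exists_small p : exists x : Gamma R, (n2 (act x p) <= 1 / 2)%R.
Proof.
suff H N q : (1 / 2 <= (1 - n2 q) * (1 + 1 / 50) ^+ N ->
    exists x : Gamma R, n2 (act x q) <= 1 / 2)%R.
  pose y := (1 - n2 p)%R; have y0 : (0 < y)%R by rewrite subr_gt0 n2_lt1.
  pose N := Num.bound (50 / y)%R; apply: (H N).
  have yN : (50 / y < N%:R)%R by apply: archi_boundP; rewrite divr_ge0 // ltW.
  have bN := @bernoulli (1 / 50) N (ltac:(lra)).
  rewrite -/y; apply: le_trans (_ : (y * (1 + 1 / 50 *+ N) <= _)%R); last first.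
    by rewrite ler_wpM2l // ltW.
  move: yN; rewrite ltr_pdivrMr // -[(_ *+ N)%R]mulr_natr; set m := N%:R.
  by clear -y0; lra.
elim: N q => [|N IH] q.
  by rewrite expr0 mulr1 => h; exists 1; rewrite act1; lra.
have [q_small|q_big] := lerP (n2 q) (1 / 2) => h; first by exists 1; rewrite act1.
have [A _ hA] := approach q_big; set x := cl _ in hA.
have [|y hy] := IH (act x q); last by exists (y * x); rewrite actM.
apply: le_trans h _; rewrite exprS mulrA ler_wpM2r ?exprn_ge0 //; first by lra.
by move: hA; have := n2_lt1 (act x q); set s := n2 _; set t := n2 _; clear; lra.
Qed.

End Action.

Lemma det3_mul (K : comPzRingType) (a b c d e f g h i a' b' c' d' e' f' g' h' i' : K) :
  let det a b c d e f g h i :=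
    (a * (e * i - f * h) - b * (d * i - f * g) + c * (d * h - e * g))%R in
  (det (a * a' + b * d' + c * g') (a * b' + b * e' + c * h') (a * c' + b * f' + c * i')
      (d * a' + e * d' + f * g') (d * b' + e * e' + f * h') (d * c' + e * f' + f * i')
      (g * a' + h * d' + i * g') (g * b' + h * e' + i * h') (g * c' + h * f' + i * i')
  = det a b c d e f g h i * det a' b' c' d' e' f' g' h' i')%R.
Proof. by move=> det; rewrite /det; ring. Qed.

(** * The congruence test for Pi *)

Section Congruence.
Local Open Scope ring_scope.
Local Open Scope group_scope.

Lemma detqM A B : detq (mulq A B) = qmul (detq A) (detq B).
Proof.
case: A => [[[[a11 a12] a13] [[a21 a22] a23]] [[a31 a32] a33]].
case: B => [[[[b11 b12] b13] [[b21 b22] b23]] [[b31 b32] b33]].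
apply: evq_inj; rewrite /mulq /mul3 /tr3 /dot3 /detq.
by rewrite !(evqD, evqB, evqM); apply: det3_mul.
Qed.

End Congruence.

Lemma red3_mod a b k : a = Z.add b (Z.mul k 3) -> red3 a = red3 b.
Proof. by move=> ->; rewrite /red3 Z.mod_add. Qed.

Lemma red3_cases a : exists k i, a = Z.add i (Z.mul k 3) /\
  (i = 0%ZZ \/ i = 1%ZZ \/ i = 2%ZZ).
Proof.
exists (Z.div a 3), (Z.modulo a 3); split; first by have := Z.div_mod a 3; lia.
by have := Z.mod_pos_bound a 3; lia.
Qed.

Lemma red3D a b : red3 (Z.add a b) = add3 (red3 a) (red3 b).
Proof.
have [k [i [-> hi]]] := red3_cases a; have [l [m [-> hm]]] := red3_cases b.
rewrite (@red3_mod _ (Z.add i m) (Z.add k l)); last by lia.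
rewrite (@red3_mod (Z.add i (Z.mul k 3)) i k) // (@red3_mod (Z.add m (Z.mul l 3)) m l) //.
by case: hi => [->|[->|->]]; case: hm => [->|[->|->]].
Qed.

Lemma red3M a b : red3 (Z.mul a b) = mult3 (red3 a) (red3 b).
Proof.
have [k [i [-> hi]]] := red3_cases a; have [l [m [-> hm]]] := red3_cases b.
rewrite (@red3_mod _ (Z.mul i m)
  (Z.add (Z.add (Z.mul i l) (Z.mul k m)) (Z.mul (Z.mul k 3) l))); last by lia.
rewrite (@red3_mod (Z.add i (Z.mul k 3)) i k) // (@red3_mod (Z.add m (Z.mul l 3)) m l) //.
by case: hi => [->|[->|->]]; case: hm => [->|[->|->]].
Qed.

Lemma red3N a : red3 (Z.opp a) = opp3 (red3 a).
Proof.
have [k [i [-> hi]]] := red3_cases a.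
rewrite (@red3_mod _ (Z.opp i) (Z.opp k)); last by lia.
rewrite (@red3_mod (Z.add i (Z.mul k 3)) i k) //.
by case: hi => [->|[->|->]].
Qed.

Lemma red9D : {morph red9 : x y / qadd x y >-> add9 x y}.
Proof.
move=> [[[x0 x1] x2] x3] [[[y0 y1] y2] y3]; rewrite /red9 /qadd /add9 /=.
by rewrite -!red3D; congr (_, _); apply: (@red3_mod _ _ 0); lia.
Qed.

Lemma red9M : {morph red9 : x y / qmul x y >-> mul9 x y}.
Proof.
move=> [[[x0 x1] x2] x3] [[[y0 y1] y2] y3]; rewrite /red9 /qmul /mul9 /=.
rewrite -!red3M -red3N -!red3D; congr (_, _).
  apply: (@red3_mod _ _ (Z.opp (Z.add (Z.add (Z.mul x1 y3) (Z.mul x2 y2)) (Z.mul x3 y1)))).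
  by lia.
apply: (@red3_mod _ _ (Z.opp (Z.add (Z.mul x2 y3) (Z.mul x3 y2)))).
by lia.
Qed.

Lemma redmM A B : redm (mulq A B) = mulm9 (redm A) (redm B).
Proof. exact: (map3_mul red9D red9M). Qed.

Lemma eq3P x y : eq3 x y -> x = y.
Proof. by case: x y => [[]|] [[]|]. Qed.

Lemma eqr9P x y : eqr9 x y -> x = y.
Proof.
case: x y => [[[a b] [c d]] [e f]] [[[a' b'] [c' d']] [e' f']] /=.
by do 5![case: ifP => [/eq3P ->|//]]; move=> /eq3P ->.
Qed.

Lemma eqm9P x y : eqm9 x y -> x = y.
Proof.
case: x y => [[a b] c] [[a' b'] c']; rewrite /eqm9.
by do 2![case: ifP => [/eqr9P ->|//]]; move=> /eqr9P ->.
Qed.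

Lemma in9P x : in9 x -> x \in P9.
Proof. by rewrite /in9 hasbE => /hasP[y yP] /eqm9P ->. Qed.

Lemma cubes_mul : all (fun x => all (fun y => qmul x y \in cubes) cubes) cubes.
Proof. by vm_compute. Qed.

Definition pigens := [:: a1M; a2M; a3M; invq a1M; invq a2M; invq a3M; scq qz Iq].

Lemma gens_cubes : all (fun A => detq A \in cubes) pigens.
Proof. by vm_compute. Qed.

Section PiTest.
Local Open Scope group_scope.
Local Open Scope classical_set_scope.

Lemma testPi_gen g A :
  g \in pigens ->
  testPi A -> testPi (mulq g A).
Proof.
move=> gP; rewrite /testPi; case: ifP => // dA /in9P rA.
rewrite detqM redmM; have := cubes_mul; move/allP/(_ _ (allP gens_cubes _ gP)).
move/allP/(_ _ dA) => ->.
by have := P9_gen; move/allP/(_ _ gP)/allP/(_ _ rA).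
Qed.

Lemma testPi_sc n A : testPi A -> testPi (scq (qzX n) A).
Proof.
move=> tA; elim: n => [|n IH].
  suff -> : scq (qzX 0) A = A by [].
  by apply: evm_inj; rewrite evm_sc evqzX expr0 scale1r.
suff -> : scq (qzX n.+1) A = mulq (scq qz Iq) (scq (qzX n) A).
  exact: (testPi_gen (@mem_nth _ Iq pigens 6 isT)).
apply: evm_inj; rewrite evmM !evm_sc evm1 !evqzX evqz.
by rewrite -scalemxAl mul1mx scalerA exprS.
Qed.

(** The test on classes; by [testable_testPi] any representative may be used. *)
Definition testable (x : Gamma R) : Prop := exists A, [/\ uq A, testPi A & x = cl A].

Lemma testable_testPi A : uq A -> testable (cl A) -> testPi A.
Proof.
move=> uA [B [uB tB e]]; have [n ->] := cl_inj uA uB e.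
exact: testPi_sc.
Qed.

(** Minimality of Pi applies only to subgroups; asking for x and x^-1 together makes this set
    one. *)
Let H : set (Gamma R) := [set x | forall y, testable y -> testable (x * y) /\ testable (x^-1 * y)].

Let H_closed : group_closed [in H].
Proof.
split; first by rewrite inE => y yS; rewrite invg1 mul1g.
move=> x y; rewrite !inE => xH yH z zS; split.
  by rewrite -mulgA; apply: (xH _ (yH _ zS).2).1.
by rewrite invgM invgK -mulgA; apply: (yH _ (xH _ zS).2).1.
Qed.

Let H_gen A : [&& uq A, A \in pigens & invq A \in pigens] -> H (cl A).
Proof.
move=> /and3P[uA AP AVP] y [B [uB tB ->]].
rewrite -(clV uA) -(clM uA uB) -(clM (uqV uA) uB); split.
  by exists (mulq A B); split=> //; [exact: uqM|exact: testPi_gen].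
by exists (mulq (invq A) B); split=> //; [exact: (uqM (uqV uA))|exact: testPi_gen].
Qed.

Lemma Pi_testable x : PiGroup R x -> forall y, testable y -> testable (x * y).
Proof.
move=> /(_ H) xP y yS; suff xH : H x by exact: (xH y yS).1.
apply: xP; split; first exact: H_closed.
move=> z /= [[] ->|->].
- by rewrite -cl_a1; apply: H_gen; vm_compute.
- by rewrite -cl_a2; apply: H_gen; vm_compute.
- by rewrite -cl_a3; apply: H_gen; vm_compute.
Qed.

Lemma testable1 : testable 1. Proof. by exists Iq; split=> //; rewrite cl1. Qed.

Lemma PiGroup_test A : uq A -> PiGroup R (cl A) -> testPi A.
Proof.
move=> uA AP; apply: testable_testPi => //.
by have := Pi_testable AP testable1; rewrite mulg1.
Qed.

Lemma PiGroup1 : PiGroup R 1.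
Proof. by have [P1 _] := PiGroup_closed R; rewrite inE in P1. Qed.

Lemma PiGroupM x y : PiGroup R x -> PiGroup R y -> PiGroup R (x * y).
Proof.
move=> xP yP; have PM := group_closedM (PiGroup_closed R).
by have := PM _ _ (mem_set xP) (mem_set yP); rewrite inE.
Qed.

Lemma PiGroupV x : PiGroup R x -> PiGroup R x^-1.
Proof.
move=> xP; have PN := group_closedV (PiGroup_closed R).
by have := PN _ (mem_set xP); rewrite inE.
Qed.

Lemma PiGroup_a : [/\ PiGroup R (cl a1M), PiGroup R (cl a2M) & PiGroup R (cl a3M)].
Proof.
split; [rewrite cl_a1|rewrite cl_a2|rewrite cl_a3]; move=> K [_ KP]; apply: KP.
- by left; left.
- by left; right.
- by right.
Qed.

End PiTest.

(** * Covering Gamma by the sets Pi b^n K *)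

Section Cosets.
Local Open Scope ring_scope.
Local Open Scope group_scope.

Definition inPi (A : qm3) : Prop := uq A /\ PiGroup R (cl A).

Lemma inPi1 : inPi Iq.
Proof. by split; [|rewrite cl1; exact: PiGroup1]. Qed.

Lemma inPiM A B : inPi A -> inPi B -> inPi (mulq A B).
Proof.
move=> [uA pA] [uB pB]; split; first exact: uqM.
by rewrite (clM uA uB); exact: PiGroupM.
Qed.

Lemma inPiV A : inPi A -> inPi (invq A).
Proof.
by move=> [uA pA]; split; [exact: uqV|rewrite (clV uA); exact: PiGroupV].
Qed.

(** Stated for every index, since the default [Iq] lies in Pi as well; the induction over the
    program generalizes the initial list. *)
Lemma Pilist_inPi A : A \in Pilist -> inPi A.
Proof.
have [p1 p2 p3] := PiGroup_a.
have u1 : uq a1M by vm_compute.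
have u2 : uq a2M by vm_compute.
have u3 : uq a3M by vm_compute.
have i1 : inPi a1M by exact: conj u1 p1.
have i2 : inPi a2M by exact: conj u2 p2.
have i3 : inPi a3M by exact: conj u3 p3.
suff H i : inPi (nth Iq Pilist i) by move=> AP; rewrite -(nth_index Iq AP); exact: H.
rewrite /Pilist; set l0 := [:: _; _; _; _; _; _; _].
have : forall i, inPi (nth Iq l0 i).
  move=> {}i; case: i => [|i]; first exact: inPi1.
  case: i => [|i]; first exact: i1.
  case: i => [|i]; first exact: i2.
  case: i => [|i]; first exact: i3.
  case: i => [|i]; first exact: inPiV i1.
  case: i => [|i]; first exact: inPiV i2.
  case: i => [|i]; first exact: inPiV i3.
  by rewrite /l0 /= nth_nil; exact: inPi1.
move: l0 i; elim: slp => [|[k m] s IH] l i lP; first exact: lP.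
apply: IH => n; rewrite nth_rcons; case: ifP => _; first exact: lP.
by case: ifP => _; [exact: inPiM (lP _) (lP _)|exact: inPi1].
Qed.

Lemma uq_bpow n : uq (bpow n).
Proof. by case: n => [|[|n]]; vm_compute. Qed.

Lemma uq_bpV n : uq (bpV n).
Proof. by case: n => [|[|n]]; vm_compute. Qed.

Lemma bpow_bpV n : mulq (bpow n) (bpV n) = Iq.
Proof. by case: n => [|[|n]]; vm_compute. Qed.

Definition bb n : Gamma R := cl (bpow n).

Lemma cl_bpV n : cl (bpV n) = (bb n)^-1.
Proof.
apply: (mulgI (bb n)); rewrite mulgV -(clM (uq_bpow n) (uq_bpV n)) bpow_bpV.
exact: cl1.
Qed.

Lemma qdot_e33 A B : qdot (lrow A) (lcol B) = e33 (mulq A B).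
Proof.
case: A => [[[[a11 a12] a13] [[a21 a22] a23]] [[a31 a32] a33]].
by case: B => [[[[b11 b12] b13] [[b21 b22] b23]] [[b31 b32] b33]].
Qed.

Lemma bKb_hints_size : all (fun n => size (nth [::] bKb_hints n) == size Klist) (iota 0 3).
Proof. by vm_compute. Qed.

Lemma bKb_rowsP r : r \in bKb_rows ->
  exists (m : nat) (p : qm3), [/\ m \in iota 0 3, p \in Pilist & r = lrow (mulq (bpV m) (invq p))].
Proof.
rewrite /bKb_rows; move: (iota 0 3) Pilist => s1 s2 /flatten_mapP[m mI /mapP[p pP ->]].
by exists m, p.
Qed.

Lemma bKb_PibK n k : (n < 3)%N -> k \in Klist ->
  exists p m (x : Gamma R), [/\ PiGroup R p, (m < 3)%N, act x origin = origin &
    bb n * cl k * b = p * bb m * x].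
Proof.
move=> n3 kK; have nI : n \in iota 0 3 by rewrite mem_iota.
set i := index k Klist; have iK : (i < size Klist)%N by rewrite index_mem.
have zs := eqP (allP bKb_hints_size _ nI).
have ki : (k, nth 0 (nth [::] bKb_hints n) i) \in zip Klist (nth [::] bKb_hints n).
  rewrite -{1}(nth_index Iq kK) -nth_zip ?zs //; apply: mem_nth.
  by rewrite size_zip zs minnn.
have := bKb_checkP; rewrite /bKb_check allbE => /allP/(_ _ nI).
rewrite allbE => /allP/(_ _ ki) /=.
set r := nth _ bKb_rows _ => rs.
have [m [p [m3 pP rE]]] : exists (m : nat) (p : qm3), [/\ (m < 3)%N, inPi p &
    r = lrow (mulq (bpV m) (invq p))].
  rewrite /r; set l := nth 0%N _ _; case: (ltnP l (size bKb_rows)) => lt.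
    have [m [p [mI pP ->]]] := bKb_rowsP (mem_nth (lrow Iq) lt).
    by exists m, p; split; [by move: mI; rewrite mem_iota|exact: Pilist_inPi|].
  (* The default row is the one with n = 0 and p = 1. *)
  by rewrite (nth_default _ lt); exists 0%N, Iq; split; [|exact: inPi1|vm_compute].
move: rs; rewrite rE qdot_e33; set X := mulq _ _ => s1.
have uk := Klist_uq kK; have [up pPi] := pP.
have ukb := uqM uk (uq_b); have uV := uqV up.
have uX : uq X.
  by apply: uqM; [apply: (uqM _ uV); exact: uq_bpV|apply: (uqM _ ukb); exact: uq_bpow].
exists (cl p), m, (cl X); split=> //; first by apply/stab_shell.
rewrite /X (clM (uqM (uq_bpV m) uV) (uqM (uq_bpow n) ukb)).
rewrite (clM (uq_bpV m) uV) (clM (uq_bpow n) ukb) (clM uk uq_b) cl_b.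
by rewrite (clV up) cl_bpV !mulgA mulgK mulgV mul1g.
Qed.

Definition PibK (x : Gamma R) : Prop :=
  exists p m y, [/\ PiGroup R p, (m < 3)%N, act y origin = origin & x = p * bb m * y].

Lemma PibK_stab x y : act y origin = origin -> PibK x -> PibK (x * y).
Proof.
move=> y0 [p [m [z [pP m3 z0 ->]]]]; exists p, m, (z * y); split=> //.
  exact: stabM.
by rewrite !mulgA.
Qed.

Lemma PibK_b x : PibK x -> PibK (x * b).
Proof.
move=> [p [m [z [pP m3 /stabP[k kK ->] ->]]]].
have [p' [m' [z' [p'P m'3 z'0 e]]]] := bKb_PibK m3 kK.
exists (p * p'), m', z'; split=> //; first exact: PiGroupM.
by rewrite -!mulgA (mulgA (bb m)) e !mulgA.
Qed.

(** Stated for the inverse because the descent multiplies B on the left by (A b^-1)^-1, while [PibK]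
    is stable under right multiplication by b and by K. *)
Lemma PibK_inv N B : uq B -> Z.lt (qnorm (e33 B)).1 (Z.of_nat N) -> PibK (cl B)^-1.
Proof.
elim: N B => [|N IH] B uB BN.
  by have := @qnorm_ge0 (e33 B); move: BN; clear; lia.
case: (pselect (act (cl B) origin = origin)) => [B0|B0].
  exists 1, 0%N, (cl B)^-1; split=> //; [exact: PiGroup1|exact: stabV|].
  by rewrite /bb /bpow cl1 !mul1g.
have [g gB] := uq_UF uB.
have c1 := n2_origin g; rewrite gB evm22 -(act_cl _ gB) in c1.
have [p_small|p_big] := lerP (n2 (act (cl B) origin)) (1 / 2)%R.
  exfalso; have : (nsq (evq (e33 B)) <= 2)%R.
    by move: c1 p_small; have := nsq_ge0 (evq (e33 B)); set x := nsq _; set y := n2 _; clear; nra.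
  move=> n2le; have : shells (e33 B).
    by apply: shells_bound => //; apply: le_trans n2le _; lra.
  move/shells_nsq => -[_ [s1|]]; last by rewrite ltNge n2le.
  by apply: B0; apply/(stab_shell uB).
have [A AK] := approach p_big.
have uA := Klist_uq AK; have uAb := uqM uA (uqV uq_b); have uV := uqV uAb.
set D := invq _ in uV *; rewrite -actM -(clM uV uB).
have uD := uqM uV uB; have [h hD] := uq_UF uD.
have c2 := n2_origin h; rewrite hD evm22 -(act_cl _ hD) in c2 => le.
have lt : (nsq (evq (e33 (mulq D B))) < nsq (evq (e33 B)))%R.
  move: c1 c2 le; have := nsq_ge0 (evq (e33 B)); have := nsq_ge0 (evq (e33 (mulq D B))).
  have := n2_lt1 (act (cl B) origin).
  by set x := nsq _; set y := nsq _; set t := n2 _; set w := n2 _; clear; nra.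
have /IH : Z.lt (qnorm (e33 (mulq D B))).1 (Z.of_nat N).
  by have := qnorm_lt uD uB lt; move: BN; clear; lia.
move=> /(_ uD); rewrite (clM uV uB) /D (clV uAb) (clM uA (uqV uq_b)) cl_bV.
move=> /PibK_b /(@PibK_stab _ (cl A)^-1); rewrite !invgM !invgK.
rewrite !mulgA mulgVK mulgK; apply.
by apply: stabV; exact: Klist_stab.
Qed.

Lemma PibK_all x : PibK x.
Proof.
have [A uA e] := cl_surj x^-1; rewrite -(invgK x) e.
apply: (@PibK_inv (Z.to_nat (Z.add (qnorm (e33 A)).1 1))) => //.
by have := @qnorm_ge0 (e33 A); clear; lia.
Qed.

End Cosets.

(** * Elements fixing a point near the origin *)

Section Elliptic.
Local Open Scope ring_scope.
Local Open Scope group_scope.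

Lemma PiGroup_bKb n m k : (n < 3)%N -> (m < 3)%N -> k \in Klist ->
  PiGroup R (bb n * cl k * (bb m)^-1) -> n = m /\ k = Iq.
Proof.
move=> n3 m3 kK; have uk := Klist_uq kK.
rewrite -cl_bpV -mulgA -(clM uk (uq_bpV m)) -(clM (uq_bpow n) (uqM uk (uq_bpV m))).
move/(PiGroup_test (uqM (uq_bpow n) (uqM uk (uq_bpV m)))) => t.
have := disjoint_checkP; rewrite /disjoint_check allbE => /allP/(_ m); rewrite mem_iota => /(_ m3).
rewrite allbE => /allP/(_ n); rewrite mem_iota => /(_ n3).
rewrite allbE => /allP/(_ k kK); rewrite t.
by case: eqP => // -> /eqP.
Qed.

(** Write A = p b^n k with p in Pi. Then b^n k = p^-1 A passes the test too, hence is the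
    identity. *)
Lemma test_PiGroup A : uq A -> testPi A -> PiGroup R (cl A).
Proof.
move=> uA tA; have [p [n [y [pP n3 /stabP[k kK ->] e]]]] := PibK_all (cl A).
have uk := Klist_uq kK; have ub := uq_bpow n.
suff [n0 k1] : n = 0%N /\ k = Iq by rewrite e n0 k1 /bb /bpow cl1 !mulg1.
have : testable (cl (mulq (bpow n) (mulq k (bpV 0)))).
  rewrite (clM ub (uqM uk (uq_bpV 0))) (clM uk (uq_bpV 0)) cl_bpV.
  have -> : bb 0 = 1 by rewrite /bb /bpow cl1.
  rewrite invg1 mulg1 -/(bb n).
  have -> : bb n * cl k = p^-1 * cl A by rewrite e -!mulgA mulKg.
  by apply: (Pi_testable (PiGroupV pP)); exists A.
move/(testable_testPi (uqM ub (uqM uk (uq_bpV 0)))) => t.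
have := disjoint_checkP; rewrite /disjoint_check allbE => /allP/(_ 0 isT).
rewrite allbE => /allP/(_ n); rewrite mem_iota => /(_ n3).
rewrite allbE => /allP/(_ k kK); rewrite t.
by case: eqP => // -> /eqP.
Qed.

Lemma cl_j4V : cl j4V = j4^-1.
Proof.
apply: (mulgI j4); rewrite mulgV -cl_j4.
have u1 : uq j4M by vm_compute.
have u2 : uq j4V by vm_compute.
rewrite -(clM u1 u2); have -> : mulq j4M j4V = Iq by vm_compute.
exact: cl1.
Qed.

Lemma uq_j4 : uq j4M. Proof. by vm_compute. Qed.

Lemma uq_j4V : uq j4V. Proof. by vm_compute. Qed.

Lemma norm_a a : a \in [:: a1M; a2M; a3M] ->
  uq a && testPi (mulq j4M (mulq a (invq j4M))).
Proof.
have : all (fun a => uq a && testPi (mulq j4M (mulq a (invq j4M)))) [:: a1M; a2M; a3M].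
  by vm_compute.
by move/allP; apply.
Qed.

(** The x whose conjugate lies in Pi form a subgroup, so testing the three generators suffices. *)
Lemma PiGroup_conj x : PiGroup R x -> PiGroup R (j4 * x * j4^-1).
Proof.
pose H : set (Gamma R) := [set y | PiGroup R (j4 * y * j4^-1)]%classic.
move=> /(_ H); apply; split; last first.
  have aH a : a \in [:: a1M; a2M; a3M] -> H (cl a).
    move=> /norm_a/andP[ua ta]; rewrite /H /=; have uV := uqV uq_j4.
    rewrite -cl_j4 -(clV uq_j4) -mulgA -(clM ua uV) -(clM uq_j4 (uqM ua uV)).
    exact: (test_PiGroup (uqM uq_j4 (uqM ua uV)) ta).
  move=> z /= [[] ->|->]; rewrite -?[a1 R]cl_a1 -?[a2 R]cl_a2 -?[a3 R]cl_a3.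
  - by apply: aH; vm_compute.
  - by apply: aH; vm_compute.
  - by apply: aH; vm_compute.
split; first by rewrite inE /H /= mulg1 mulgV; exact: PiGroup1.
move=> y z; rewrite !inE /H /= => yP zP.
have -> : j4 * (y * z^-1) * j4^-1 = (j4 * y * j4^-1) * (j4 * z * j4^-1)^-1.
  by move: (j4) => J; rewrite !invgM invgK !mulgA mulgVK.
exact: PiGroupM yP (PiGroupV zP).
Qed.

Lemma hval_stab (g : UF R) p : actUF g origin = origin -> nsq (hval g p) = 1%R.
Proof.
move=> g0; have [l _ e] := hz_actUF g origin; rewrite g0 in e.
have lE : UFmx g 2 2 = l.
  by have := congr1 (fun M : 'cV_3 => M 2%R 0%R) e; rewrite tilde_hz0 !mxE /= mulr1.
have := n2_origin g; rewrite g0 n2_0 subr0 mulr1 lE => l1.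
rewrite /hval e jfZl nsqM nsq_conj l1 mul1r.
by rewrite jf_origin nsqN /nsq /=; ring.
Qed.

Lemma n2_stab x p : act x origin = origin -> n2 (act x p) = n2 p.
Proof.
elim/coset_ind: x => g; rewrite !act_coset => g0.
have gV0 : actUF g^-1 origin = origin.
  by rewrite -{1}g0 -actUFM mulVg (actUF_center _ (Zcenter1 R)).
have := n2_act g p; rewrite (hval_stab _ gV0) mul1r.
by move: (n2 _) (n2 _) => a c; clear; lra.
Qed.

Lemma nsq_e33 A : uq A -> (nsq (evq (e33 A)) * (1 - n2 (act (cl A) origin)) = 1)%R.
Proof.
move=> /uq_UF[g gA]; rewrite (act_cl _ gA) -evm22 -gA.
exact: n2_origin.
Qed.

Lemma qnorm_e33 A B : uq A -> uq B ->
  n2 (act (cl A) origin) = n2 (act (cl B) origin) -> qnorm (e33 A) = qnorm (e33 B).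
Proof.
move=> /nsq_e33 eA /nsq_e33 eB e; rewrite e in eA.
have : nsq (evq (e33 A)) = nsq (evq (e33 B)).
  have n0 : (1 - n2 (act (cl B) origin) != 0)%R.
    by apply: lt0r_neq0; rewrite subr_gt0; exact: n2_lt1.
  by apply: (mulIf n0); rewrite eA eB.
rewrite !nsq_evq => /zr_s3_inj; case: (qnorm _) (qnorm _) => ? ? [? ?] /= [-> ->].
by [].
Qed.

Lemma fix_shells A p : uq A -> (n2 p <= 1 / 2)%R -> act (cl A) p = p -> shells (e33 A).
Proof.
move=> uA p_small; have [g gA] := uq_UF uA; rewrite (act_cl _ gA) => gp.
by apply: shells_bound => //; rewrite -evm22 -gA; exact: fix_bound p_small gp.
Qed.

(** One step down through the values of [shells]. *)
Lemma descend M : uq M -> ~ shell1 (e33 M) -> shells (e33 M) ->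
  exists A D, [/\ A \in Klist, uq D, cl M = cl A * cl bV * cl D, shells (e33 D) &
    Z.lt (qnorm (e33 D)).1 (qnorm (e33 M)).1].
Proof.
move=> uM n1 sh.
have c1 := nsq_e33 uM; have [c_hi [/n1 []|c_lo]] := shells_nsq sh.
have p_big : (1 / 2 < n2 (act (cl M) origin))%R.
  by move: c1 c_lo; set x := nsq _; set y := n2 _; clear; nra.
have [A AK] := approach p_big.
have uA := Klist_uq AK; have uAb := uqM uA (uqV uq_b); have uV := uqV uAb.
set E := invq _ in uV *; rewrite -actM -(clM uV uM).
have uD := uqM uV uM; have c2 := nsq_e33 uD => le.
have lt : (nsq (evq (e33 (mulq E M))) < nsq (evq (e33 M)))%R.
  move: c1 c2 le; have := nsq_ge0 (evq (e33 M)); have := nsq_ge0 (evq (e33 (mulq E M))).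
  have := n2_lt1 (act (cl M) origin).
  by set x := nsq _; set y := nsq _; set t := n2 _; set w := n2 _; clear; nra.
exists A, (mulq E M); split=> //; last exact: (qnorm_lt uD uM lt).
  by rewrite (clM uV uM) /E (clV uAb) (clM uA (uqV uq_b)) mulVKg.
by apply: (shells_bound uD); apply: le_trans (ltW lt) c_hi.
Qed.

End Elliptic.

(** * Double cosets of K and the candidates for twisted elements *)

Section Candidates.
Local Open Scope ring_scope.
Local Open Scope group_scope.

Lemma uq_shell3_mx : uq shell3_mx. Proof. by vm_compute. Qed.

Lemma uq_bV : uq bV. Proof. by vm_compute. Qed.

Lemma uq_g : uq gM. Proof. by vm_compute. Qed.

Lemma dotmv_lcol A B : dotmv A (lcol B) = lcol (mulq A B).
Proof.
case: A => [[[[a11 a12] a13] [[a21 a22] a23]] [[a31 a32] a33]].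
by case: B => [[[[b11 b12] b13] [[b21 b22] b23]] [[b31 b32] b33]].
Qed.

Lemma shell3_decomp k : k \in Klist -> let X := mulq bV (mulq k bV) in
  shell3 (e33 X) -> exists y1 y2 : Gamma R, [/\ act y1 origin = origin, act y2 origin = origin &
    cl X = y1 * cl shell3_mx * y2].
Proof.
move=> kK X s3X; have uk := Klist_uq kK.
have uX : uq X := uqM uq_bV (uqM uk uq_bV).
have := shell3_checkP; rewrite /shell3_check allbE => /allP/(_ k kK).
rewrite -/X s3X hasbE => /hasP[c cK].
have uc := Klist_uq cK; have uV := uqV uq_shell3_mx; have ucX := uqM uc uX.
rewrite dotmv_lcol qdot_e33 => s1.
exists (cl c)^-1, (cl (mulq (invq shell3_mx) (mulq c X))); split.
- by apply: stabV; exact: Klist_stab.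
- by apply/(stab_shell (uqM uV ucX)).
rewrite (clM uV ucX) (clV uq_shell3_mx) (clM uc uX).
by move: (cl c) (cl shell3_mx) (cl X) => x y z; rewrite -!mulgA mulVKg mulKg.
Qed.

(** There are three values in [shells], so at most two steps reach K; two steps can only start at
    the top value, which is a single double coset by [shell3_decomp]. *)
Lemma decomp M : uq M -> shells (e33 M) -> exists gs (y1 y2 : Gamma R),
  [/\ uq gs, gs \in [:: Iq; bV; shell3_mx], act y1 origin = origin, act y2 origin = origin &
    cl M = y1 * cl gs * y2].
Proof.
move=> uM sM; have [s1|s1] := boolP (shell1 (e33 M)).
  exists Iq, 1, (cl M); split.
  - by vm_compute.
  - by vm_compute.
  - exact: act1.
  - exact/(stab_shell uM).
  - by rewrite cl1 !mul1g.
have [A [D [AK uD eM sD lt]]] := descend uM (elimN idP s1) sM.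
have [d1|d1] := boolP (shell1 (e33 D)).
  exists bV, (cl A), (cl D); split.
  - exact: uq_bV.
  - by vm_compute.
  - exact: Klist_stab.
  - exact/(stab_shell uD).
  - exact: eM.
have [A' [D' [A'K uD' eD sD' lt']]] := descend uD (elimN idP d1) sD.
have [qM d'1] : qnorm (e33 M) = (4, 2)%ZZ /\ shell1 (e33 D').
  move: lt lt' d1 s1; rewrite /shell1.
  by case/or3P: sM => /eqP ->; case/or3P: sD => /eqP ->; case/or3P: sD' => /eqP ->.
have D'0 := (stab_shell uD').2 d'1.
have uA' := Klist_uq A'K.
set X := mulq bV (mulq A' bV).
have uX : uq X := uqM uq_bV (uqM uA' uq_bV).
have eX : cl M = cl A * cl X * cl D'.
  rewrite eM eD /X (clM uq_bV (uqM uA' uq_bV)) (clM uA' uq_bV).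
  by move: (cl A) (cl A') (cl bV) (cl D') => x y z w; rewrite !mulgA.
have sX : shell3 (e33 X).
  rewrite /shell3 -qM; apply/eqP; apply: (@qnorm_e33 _ _ uX uM).
  by rewrite eX !actM D'0 (n2_stab _ (Klist_stab AK)).
have [y1 [y2 [y10 y20 e]]] := shell3_decomp A'K sX.
exists shell3_mx, (cl A * y1), (y2 * cl D'); split.
- exact: uq_shell3_mx.
- by vm_compute.
- exact: stabM (Klist_stab AK) y10.
- exact: stabM y20 D'0.
rewrite eX e.
by move: (cl A) (cl shell3_mx) (cl D') => x y z; rewrite !mulgA.
Qed.

Lemma pow_test_fix M P n p : uq M -> uq P -> (n2 p <= 1 / 2)%R ->
  act (cl M) p = p -> act (cl P) p = p -> pow_test M P n.
Proof.
move=> uM uP p_small Mp; elim: n P uP => [|n IH] P uP Pp /=.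
  by rewrite (fix_shells uP p_small Pp).
rewrite (fix_shells uP p_small Pp); apply: IH; first exact: uqM.
by rewrite (clM uP uM) actM Mp.
Qed.

Lemma bK_P n k : (n < 3)%N -> k \in Klist -> mulq (bpow n) k \in bK.
Proof. by move=> n3 kK; apply/allpairsP; exists (n, k); split; rewrite // mem_iota. Qed.

Lemma hconj_uq h : h \in hconj -> uq h.
Proof.
move=> /allpairsP[[n k] [_ kK ->]].
exact: (uqM (Klist_uq kK) (uq_bpow n)).
Qed.

Lemma det_twist A T : uq A -> uq T ->
  detq (mulq (mulq T A) (mulq (invq T) j4V)) \in cubes -> detq A \in twist_dets.
Proof.
move=> uA uT; rewrite (detqM (mulq T A)) (detqM T) (detqM (invq T)).
have -> : detq j4V = qzX 4 by vm_compute.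
have TV : qmul (detq T) (detq (invq T)) = q1.
  rewrite -(detqM); suff -> : mulq T (invq T) = Iq by [].
  have [g gT] := uq_UF uT.
  by apply: evm_inj; rewrite evmM (evm_inv uT) -gT mulmxV ?UF_unit // evm1.
set x := qmul _ _ => xc.
have -> : detq A = qmul x (qzX 8).
  have e : (evq (detq T) * evq (detq (invq T)) = 1)%R by rewrite -evqM TV evq1.
  apply: evq_inj; rewrite /x; have := evqzX 4; have := evqzX 8.
  move: (qzX 4) (qzX 8) => y4 y8 e8 e4; rewrite !evqM e4 e8.
  move: (evq (detq T)) (evq (detq (invq T))) e => x1 x2 e.
  by rewrite [X in _ = (X * _)%R]mulrACA e mul1r -mulrA -exprD zeta12 mulr1.
have : all (fun y => qmul y (qzX 8) \in twist_dets) cubes by vm_compute.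
by move/allP/(_ _ xc).
Qed.

Lemma elliptic_twist gs k n k' p :
  uq gs -> gs \in [:: bV; shell3_mx] -> k \in Klist -> (n < 3)%N -> k' \in Klist ->
  (n2 p <= 1 / 2)%R -> act (cl gs * cl k) p = p ->
  PiGroup R (bb n * cl k' * (cl gs * cl k) * (bb n * cl k')^-1 * j4^-1) ->
  exists h : Gamma R, cl gs * cl k = h * cl gM * h^-1.
Proof.
move=> ugs gsP kK n3 k'K p_small fp.
have uk := Klist_uq kK; have uk' := Klist_uq k'K.
set m := mulq gs k; have um : uq m := uqM ugs uk.
have em : cl m = cl gs * cl k := clM ugs uk.
set T := mulq (bpow n) k'; have uT : uq T := uqM (uq_bpow n) uk'.
have eT : cl T = bb n * cl k' := clM (uq_bpow n) uk'.
have uV := uqV uT; have uTm := uqM uT um; have uVJ := uqM uV uq_j4V.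
rewrite -em -eT -cl_j4V -(clV uT) -(clM uT um) -mulgA -(clM uV uq_j4V).
rewrite -(clM uTm uVJ) => /(PiGroup_test (uqM uTm uVJ)).
rewrite /testPi; case: ifP => // dc; rewrite redmM redmM redmM => r9.
have TP : (redm T, redm (invq T)) \in bK9.
  by apply/mapP; exists T => //; exact: bK_P.
have := twist_elliptic_checkP; rewrite /twist_elliptic_check allbE => /allP/(_ gs gsP).
rewrite allbE => /allP/(_ k kK); rewrite -/m (det_twist um uT dc).
have mp : act (cl m) p = p by rewrite em.
rewrite (pow_test_fix 3 um um p_small mp mp).
case: ifP => [|_].
  rewrite allbE; move: r9 TP.
  move: (redm T) (redm (invq T)) (redm m) (redm j4V) => rT rV rm rj r9 TP.
  by move/allP/(_ _ TP); rewrite /fst /snd r9.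
rewrite hasbE => /hasP[h hP hm]; have uh := hconj_uq hP.
exists (cl h); have := eqscq_cl (uqM um uh) hm.
by rewrite (clM uh uq_g) (clM um uh) => ->; rewrite mulgK.
Qed.

End Candidates.

(** * The fixed point of buv *)

Section FixedPoint.
Local Open Scope ring_scope.
Local Open Scope sesquilinear_scope.

Definition expi (x : R) : C := (cos x +i* sin x)%C.

Lemma expiD x y : expi (x + y) = expi x * expi y.
Proof.
rewrite /expi cosD sinD; simpc; congr (_ +i* _)%C.
by rewrite addrC.
Qed.

(* A cube root of zeta, and the inverse of an eigenvalue of buv. *)
Definition tau : C := expi (2 * pi / 36).

Lemma tau3 : tau ^+ 3 = zeta.
Proof.
rewrite !exprS expr0 mulr1 /tau -!expiD /zeta /expi.
by have -> : 2 * pi / 36 + (2 * pi / 36 + 2 * pi / 36) = 2 * pi / 12 :> R by field.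
Qed.

Lemma tau_nsq : nsq tau = 1.
Proof. by rewrite /nsq /=; exact: cos2Dsin2. Qed.

Lemma tau_conj : tau^* * tau = 1.
Proof. by rewrite -nsqC tau_nsq. Qed.

Lemma tau_neq0 : tau != 0.
Proof.
by apply/eqP => t0; have := tau_conj; rewrite t0 mulr0 => /eqP; rewrite eq_sym oner_eq0.
Qed.

Local Notation G := (evm gM).
Local Notation P := (Dmx R *m gamma0 R).
Definition e3v : 'cV[C]_3 := delta_mx 2 0.

(** The cube of the matrix is zeta^-1, so its eigenvalues are cube roots of zeta^-1; these are not
    in Z[zeta], whence [tau]. *)
Lemma gM3 : mulq gM (mulq gM gM) = scq (qzX 11) Iq. Proof. by vm_compute. Qed.

Lemma G3 (x : 'cV[C]_3) : G *m (G *m (G *m x)) = zeta ^+ 11 *: x.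
Proof.
have e : G *m (G *m G) = zeta ^+ 11 *: 1%:M by rewrite -!evmM gM3 evm_sc evm1 evqzX.
by rewrite (mulmxA G G x) (mulmxA G (G *m G)) e -scalemxAl mul1mx.
Qed.

(** Three times the projection of e3 to the eigenspace of G for tau^-1. *)
Definition v0 : 'cV[C]_3 := e3v + tau *: (G *m e3v) + tau ^+ 2 *: (G *m (G *m e3v)).

Lemma Gv0 : tau *: (G *m v0) = v0.
Proof.
have h : tau * tau ^+ 2 * zeta ^+ 11 = 1 by rewrite -exprS tau3 -exprS zeta12.
rewrite /v0 !mulmxDr -!scalemxAr G3 !scalerDr !scalerA h scale1r -expr2.
by rewrite [RHS]addrC !addrA [RHS]addrC addrA.
Qed.

Lemma P_unit : P \in unitmx.
Proof. by rewrite unitmx_mul Dmx_unit gamma0_unit. Qed.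

Lemma tildeP (g : UF R) (x : 'cV[C]_3) : tilde g *m (P *m x) = P *m (UFmx g *m x).
Proof. by rewrite mulmxA tilde_conj -mulmxA. Qed.

Definition jP (x y : 'cV[C]_3) : C := jf (P *m x) (P *m y).

Lemma jP_inv (g : UF R) x y : jP (UFmx g *m x) (UFmx g *m y) = jP x y.
Proof. by rewrite /jP -!tildeP jf_tilde. Qed.

Lemma jfDl (x y z : 'cV[C]_3) : jf (x + y) z = jf x z + jf y z.
Proof. by rewrite /jf linearD /= map_mxD !mulmxDl mxE. Qed.

Lemma jPDl x y z : jP (x + y) z = jP x z + jP y z.
Proof. by rewrite /jP mulmxDr jfDl. Qed.

Lemma jPZl (c : C) x y : jP (c *: x) y = c^* * jP x y.
Proof. by rewrite /jP -scalemxAr jfZl. Qed.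

Lemma jPZr (c : C) x y : jP x (c *: y) = c * jP x y.
Proof. by rewrite /jP -scalemxAr jfZr. Qed.

Lemma P2 (x : 'cV[C]_3) : (P *m x) 2 0 = dsqrt R * x 2 0.
Proof. by rewrite Dgamma0 mx3_col mxE /= !mul0r !add0r. Qed.

Lemma P_e3 : P *m e3v = dsqrt R *: hz origin.
Proof.
rewrite Dgamma0 mx3_col; apply/matrixP => i k; rewrite ord1 !mxE /=.
by case: i => [[|[|[|//]]]] ? /=; rewrite !(mul0r, mulr0, add0r, addr0, mulr1).
Qed.

Lemma dsqrt_conj : (dsqrt R)^* = dsqrt R.
Proof. exact: conjc_real. Qed.

Lemma jP_e3 x : jP e3v x = - (dsqrt R ^+ 2 * x 2 0).
Proof.
rewrite /jP P_e3 jfZl dsqrt_conj jfE P2 !mxE /= rmorph0 rmorph1.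
by move: (dsqrt R) (x 2 0) ((P *m x) 0 0) ((P *m x) 1 0) => d y a b; clear; ring.
Qed.

Definition v0_last : R := 1 + 2 * (cos (2 * pi / 36) + cos (4 * pi / 36)).

(** As |z0|^2 = 1 - 3 / [v0_last], the upper bound puts z0 within |z|^2 <= 2/5. *)
Lemma v0_last_bound : 1 < v0_last <= 5.
Proof.
have pp := pi_gt0 R.
have c1 : 0 < cos (2 * pi / 36) :> R by apply: cos_gt0_pihalf; lra.
have c2 : 0 < cos (4 * pi / 36) :> R by apply: cos_gt0_pihalf; lra.
have := cos_le1 (2 * pi / 36 : R); have := cos_le1 (4 * pi / 36 : R).
by rewrite /v0_last; move: c1 c2; set a := cos _; set c := cos _; clear; lra.
Qed.

Lemma v0E i : v0 i 0 = e3v i 0 + tau * (G *m e3v) i 0 + tau ^+ 2 * (G *m (G *m e3v)) i 0.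
Proof.
have D (x y : 'cV[C]_3) : (x + y) i 0 = x i 0 + y i 0 by rewrite mxE.
have Z (c : C) (x : 'cV[C]_3) : (c *: x) i 0 = c * x i 0 by rewrite mxE.
by rewrite /v0 !D !Z.
Qed.

Lemma v0_2 : v0 2 0 = (v0_last)%:C%C.
Proof.
have Ge : (G *m e3v) 2 0 = evq (e33 gM) by rewrite -colE mxE evm22.
have GGe : (G *m (G *m e3v)) 2 0 = evq (e33 (mulq gM gM)).
  by rewrite mulmxA -evmM -colE mxE evm22.
(* G^2 = zeta^11 G^-1, and inversion conjugates the (3,3) entry. *)
have e2 : e33 (mulq gM gM) = qmul (qzX 11) (qconj (e33 gM)) by vm_compute.
have {}GGe : (G *m (G *m e3v)) 2 0 = zeta ^+ 11 * (evq (e33 gM))^*.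
  have aux c : evq (qmul (qzX 11) (qconj c)) = zeta ^+ 11 * (evq c)^*.
    by rewrite evqM evqzX evq_conj.
  exact: etrans GGe (etrans (congr1 evq e2) (aux _)).
have e1 : e33 gM = qadd q1 (qconj qz) by vm_compute.
pose y := tau * evq (e33 gM).
have tz : tau ^+ 2 * zeta ^+ 11 = tau^*.
  by apply: (mulIf tau_neq0); rewrite tau_conj mulrC mulrA -exprS tau3 -exprS zeta12.
have -> : v0 2 0 = 1 + (y + y^*).
  rewrite v0E Ge GGe mulrA tz /y rmorphM /= addrA.
  by rewrite mxE !eqxx.
have -> : y = expi (2 * pi / 36) + (expi (4 * pi / 36))^*.
  rewrite /y e1 evqD evq1 evq_conj evqz -tau3 mulrDr mulr1; congr (_ + _).
  have -> : expi (4 * pi / 36) = tau * tau.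
    by rewrite /tau -expiD; congr expi; field.
  have -> : (tau ^+ 3)^* = tau^* * (tau^* * tau^*).
    by rewrite -!rmorphM /= !exprS expr0 mulr1.
  by rewrite rmorphM /= (mulrA tau) (mulrC tau) tau_conj mul1r.
have yy (x : C) : 1 + (x + x^*) = (1 + 2 * complex.Re x)%:C%C.
  case: x => p q; have -> : ((p +i* q)%C)^* = (p -i* q)%C by [].
  by apply/eqP; rewrite eq_complex /=; apply/andP; split; apply/eqP; ring.
by rewrite yy.
Qed.

(** G preserves the form and tau G fixes v0, so the three terms of the left argument contribute
    equally. *)
Lemma jP_v0 : jP v0 v0 = - (3 * dsqrt R ^+ 2 * (v0_last)%:C%C).
Proof.
have [g gE] := uq_UF uq_g.
have t (x : 'cV[C]_3) : jP (G *m x) v0 = tau * jP x v0.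
  by rewrite -{1}Gv0 jPZr -gE jP_inv.
rewrite {1}/v0 !jPDl !jPZl !t jP_e3 v0_2 rmorphXn /=.
have tc := tau_conj.
have t2 : tau^* ^+ 2 * (tau * tau) = 1 by rewrite -expr2 -exprMn tc expr1n.
rewrite [tau^* * _]mulrA tc mul1r [tau^* ^+ 2 * _]mulrA mulrA -(mulrA (tau^* ^+ 2)) t2 mul1r.
by move: (dsqrt R) (v0_last)%:C%C => d w; clear; ring.
Qed.

Lemma v0_last_neq0 : (v0_last)%:C%C != 0 :> C.
Proof.
have /andP[w1 _] := v0_last_bound; apply/eqP => /(congr1 (@complex.Re R)) /= w0.
by move: w1; rewrite w0; clear; lra.
Qed.

Definition z0val : C * C := projpt (P *m v0).

Lemma hcol_projpt (V : 'cV[C]_3) : V 2 0 != 0 -> hcol (projpt V) = (V 2 0)^-1 *: V.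
Proof.
move=> n0; apply/matrixP => i k; rewrite ord1 [RHS]mxE mxE /=.
case: i => [[|[|[|//]]]] lti /=.
- by rewrite mulrC; congr (_ * V _ 0); apply: val_inj.
- by rewrite mulrC; congr (_ * V _ 0); apply: val_inj.
- by rewrite -(mulVf n0); congr (_ * V _ 0); apply: val_inj.
Qed.

Lemma hcol_z0val : hcol z0val = ((P *m v0) 2 0)^-1 *: (P *m v0).
Proof. by apply: hcol_projpt; rewrite P2 v0_2 mulf_neq0 ?dsqrt_neq0 ?v0_last_neq0. Qed.

Lemma n2_z0val : nsq z0val.1 + nsq z0val.2 = 1 - 3 / v0_last.
Proof.
have /andP[w1 _] := v0_last_bound; have w0 := v0_last_neq0.
have := jP_v0; rewrite /jP; set V := P *m v0.
have V2 : V 2 0 = dsqrt R * (v0_last)%:C%C by rewrite P2 v0_2.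
have V0 : V 2 0 != 0 by rewrite V2 mulf_neq0 ?dsqrt_neq0.
have -> : V = V 2 0 *: hcol z0val by rewrite hcol_z0val scalerA mulfV // scale1r.
rewrite jfZl jfZr mulrA -nsqC V2 nsqM.
have -> : nsq (dsqrt R) = s3 - 1 by rewrite -dr_sqr dsqrtE /nsq /= expr0n addr0.
have -> : nsq (v0_last)%:C%C = v0_last ^+ 2 by rewrite /nsq /= expr0n addr0.
have -> : jf (hcol z0val) (hcol z0val) = (nsq z0val.1 + nsq z0val.2 - 1)%:C%C.
  by rewrite jfE !mxE /= rmorph1 mulr1 -!nsqC !rmorphD rmorphN rmorph1.
have -> : dsqrt R ^+ 2 = (s3 - 1)%:C%C.
  by rewrite -dr_sqr rmorphXn.
have -> (a c : R) : - (3 * a%:C * c%:C)%C = (- (3 * a * c))%:C%C.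
  by rewrite rmorphN !rmorphM rmorph_nat.
rewrite -rmorphM.
move=> /(congr1 (@complex.Re R)) /=; have := cos_num_gt0.
move: w1; set s := s3; set w := v0_last; set n := nsq _ + nsq _ => w1 s1 e.
have : (s - 1) * (w * (w * (n - 1) + 3)) = 0 by move: e; clear; lra.
move/eqP; rewrite mulf_eq0 (gt_eqF s1) /= mulf_eq0 => /orP[/eqP w00|/eqP h].
  by move: w1; rewrite w00; lra.
have wn : w != 0 by rewrite gt_eqF //; lra.
by apply: (mulfI wn); rewrite mulrBr mulr1 mulrCA mulfV // mulr1; move: h; lra.
Qed.

Fact z0_subproof : (`|z0val.1| ^+ 2 + `|z0val.2| ^+ 2 < 1).
Proof.
rewrite !nsq_norm -rmorphD /=; suff : nsq z0val.1 + nsq z0val.2 < 1 by rewrite -(ltcR _ 1).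
rewrite n2_z0val.
have /andP[w1 _] := v0_last_bound; have : 0 < 3 / v0_last by rewrite divr_gt0 //; lra.
by clear; lra.
Qed.

Definition z0 : B2 R := exist _ z0val z0_subproof.

Lemma n2_z0 : n2 z0 <= 1 / 2.
Proof.
rewrite /n2 /= n2_z0val; have /andP[w1 w5] := v0_last_bound.
have : 3 / 5 <= 3 / v0_last by rewrite ler_pM2l // lef_pV2 // posrE; lra.
by clear; lra.
Qed.

Lemma hz_z0 : hz z0 = ((P *m v0) 2 0)^-1 *: (P *m v0).
Proof. exact: hcol_z0val. Qed.

Lemma act_g_z0 : act (cl gM) z0 = z0.
Proof.
have [g gE] := uq_UF uq_g; rewrite (act_cl _ gE); apply/actUFP.
exists tau^-1; rewrite -/(hz z0) hz_z0 -scalemxAr tildeP gE scalerA mulrC -scalerA.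
congr (_ *: _); rewrite scalemxAr; congr (_ *m _).
by rewrite -[in RHS]Gv0 scalerA mulVf ?tau_neq0 // scale1r.
Qed.

Lemma jf_hz_neq0 (p q : B2 R) : jf (hz p) (hz q) != 0.
Proof.
apply/eqP; rewrite jf_hz2 => /eqP; rewrite subr_eq0 => /eqP h.
have := @nsq_CauchySchwarz (val p).1^* (val p).2^* (val q).1 (val q).2.
rewrite h !nsq_conj -/(n2 p) -/(n2 q).
have -> : nsq 1 = 1 by rewrite /nsq /= expr0n addr0 expr1n.
have := n2_lt1 p; have := n2_lt1 q; have := n2_ge0 p; have := n2_ge0 q.
by move: (n2 p) (n2 q) => x y; clear; nra.
Qed.

Definition g11 : quad := (0,-1,0,1)%ZZ.
Definition g12 : quad := (1,-1,0,0)%ZZ.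
Definition g31 : quad := (1,1,0,0)%ZZ.
Definition g32 : quad := (0,0,-1,0)%ZZ.
(** Exposes the four entries used in [g_eigen] and keeps the others abstract. *)
Definition gM_eta (A : qm3) : qm3 :=
  let: ((a, c, d), r, (e, f, h)) := A in ((g11, g12, d), r, (g31, g32, h)).
Lemma gM_entries : gM = gM_eta gM. Proof. by vm_compute. Qed.

(** The third row gives x1 = zeta^-2 (1 + zeta) x0, and then for nonzero x0 the first row forces c =
    zeta^3 - zeta^2 - zeta, whose squared modulus is 2. *)
Lemma g_eigen (x : 'cV[C]_3) c : G *m x = c *: x -> c^* * c = 1 -> x 2 0 = 0 -> x = 0.
Proof.
rewrite gM_entries /gM_eta; case: gM => [[[[_ _] d] [[g21 g22] g23]] [[_ _] h]].
move=> e c1 x3.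
have row i : (evm (g11, g12, d, (g21, g22, g23), (g31, g32, h)) *m x) i 0 = c * x i 0.
  by rewrite e mxE.
have := row 0; have := row 2; rewrite /evm [map3 _ _]/map3 /mxr3 mx3_col !mxE x3.
have -> : evq g11 = zeta ^+ 3 - zeta by rewrite /= /zc; ring.
have -> : evq g12 = 1 - zeta by rewrite /= /zc; ring.
have -> : evq g31 = 1 + zeta by rewrite /= /zc; ring.
have -> : evq g32 = - zeta ^+ 2 by rewrite /= /zc; ring.
rewrite /= !mulr0 !addr0 => r2 r0.
have z4 := @zeta4 R.
have x1E : x 1 0 = (1 - zeta ^+ 2) * (1 + zeta) * x 0 0.
  move: r2; move: (x 0 0) (x 1 0) => a y r2.
  have -> : y = (1 - zeta ^+ 2) * (1 + zeta) * a
      - (1 - zeta ^+ 2) * ((1 + zeta) * a + - zeta ^+ 2 * y).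
    by ring: z4.
  by rewrite r2 mulr0 subr0.
have w0 : (c - (zeta ^+ 3 - zeta ^+ 2 - zeta)) * x 0 0 = 0.
  by rewrite mulrBl -r0 x1E; ring: z4.
have x00 : x 0 0 = 0.
  apply/eqP; move/eqP: w0; rewrite mulf_eq0 => /orP[|//]; rewrite subr_eq0 => /eqP cE.
  have : c^* * c = 2.
    rewrite cE !(rmorphB, rmorphXn) /= conj_zeta; ring: z4.
  rewrite c1 => /eqP; rewrite -subr_eq0 => /eqP h2.
  have : (1 : C) = 0 by rewrite -oppr0 -h2; ring.
  by move=> /eqP; rewrite oner_eq0.
apply/matrixP => i k; rewrite ord1 [RHS]mxE.
case: i => [[|[|[|//]]]] lti.
- by rewrite -x00; congr (x _ 0); apply: val_inj.
- by rewrite -(mulr0 ((1 - zeta ^+ 2) * (1 + zeta))) -x00 -x1E; congr (x _ 0); apply: val_inj.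
- by rewrite -x3; congr (x _ 0); apply: val_inj.
Qed.

(** The last clause holds because lifts of two points of the ball are never orthogonal: all fixed
    points share one eigenvalue, of modulus 1. *)
Lemma fix_eigen A (p : B2 R) : uq A -> act (cl A) p = p ->
  exists x : 'cV[C]_3, exists c : C, [/\ hz p = P *m x, evm A *m x = c *: x &
    forall (q : B2 R) (y : 'cV[C]_3) (d : C), hz q = P *m y -> evm A *m y = d *: y -> c^* * d = 1].
Proof.
move=> uA; have [g gA] := uq_UF uA; rewrite (act_cl _ gA) => gp.
have [c _ e] := hz_actUF g p; rewrite gp in e.
pose x := invmx P *m hz p; have xE : hz p = P *m x by rewrite mulKVmx // P_unit.
have Ax : evm A *m x = c *: x.
  apply: (can_inj (mulKmx (P_unit))); rewrite -gA -tildeP -xE e -scalemxAr.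
  exact: congr1 _ xE.
exists x, c; split=> // q y d qE Ay.
have := jP_inv g x y; rewrite gA Ax Ay jPZl jPZr mulrA /jP -xE -qE => h.
by apply: (mulIf (jf_hz_neq0 p q)); rewrite mul1r.
Qed.

Lemma z0_eigen : exists2 t : C, t != 0 & hz z0 = P *m (t *: v0).
Proof.
exists ((P *m v0) 2 0)^-1; last by rewrite hz_z0 scalemxAr.
by rewrite invr_neq0 // P2 v0_2 mulf_neq0 ?dsqrt_neq0 ?v0_last_neq0.
Qed.

(** The lifts of p and z0 have the same eigenvalue and the same last coordinate, so [g_eigen] kills
    their difference. *)
Lemma fix_g_uniq p : act (cl gM) p = p -> p = z0.
Proof.
move=> /(fix_eigen uq_g)[x [c [px Gx H]]].
have [t t0 zE] := z0_eigen.
have Gv : G *m (t *: v0) = tau^-1 *: (t *: v0).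
  rewrite -scalemxAr scalerA mulrC -scalerA; congr (_ *: _).
  by rewrite -[in RHS]Gv0 scalerA mulVf ?tau_neq0 // scale1r.
have cc := H _ _ _ px Gx.
have ct := H _ _ _ zE Gv.
have cE : c = tau^-1.
  have c0 : c^* != 0 by apply/eqP => c0; move/eqP: cc; rewrite c0 mul0r eq_sym oner_eq0.
  by apply: (mulfI c0); rewrite cc ct.
have y0 : x - t *: v0 = 0.
  apply: (g_eigen (c := c)) => //.
    by rewrite mulmxBr Gx Gv -cE scalerBr.
  have D (a d : 'cV[C]_3) : (a - d) 2 0 = a 2 0 - d 2 0 by rewrite !mxE.
  apply: (mulfI (dsqrt_neq0 R)); rewrite D mulrBr -!P2 -px -zE mulr0.
  by rewrite !mxE /= subrr.
apply: val_inj; apply: (@hcol_inj _ _ _ 1); rewrite scale1r.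
rewrite -[hcol _]/(hz p) -[RHS]/(hz z0) px zE; congr (_ *m _).
by apply/eqP; rewrite -subr_eq0 y0.
Qed.

Lemma mulv0 A i : (evm A *m v0) i 0 =
  evm A i 2 + tau * evm (mulq A gM) i 2 + tau ^+ 2 * evm (mulq A (mulq gM gM)) i 2.
Proof.
have D (x y : 'cV[C]_3) : (x + y) i 0 = x i 0 + y i 0 by rewrite mxE.
have Z (c : C) (x : 'cV[C]_3) : (c *: x) i 0 = c * x i 0 by rewrite mxE.
have E (M : 'M[C]_3) : (M *m e3v) i 0 = M i 2 by rewrite /e3v -colE mxE.
rewrite (@evmM A (mulq gM gM)) (@evmM A gM) (@evmM gM gM) -!E -!mulmxA.
rewrite /v0; move: (evm A) (evm gM) => M N.
by rewrite mulmxDr mulmxDr -scalemxAr -scalemxAr D D Z Z.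
Qed.

(** X + Y + Z divides X^3 + Y^3 + Z^3 - 3 X Y Z; here X, Y, Z are a, tau c, tau^2 d. *)
Lemma cubnorm_eq0 a c d : evq a + tau * evq c + tau ^+ 2 * evq d = 0 -> cubnorm a c d = q0.
Proof.
move=> h; apply: evq_inj.
rewrite /cubnorm !(evqB, evqD, evqM, evqzX, evqz) evq0 -tau3.
move: h; move: (tau) (evq a) (evq c) (evq d) => t x y z h.
pose w := x + t * y + t ^+ 2 * z.
rewrite [LHS](_ : _ = w * (x ^+ 2 + t ^+ 2 * y ^+ 2 + t ^+ 4 * z ^+ 2
   - t * x * y - t ^+ 2 * x * z - t ^+ 3 * y * z)); last by rewrite /w; ring.
by rewrite /w h mul0r.
Qed.

Lemma evm_subm A B : evm (subq A B) = evm A - evm B.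
Proof.
case: A => [[[[a11 a12] a13] [[a21 a22] a23]] [[a31 a32] a33]].
case: B => [[[[b11 b12] b13] [[b21 b22] b23]] [[b31 b32] b33]].
rewrite /evm /subq [map3 _ _]/map3 [map3 _ (a11, _, _, _, _)]/map3
  [map3 _ (b11, _, _, _, _)]/map3 /mxr3 !evqB.
by apply: mx3_eq => -[|[|[|//]]] [|[|[|//]]] _ _; rewrite !mxE !inordK.
Qed.

Lemma moves_z0P S : uq S -> act (cl S) z0 = z0 -> moves_z0 S = false.
Proof.
move=> uS /(fix_eigen uS)[x [c [zx Sx _]]].
have [t t0 zE] := z0_eigen.
have xE : x = t *: v0 by apply: (can_inj (mulKmx (P_unit))); rewrite -zx.
have Sv : evm S *m v0 = c *: v0.
  apply: (scalerI t0); rewrite scalemxAr -xE Sx xE !scalerA.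
  by rewrite mulrC.
have Gv : G *m v0 = tau^-1 *: v0.
  by rewrite -[in RHS]Gv0 scalerA mulVf ?tau_neq0 // scale1r.
have Cv i : (evm (subq (mulq gM S) (mulq S gM)) *m v0) i 0 = 0.
  rewrite (evm_subm (mulq gM S)) (@evmM gM S) (@evmM S gM) mulmxBl -!mulmxA.
  by rewrite Sv Gv -!scalemxAr Sv Gv !scalerA mulrC subrr mxE.
rewrite /moves_z0; move: (subq (mulq gM S) (mulq S gM)) Cv => D Dv.
have D0 := Dv 0; have D1 := Dv 1; have D2 := Dv 2.
move: D0 D1 D2; rewrite !mulv0 !evm02 !evm12 !evm22.
move: (mulq D gM) (mulq D (mulq gM gM)) => D' D''.
rewrite !lcolE => /cubnorm_eq0 -> /cubnorm_eq0 -> /cubnorm_eq0 ->.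
by rewrite eqxx.
Qed.

End FixedPoint.

(** * The stabilizer of z0 and the fixed point of j^4 *)

Section StabilizerGroup.
Local Open Scope ring_scope.
Local Open Scope sesquilinear_scope.

Local Open Scope group_scope.

Lemma gpow_uq g : g \in gpow -> uq g.
Proof.
have : all uq gpow by vm_compute.
by move/allP; apply.
Qed.

Lemma stab_ok_z0 S : uq S -> act (cl S) z0 = z0 -> stab_ok S ->
  exists2 g, g \in gpow & cl S = cl g.
Proof.
move=> uS Sz; rewrite /stab_ok (moves_z0P uS Sz) hasbE => /hasP[g gG e].
by exists g; [exact: gG | exact: (eqscq_cl (gpow_uq gG))].
Qed.

Lemma stab_z0 (s : Gamma R) : act s z0 = z0 -> exists2 g, g \in gpow & s = cl g.
Proof.
have [M uM ->] := cl_surj s => Mz.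
have sM := fix_shells uM (n2_z0) Mz.
have [gs [y1 [y2 [ugs gsI y1o y2o E]]]] := decomp uM sM.
move: gsI; rewrite inE => /orP[/eqP gsI|gsI].
  have Mo : act (cl M) origin = origin.
    by rewrite E gsI cl1 mulg1 !actM y2o y1o.
  have [k kK e] := stabP Mo; rewrite e in Mz *.
  apply: (stab_ok_z0 (Klist_uq kK) Mz).
  by have := stab_ok_Klist; rewrite allbE => /allP/(_ _ kK).
have := z0_stab_checkP; rewrite /z0_stab_check allbE => /allP/(_ _ gsI); rewrite allbE.
have [k1 k1K e1] := stabP y1o; have [k2 k2K e2] := stabP y2o.
have u1 := Klist_uq k1K; have u2 := Klist_uq k2K.
move=> /allP/(_ _ k1K); set m := mulq k1 gs.
have um : uq m := uqM u1 ugs.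
have mE : cl M = cl m * cl k2 by rewrite E e1 e2 (clM u1 ugs).
have mz : act (cl m) (act (cl k2) z0) = z0 by rewrite -actM -mE.
have g0 := act_g_z0.
(* m^-1 g m fixes k2.z0, which is as close to the origin as z0. *)
have -> : shells (e33 (mulq (invq m) (mulq gM m))) = true.
  apply: (@fix_shells _ (act (cl k2) z0)); last 1 first.
  - rewrite (clM (uqV um) (uqM uq_g um)) (clM uq_g um) (clV um).
    by rewrite !actM mz g0 -{1}mz -actM mulVg act1.
  - exact: (uqM (uqV um) (uqM uq_g um)).
  - by rewrite n2_stab; [exact: n2_z0 | exact: Klist_stab].
have uk := uqM u2 uq_g; have ugm := uqM uq_g um.
rewrite allbE => /allP/(_ _ k2K); rewrite (qdot_e33 m) (qdot_e33 (mulq gM m)).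
have -> : shells (e33 (mulq m (mulq k2 gM))) = true.
  apply: (fix_shells (uqM um uk) (n2_z0)).
  by rewrite (clM um uk) (clM u2 uq_g) !actM g0 mz.
have -> : shells (e33 (mulq (mulq gM m) (mulq k2 gM))) = true.
  apply: (fix_shells (uqM ugm uk) (n2_z0)).
  by rewrite (clM ugm uk) (clM u2 uq_g) (clM uq_g um) !actM g0 mz g0.
rewrite mE -(clM um u2) => ok; apply: (stab_ok_z0 (uqM um u2) _ ok).
by rewrite (clM um u2) actM mz.
Qed.

Local Open Scope ring_scope.

Lemma diag_fix (w : quad) (x : 'cV[C]_3) c : w <> q1 ->
  evm ((w, q0, q0), (q0, w, q0), (q0, q0, q1)) *m x = c *: x -> x 2 0 != 0 ->
  x 0 0 = 0 /\ x 1 0 = 0.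
Proof.
move=> w1 e x3.
have row i : (evm ((w, q0, q0), (q0, w, q0), (q0, q0, q1)) *m x) i 0 = c * x i 0.
  by rewrite e mxE.
have := row 0; have := row 1; have := row 2.
rewrite /evm [map3 _ _]/map3 /mxr3 mx3_col evq0 evq1 !mxE /= !mul0r !add0r !addr0 => r2 r1 r0.
have c1 : c = 1 by apply/esym/(mulIf x3).
have w0 : evq w - 1 != 0.
  by rewrite subr_eq0; apply/eqP; rewrite -(evq1) => /evq_inj.
split; apply: (mulfI w0); rewrite mulr0 mulrBl mul1r.
  by rewrite r0 c1 mul1r subrr.
by rewrite r1 c1 mul1r subrr.
Qed.

Lemma j4_fix (p : B2 R) : act (cl j4M) p = p -> p = origin.
Proof.
move=> /(fix_eigen uq_j4)[x [c [px jx _]]].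
have jE : j4M = ((qzX 4, q0, q0), (q0, qzX 4, q0), (q0, q0, q1)) by vm_compute.
have w1 : qzX 4 <> q1 by vm_compute.
move: jx; rewrite jE => jx.
have d0 := dsqrt_neq0 R.
have x3 : x 2 0 != 0.
  apply/eqP => x3; have := P2 x; rewrite -px x3 mulr0 mxE /= => /eqP.
  by rewrite oner_eq0.
have [x0 x1] := diag_fix w1 jx x3.
have h0 : (hz p) 0 0 = 0 by rewrite px Dgamma0 mx3_col x0 x1 mxE /=; ring.
have h1 : (hz p) 1 0 = 0 by rewrite px Dgamma0 mx3_col x0 x1 mxE /=; ring.
move: h0 h1; rewrite !mxE /= => h0 h1.
by apply: n2_eq0; rewrite /n2 h0 h1 /nsq /=; ring.
Qed.

End StabilizerGroup.

(** * Fixed orbits *)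

Section Main.
Local Open Scope group_scope.

Definition sig (x : X R) : X R := orbX (act j4 (repr x)).

Lemma sigE p : sig (orbX p) = orbX (act j4 p).
Proof.
have /orbXP[g gP e] : orbX (repr (orbX p)) = orbX p by exact: reprK.
apply/orbXP; exists (j4 * g * j4^-1); first exact: PiGroup_conj.
by rewrite {1}e -!actM mulgVK.
Qed.

Lemma j4_cube : j4 * (j4 * j4) = 1.
Proof.
rewrite -cl_j4 -(clM uq_j4 uq_j4) -(clM uq_j4 (uqM uq_j4 uq_j4)).
have -> : mulq j4M (mulq j4M j4M) = Iq by vm_compute.
exact: cl1.
Qed.

Lemma sig_cube x : sig (sig (sig x)) = x.
Proof.
rewrite -[x]reprK -!/(orbX _) !sigE -!actM.
by rewrite -mulgA j4_cube act1.
Qed.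

Lemma sig_bij : bijective sig.
Proof. by exists (sig \o sig) => x /=; apply: sig_cube. Qed.

Lemma sig_fix p : sig (orbX p) = orbX p -> exists2 g, PiGroup R g & act (g * j4) p = p.
Proof. by rewrite sigE => /orbXP[g gP e]; exists g; rewrite // actM -e. Qed.

Lemma fix_sig t y q : act y q = q -> PiGroup R (t * y * t^-1 * j4^-1) ->
  sig (orbX (act t q)) = orbX (act t q).
Proof.
move=> yq tP; rewrite sigE; apply/orbXP; exists (t * y * t^-1 * j4^-1) => //.
by rewrite -!actM mulgVK mulgVK actM yq.
Qed.

(** Since j^4 normalizes Pi, the coset Pi j^4 is stable under conjugation by Pi. *)
Lemma untwist p y : PiGroup R p -> PiGroup R (p * y * p^-1 * j4^-1) -> PiGroup R (y * j4^-1).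
Proof.
move=> pP h; have := PiGroupM (PiGroupV pP) (PiGroupM h (PiGroup_conj pP)).
by move: (j4) => J; rewrite !mulgA mulgVK mulgVK mulVg mul1g.
Qed.

Lemma testPi_conj A B : uq A -> uq B ->
  testPi (mulq (mulq A (mulq B (invq A))) j4V) <->
  PiGroup R (cl A * cl B * (cl A)^-1 * j4^-1).
Proof.
move=> uA uB; have uV := uqV uA; have uBV := uqM uB uV; have u := uqM uA uBV.
have -> : cl A * cl B * (cl A)^-1 * j4^-1 = cl (mulq (mulq A (mulq B (invq A))) j4V).
  by rewrite (clM u uq_j4V) (clM uA uBV) (clM uB uV) (clV uA) cl_j4V !mulgA.
have u' := uqM u uq_j4V.
by split=> h; [exact: (test_PiGroup u' h)|exact: (PiGroup_test u' h)].
Qed.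

Lemma testPi_conj_b n k : k \in Klist ->
  testPi (mulq (mulq (bpow n) (mulq k (bpV n))) j4V) <->
  PiGroup R (bb n * cl k * (bb n)^-1 * j4^-1).
Proof.
move=> /Klist_uq uk; have ub := uq_bpow n; have uV := uq_bpV n.
have u1 := uqM uk uV; have u2 := uqM ub u1; have u3 := uqM u2 uq_j4V.
have -> : bb n * cl k * (bb n)^-1 * j4^-1 = cl (mulq (mulq (bpow n) (mulq k (bpV n))) j4V).
  by rewrite (clM u2 uq_j4V) (clM ub u1) (clM uk uV) cl_bpV cl_j4V !mulgA.
by split=> h; [exact: (test_PiGroup u3 h)|exact: (PiGroup_test u3 h)].
Qed.

Lemma orbX_act g p : PiGroup R g -> orbX (act g p) = orbX p.
Proof. by move=> gP; apply/esym/orbXP; exists g. Qed.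

Lemma gpow_z0 g : g \in gpow -> act (cl g) z0 = z0.
Proof.
have g0 := act_g_z0; rewrite /gpow.
have g2 : act (cl (mulq gM gM)) z0 = z0 by rewrite (clM uq_g uq_g) actM g0.
move: (gM) (mulq gM gM) g0 g2 => A B g0 g2; rewrite !inE.
by case/or3P=> /eqP->; [rewrite cl1 act1 | exact: g0 | exact: g2].
Qed.

Lemma z0_hits_orbit t : t \in bK -> uq t -> PiGroup R (cl t * cl gM * (cl t)^-1 * j4^-1) ->
  exists2 h, h \in z0_reps & orbX (act (cl t) z0) = orbX (act (cl h) z0).
Proof.
move=> tT ut /(testPi_conj ut uq_g) tt.
have th : t \in z0_hits by rewrite mem_filter tt tT.
have /and5P[_] := z0_orbits_checkP; rewrite !allbE => uh /allP/(_ t th).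
rewrite hasbE => /hasP[h hh]; rewrite /linked hasbE => /hasP[g gg] lk _ _.
have {}uh := allP uh h hh; have ug := gpow_uq gg; have uV := uqV uh.
exists h; first exact: hh.
have gh := uqM ug uV.
have : PiGroup R (cl (mulq t (mulq g (invq h)))) := test_PiGroup (uqM ut gh) lk.
rewrite (clM ut gh) (clM ug uV) (clV uh) => /(orbX_act (act (cl h) z0)) <-.
have gz : act (cl g) z0 = z0.
  exact: gpow_z0.
by rewrite !actM -(actM (cl h)^-1) mulVg act1 gz.
Qed.

Lemma conj_untwist (x y g i : Gamma R) :
  x * (y * ((x * y)^-1 * (g * i) * (x * y)) * y^-1) * x^-1 * i^-1 = g.
Proof. by rewrite !invgM !mulgA !mulgK mulgV mul1g. Qed.

Lemma conj_mul (x y m : Gamma R) : x * (y * m * y^-1) * x^-1 = (x * y) * m * (x * y)^-1.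
Proof. by rewrite invgM !mulgA. Qed.

Lemma fixed_orbits p : sig (orbX p) = orbX p ->
  (exists2 n, (n < 3)%N & orbX p = orbX (act (bb n) origin)) \/
  (exists2 h, h \in z0_reps & orbX p = orbX (act (cl h) z0)).
Proof.
move=> /sig_fix[g gP gp].
have [x xs] := exists_small p.
(* Gives p = q b^n z with q in Pi and z = y x p still near the origin; [m] is g j^4 carried back to
   fix z. *)
have [q [n [y [qP n3 y0 xE]]]] := PibK_all x^-1.
pose z := act (y * x) p.
have zs : (n2 z <= 1 / 2)%R by rewrite /z actM n2_stab.
have pE : p = act (q * bb n) z.
  by rewrite /z -actM mulgA -xE mulVg act1.
pose m := (q * bb n)^-1 * (g * j4) * (q * bb n).
have mz : act m z = z.
  by rewrite /m (actM (_ * _) _ z) -pE (actM _ (g * j4)) gp pE -actM mulVg act1.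
have mP : PiGroup R (bb n * m * (bb n)^-1 * j4^-1).
  apply: (untwist qP); suff -> : q * (bb n * m * (bb n)^-1) * q^-1 * j4^-1 = g by [].
  exact: conj_untwist.
have orbT w : orbX (act (q * w) z) = orbX (act w z) by rewrite actM orbX_act.
have [M uM mE] := cl_surj m; rewrite mE in mz.
have sM := fix_shells uM zs mz.
have [gs [y1 [y2 [ugs gsI y1o y2o E]]]] := decomp uM sM.
move: gsI; rewrite inE => /orP[/eqP gsI|gsI].
  have Mo : act (cl M) origin = origin.
    by rewrite E gsI cl1 mulg1 !actM y2o y1o.
  have [k kK e] := stabP Mo; left; exists n; first exact: n3.
  move: mP; rewrite mE e => /(testPi_conj_b n kK) tk.
  have := twist_stab_checkP; rewrite /twist_stab_check allbE => /allP/(_ n).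
  rewrite mem_iota => /(_ n3); rewrite allbE => /allP/(_ k kK); rewrite tk => /eqP kJ.
  have zo : z = origin by apply: j4_fix; rewrite -kJ -e.
  by rewrite pE orbT zo.
right.
(* Conjugation by y1 brings the element to the form gs k of [elliptic_twist]. *)
have [k1 k1K e1] := stabP y1o; have [k kK e] := stabP (stabM y2o y1o).
pose z' := act y1^-1 z.
have zE : z = act y1 z' by rewrite /z' -actM mulgV act1.
have z's : (n2 z' <= 1 / 2)%R by rewrite /z' n2_stab; [exact: zs | exact: stabV].
have m'E : cl M = y1 * (cl gs * cl k) * y1^-1 by rewrite E -e !mulgA mulgK.
have m'z : act (cl gs * cl k) z' = z'.
  have -> : cl gs * cl k = y1^-1 * cl M * y1 by rewrite m'E !mulgA mulVg mul1g mulgVK.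
  by rewrite !actM -zE mz.
have m'P : PiGroup R (bb n * cl k1 * (cl gs * cl k) * (bb n * cl k1)^-1 * j4^-1).
  move: mP; rewrite mE m'E e1.
  suff -> : bb n * (cl k1 * (cl gs * cl k) * (cl k1)^-1) * (bb n)^-1 =
    bb n * cl k1 * (cl gs * cl k) * (bb n * cl k1)^-1 by [].
  exact: conj_mul.
have [h hE] := elliptic_twist ugs gsI kK n3 k1K z's m'z m'P.
have hz' : act h^-1 z' = z0.
  apply: fix_g_uniq; rewrite -{2}m'z hE !actM.
  by rewrite -(actM h^-1 h) mulVg act1.
(* p is now a translate of z0 by q b^n y1 h; modulo Pi the translation is one of the finitely many
   b^nu k'. *)
have [q2 [nu [y' [q2P nu3 /stabP[k' k'K y'E] tE]]]] := PibK_all (bb n * y1 * h).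
have uk' := Klist_uq k'K; have ut := uqM (uq_bpow nu) uk'.
have tT : cl (mulq (bpow nu) k') = bb nu * cl k' by rewrite (clM (uq_bpow nu) uk').
have pt : orbX p = orbX (act (cl (mulq (bpow nu) k')) z0).
  have z'E : z' = act h z0 by rewrite -hz' -actM mulgV act1.
  by rewrite pE orbT zE z'E -!actM tE y'E -mulgA (actM q2) (orbX_act _ q2P) tT.
have [] := z0_hits_orbit (bK_P nu3 k'K) ut; last first.
  by move=> h' h'I e'; exists h'; [exact: h'I|rewrite pt].
apply: (untwist q2P); set t := cl (mulq _ _) in tT *.
suff -> : q2 * (t * cl gM * t^-1) * q2^-1 = bb n * m * (bb n)^-1 by [].
rewrite tT mE m'E hE.
have -> : bb n * (y1 * (h * cl gM * h^-1) * y1^-1) * (bb n)^-1 =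
  (bb n * y1 * h) * cl gM * (bb n * y1 * h)^-1.
  by rewrite (conj_mul y1 h) conj_mul mulgA.
by rewrite tE y'E (conj_mul q2) (mulgA q2).
Qed.

Lemma sig_bb n : (n < 3)%N -> sig (orbX (act (bb n) origin)) = orbX (act (bb n) origin).
Proof.
move=> n3; have jK : j4M \in Klist by vm_compute.
apply: (@fix_sig _ (cl j4M)); first exact: Klist_stab.
apply/(testPi_conj_b n jK).
have := twist_b_checkP; rewrite /twist_b_check allbE => /allP/(_ n); rewrite mem_iota => /(_ n3) h.
exact: h.
Qed.

Lemma sig_z0_reps h : h \in z0_reps -> sig (orbX (act (cl h) z0)) = orbX (act (cl h) z0).
Proof.
have /and5P[_] := z0_orbits_checkP; rewrite !allbE => /allP uh _ /allP hP _ hI.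
apply: (@fix_sig _ (cl gM)); first exact: act_g_z0.
by apply/(testPi_conj (uh _ hI) uq_g); exact: hP.
Qed.

Lemma bb_inj n m : (n < 3)%N -> (m < 3)%N ->
  orbX (act (bb n) origin) = orbX (act (bb m) origin) -> n = m.
Proof.
move=> n3 m3 /orbXP[g gP e].
have : act ((bb n)^-1 * g^-1 * bb m) origin = origin.
  by rewrite !actM e -(actM g^-1) mulVg act1 -actM mulVg act1.
move/stabP=> [k kK kE].
suff kP : PiGroup R (bb n * cl k * (bb m)^-1) by have [] := PiGroup_bKb n3 m3 kK kP.
by rewrite -kE !mulgA mulgV mul1g mulgK; exact: PiGroupV.
Qed.

(** A translate of the origin with |z|^2 <= 1/2 is the origin, which buv does not fix. *)
Lemma z0_not_origin x : act x origin <> z0.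
Proof.
have [A uA ->] := cl_surj x => Az.
have := nsq_e33 uA; rewrite Az => c1; have zs := n2_z0.
have c2 : (nsq (evq (e33 A)) <= 2)%R.
  by move: c1 zs (nsq_ge0 (evq (e33 A))); move: (nsq _) (n2 _) => s t; clear; nra.
have sA : shell1 (e33 A).
  have sh : shells (e33 A) by apply: (shells_bound uA); apply: le_trans c2 _; lra.
  by have [_ [//|]] := shells_nsq sh; rewrite ltNge c2.
have Ao := (stab_shell uA).2 sA; rewrite Ao in Az.
have := act_g_z0; rewrite -Az => /(stab_shell uq_g).
by apply/negP; vm_compute.
Qed.

Lemma bb_z0_reps n h : orbX (act (bb n) origin) <> orbX (act (cl h) z0).
Proof.
move=> /orbXP[g _ e]; apply: (@z0_not_origin ((cl h)^-1 * g * bb n)).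
by rewrite !actM -e -actM mulVg act1.
Qed.

(** If h' z0 = g h z0 with g in Pi, then h^-1 g^-1 h' fixes z0, hence is in [gpow], so the pair is
    [linked]. *)
Lemma z0_reps_inj n m : (n < 6)%N -> (m < 6)%N ->
  orbX (act (cl (nth Iq z0_reps n)) z0) = orbX (act (cl (nth Iq z0_reps m)) z0) -> n = m.
Proof.
have /and5P[/eqP sz] := z0_orbits_checkP; rewrite !allbE => /allP uh _ _ lk n6 m6.
move/allP/(_ n): lk; rewrite mem_iota => /(_ n6); rewrite allbE => /allP/(_ m).
rewrite mem_iota => /(_ m6).
have := uh _ (mem_nth Iq (_ : n < size z0_reps)); have := uh _ (mem_nth Iq (_ : m < size z0_reps)).
rewrite sz => /(_ m6) um /(_ n6) un.
move: (nth Iq z0_reps n) (nth Iq z0_reps m) um un => h h' uh' uh'' + /orbXP[g gP e].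
have [g' gg' gE] : exists2 g', g' \in gpow & (cl h)^-1 * g^-1 * cl h' = cl g'.
  by apply: stab_z0; rewrite !actM e -(actM g^-1) mulVg act1 -actM mulVg act1.
suff -> : linked h h' by move=> /eqP.
rewrite /linked hasbE; apply/hasP; exists g'; first exact: gg'.
have ug := gpow_uq gg'; have uV := uqV uh'; have u1 := uqM ug uV.
suff gP' : PiGroup R (cl (mulq h (mulq g' (invq h')))) by exact: (PiGroup_test (uqM uh'' u1) gP').
rewrite (clM uh'' u1) (clM ug uV) (clV uh') -gE !mulgA mulgV mul1g mulgK.
exact: PiGroupV.
Qed.

Definition fixpt (i : nat) : X R :=
  if (i < 3)%N then orbX (act (bb i) origin)
  else orbX (act (cl (nth Iq z0_reps (i - 3))) z0).

Lemma fixpt_inj n m : (n < 9)%N -> (m < 9)%N -> fixpt n = fixpt m -> n = m.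
Proof.
move=> n9 m9; rewrite /fixpt; case: ltnP => n3; case: ltnP => m3.
- exact: bb_inj.
- by move/bb_z0_reps.
- by move/esym/bb_z0_reps.
move/z0_reps_inj; rewrite !ltn_subLR // => /(_ n9 m9) e.
by rewrite -(subnK n3) e subnK.
Qed.

Lemma sig_fixpt x : sig x = x <-> exists2 i, (i < 9)%N & x = fixpt i.
Proof.
have sz : size z0_reps = 6 by have /and5P[/eqP] := z0_orbits_checkP.
split=> [|[i i9 ->]]; last first.
  rewrite /fixpt; case: ltnP => i3; first exact: sig_bb.
  by apply/sig_z0_reps/mem_nth; rewrite sz ltn_subLR.
rewrite -[x]reprK -!/(orbX _) => /fixed_orbits[[n n3 ->]|[h hI ->]].
  by exists n; rewrite ?(leq_trans n3) // /fixpt n3.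
exists (index h z0_reps + 3); first by rewrite -[9]/(6 + 3)%N ltn_add2r -sz index_mem.
by rewrite /fixpt ltnNge leq_addl /= addnK nth_index.
Qed.

End Main.

End Proof.

Local Open Scope classical_set_scope.
Local Open Scope card_scope.
Local Open Scope group_scope.

Theorem proposition3p6 (R : realType) :
  exists sigma : X R -> X R,
    [/\ bijective sigma,
        forall p : B2 R, sigma (orbX p) = orbX (act (j ^+ 4) p)
      & exists (z0 : B2 R) (h : 'I_6 -> Gamma R),
          [/\ act (b * u * v) z0 = z0,
              forall p : B2 R, act (b * u * v) p = p -> p = z0,
              [set x | sigma x = x] #= `I_9
            & [set x | sigma x = x] =
                [set orbX (origin R); orbX (act b (origin R));
                     orbX (act b^-1 (origin R))]
                `|` [set orbX (act (h i) z0) | i in [set: 'I_6]]]].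
Proof.
exists (@sig R); split; [exact: sig_bij | exact: sigE |].
exists (z0 R), (fun i => cl R (nth Iq z0_reps i)).
rewrite -(cl_g R); split; [exact: act_g_z0 | exact: fix_g_uniq | |].
  have -> : [set x | sig x = x] = (@fixpt R) @` `I_9.
    apply/seteqP; split=> x /=; first by case/sig_fixpt => i i9 ->; exists i.
    by case=> i i9 <-; apply/sig_fixpt; exists i.
  by apply: inj_card_eq => m n; rewrite !inE; exact: fixpt_inj.
have b0 : bb R 0 = 1 by exact: cl1.
have b1 : bb R 1 = b by exact: cl_b.
have b2 : bb R 2 = b^-1 by exact: cl_bV.
rewrite -b2 -b1; apply/seteqP; split=> x /=.
  case/sig_fixpt => i i9 ->; rewrite /fixpt; case: ltnP => i3.
    left; case: i i3 {i9} => [|[|[|//]]] _.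
    - by left; left; rewrite b0 act1.
    - by left; right.
    - by right.
  have i6 : (i - 3 < 6)%N by rewrite ltn_subLR.
  by right; exists (Ordinal i6).
move=> h; apply/sig_fixpt; case: h => [[[->|->]|->]|[i _ <-]].
- by exists 0%N; rewrite // /fixpt b0 act1.
- by exists 1%N.
- by exists 2%N.
exists (i + 3)%N; first by rewrite -[9]/(6 + 3)%N ltn_add2r.
by rewrite /fixpt ltnNge leq_addl /= addnK.
Qed.
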